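(* Let $C\subset\mathbb{R}^3$ be a convex body and let $r_0\in\partial C$ be a ridge point at which the tangent cone to $C$ is the dihedral angle $\{r : (r-r_0,e_1)\le 0,\ (r-r_0,e_2)\le 0\}$, where $e_1,e_2$ are unit vectors with $e_1\neq\pm e_2$. Let $e=\lambda_1e_1+\lambda_2e_2$ with $\lambda_1>0$, $\lambda_2>0$, $|e|=1$, and let $\nu_t=\nu_{t,e,r_0,C}$ be the associated normalized measures on $S^2$. If the set $B_0=C\cap\{r:(r-r_0,e)=0\}$ is a non-degenerate line segment, then $\nu_t$ converges weakly to $\lambda_1\delta_{e_1}+\lambda_2\delta_{e_2}$ as $t\to0^+$.
   Context: A convex body is a convex compact set with nonempty interior. $(\cdot,\cdot)$ is the scalar product in $\mathbb{R}^3$. The tangent cone to $C$ at $r_0$ is the closure of the union of all rays with vertex $r_0$ through points of $C\setminus\{r_0\}$; $r_0\in\partial C$ is a ridge point if the tangent cone at $r_0$ is a dihedral angle as described in the claim. $|A|$ denotes the area (2-dimensional Lebesgue/Hausdorff measure) of a Borel set $A$ contained in a plane or in the convex surface $\partial C$. $\partial'C$ is the set of regular points of $\partial C$ (points with a unique plane of support); it has full measure in $\partial C$. For $r\in\partial'C$, $n_r$ is the outward unit normal to $C$ at $r$. For $t>0$ put $B_t=C\cap\{r:(r-r_0,e)=-t\}$ and $S_t=\partial C\cap\{r:(r-r_0,e)\ge -t\}$. For all sufficiently small $t>0$ one has $|B_t|>0$, and the measure $\nu_t=\nu_{t,e,r_0,C}$ on $S^2$ is defined by $\nu_t(A)=\frac{1}{|B_t|}\,|\{r\in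 S_t\cap\partial'C : n_r\in A\}|$ for Borel sets $A\subset S^2$. Weak convergence $\nu_t\to\nu_*$ as $t\to0$ means $\int_{S^2}f\,d\nu_t\to\int_{S^2}f\,d\nu_*$ for every continuous function $f$ on $S^2$. $\delta_v$ is the unit point mass at $v\in S^2$. *)

(* Defs.v *)
From HB Require Import structures.
From mathcomp Require Import all_boot all_order all_algebra.
From mathcomp Require Import all_classical all_reals all_analysis.
Set Implicit Arguments.
Unset Strict Implicit.
Unset Printing Implicit Defensive.
Import Order.TTheory GRing.Theory Num.Theory.
Import numFieldNormedType.Exports.
Local Open Scope classical_set_scope.
Local Open Scope ring_scope.

(* The library norm on row vectors is the
   sup norm (same topology); all metric notions below use [enorm] instead. *)

Definition dot (R : realType) (u v : 'rV[R]_3) : R := \sum_(i < 3) u 0 i * v 0 i.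

Definition enorm (R : realType) (u : 'rV[R]_3) : R := Num.sqrt (dot u u).

(* The point 0 is added so that the diameter of the empty set is 0, not -oo. *)
Definition ediam (R : realType) (U : set 'rV[R]_3) : \bar R :=
  ereal_sup (0%E |` [set (enorm (x - y))%:E | x in U & y in U]).

Definition hausdorff2_pre (R : realType) (delta : R) (A : set 'rV[R]_3) : \bar R :=
  ereal_inf
    [set (\sum_(0 <= i <oo) ((pi / 4)%:E * ediam (U i) ^+ 2))%E
      | U in [set U : (set 'rV[R]_3)^nat |
               A `<=` \bigcup_i U i /\ forall i, (ediam (U i) <= delta%:E)%E]].

(* Two-dimensional Hausdorff measure; the factor [pi / 4], the area of a disc
   of diameter 1, makes it coincide with Lebesgue measure on planes. *)
Definition area (R : realType) (A : set 'rV[R]_3) : \bar R :=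
  ereal_sup [set hausdorff2_pre delta A | delta in [set delta : R | 0 < delta]].

Definition convex_body (R : realType) (C : set 'rV[R]_3) : Prop :=
  [/\ convex_set (C : set (convex_lmodType 'rV[R]_3)), compact C & C^° !=set0].

Definition bd (R : realType) (C : set 'rV[R]_3) : set 'rV[R]_3 :=
  closure C `\` C^°.

Definition segment (R : realType) (p q : 'rV[R]_3) : set 'rV[R]_3 :=
  [set (1 - s) *: p + s *: q | s in [set s : R | 0 <= s <= 1]].

Definition tangent_cone (R : realType) (C : set 'rV[R]_3) (r0 : 'rV[R]_3) :
    set 'rV[R]_3 :=
  closure [set r0 + s *: (p - r0) | s in [set s : R | 0 <= s] & p in C `\ r0].

Definition outward_unit_normal (R : realType) (C : set 'rV[R]_3)
    (r n : 'rV[R]_3) : Prop :=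
  enorm n = 1 /\ forall x, C x -> dot (x - r) n <= 0.

Definition support_plane (R : realType) (C : set 'rV[R]_3) (r : 'rV[R]_3)
    (P : set 'rV[R]_3) : Prop :=
  exists2 n, outward_unit_normal C r n & P = [set x | dot (x - r) n = 0].

Definition regular_bd (R : realType) (C : set 'rV[R]_3) : set 'rV[R]_3 :=
  [set r | bd C r /\ exists! P, support_plane C r P].

(* Meaningful for [r] in [regular_bd C], where the outward unit normal of a
   convex body is unique. *)
Definition normal (R : realType) (C : set 'rV[R]_3) (r : 'rV[R]_3) : 'rV[R]_3 :=
  get (outward_unit_normal C r).

Definition slice (R : realType) (C : set 'rV[R]_3) (r0 e : 'rV[R]_3) (t : R) :
    set 'rV[R]_3 :=
  C `&` [set r | dot (r - r0) e = - t].

Definition cap (R : realType) (C : set 'rV[R]_3) (r0 e : 'rV[R]_3) (t : R) :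
    set 'rV[R]_3 :=
  bd C `&` [set r | - t <= dot (r - r0) e].

Definition sphere2 (R : realType) : set 'rV[R]_3 := [set x | enorm x = 1].
Arguments sphere2 {R}.

(* R^3 with its Borel sigma-algebra. *)
Notation borel3 R := (g_sigma_algebraType (@open 'rV[R]_3)).

(* Measures on the sphere are encoded as set functions on [borel3 R], integrated
   over [sphere2]. *)
Definition nu (R : realType) (C : set 'rV[R]_3) (r0 e : 'rV[R]_3) (t : R) :
    set (borel3 R) -> \bar R :=
  fun A => (((fine (area (slice C r0 e t)))^-1)%:E *
    area (cap C r0 e t `&` regular_bd C `&` [set r | A (normal C r)]))%E.

Definition nu_star (R : realType) (l1 l2 : R) (e1 e2 : 'rV[R]_3) :
    set (borel3 R) -> \bar R :=
  fun A => (l1%:E * dirac (e1 : borel3 R) A + l2%:E * dirac (e2 : borel3 R) A)%E.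

Definition weakly_converges (R : realType) (m : R -> set (borel3 R) -> \bar R)
    (m0 : set (borel3 R) -> \bar R) : Prop :=
  forall f : 'rV[R]_3 -> R, {within sphere2, continuous f} ->
    (\int[m t]_(x in (sphere2 : set (borel3 R))) (f x)%:E)%E @[t --> 0^'+] -->
    (\int[m0]_(x in (sphere2 : set (borel3 R))) (f x)%:E)%E.

(* Main.v *)
Require Import Defs.
From HB Require Import structures.
From mathcomp Require Import all_boot all_order all_algebra.
From mathcomp Require Import all_classical all_reals all_analysis.
From mathcomp Require Import ring lra.
Set Implicit Arguments.
Unset Strict Implicit.
Unset Printing Implicit Defensive.
Import Order.TTheory GRing.Theory Num.Theory.
Import numFieldNormedType.Exports.
Local Open Scope classical_set_scope.
Local Open Scope ring_scope.

(* Near the ridge, [C] lies in the wedge cut off at depth [t], a thin prism over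
   the segment [B_0]; its faces on [e1] and [e2] have areas [l1 w t] and [l2 w t]
   up to [o(t)], where [w t] is the area of its base, and its two ends have area
   [O(t^2)].
   - Moving the points of the cap of [C] along their outward normals to the
     boundary of the prism never decreases distances and almost misses the base,
     hence the area of the cap is at most [(l1 + l2) w t + o(t)].
   - A small ball pushed from inside [C] towards the face on [ei], until it
     touches the boundary of [C], does so at a regular point whose normal is close
     to [ei], and touching points are at least as far apart as the starting
     points; hence the points with normal near [ei] have area at least
     [li w t - o(t)].
   - The slice has area [w t + o(t)]. After normalization, the total mass is at
     most [l1 + l2 + o(1)] and the mass near [ei] is at least [li - o(1)], so the
     mass concentrates at [e1] and [e2]. *)

(** * Euclidean geometry *)

(** Both comparisons of areas rest on one principle: a map that never decreases distances never
    decreases [area], because covers of the target pull back to covers by sets of no larger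
    diameter. The curved surface is therefore never parametrized. For the upper bound the cap is
    mapped into flat pieces, for the lower bound a flat rectangle is mapped into the cap, and both
    times the monotonicity of outward normals gives the expansion. The length [Q - P] of the segment
    is positive, so the faces have area of exact order [t]; this is what makes the two ends
    negligible. The lower bound plays on two scales: the balls have radius [delta * theta * t],
    while there is room of order [delta * t] inside [C] around them. The ratio [theta] bounds the
    tilt of the normal, and [delta] the part of the face that is lost. As defined, [nu] is a mere
    set function. It becomes a measure because preimages of Borel sets under the normal map are
    Caratheodory measurable for the area restricted to regular points. *)

Section Euclid.
Variable R : realType.
Implicit Types (u v w x y z : 'rV[R]_3) (a b : R).

Lemma dotE u v : dot u v = u 0 0 * v 0 0 + u 0 1 * v 0 1 + u 0 2%:R * v 0 2%:R.
Proof.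
rewrite /dot !big_ord_recl big_ord0 addr0 addrA.
by congr (_ * _ + _ * _ + _ * _); congr (_ 0 _); apply/val_inj.
Qed.

Lemma dotC u v : dot u v = dot v u.
Proof. by apply: eq_bigr => i _; rewrite mulrC. Qed.

Lemma dotDl u v w : dot (u + v) w = dot u w + dot v w.
Proof. by rewrite -big_split; apply: eq_bigr => i _; rewrite mxE mulrDl. Qed.

Lemma dotZl a u v : dot (a *: u) v = a * dot u v.
Proof. by rewrite /dot mulr_sumr; apply: eq_bigr => i _; rewrite mxE mulrA. Qed.

Lemma dotNl u v : dot (- u) v = - dot u v.
Proof. by rewrite -scaleN1r dotZl mulN1r. Qed.

Lemma dotBl u v w : dot (u - v) w = dot u w - dot v w.
Proof. by rewrite dotDl dotNl. Qed.

Lemma dotDr u v w : dot w (u + v) = dot w u + dot w v.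
Proof. by rewrite dotC dotDl !(dotC w). Qed.

Lemma dotZr a u v : dot v (a *: u) = a * dot v u.
Proof. by rewrite dotC dotZl dotC. Qed.

Lemma dotNr u v : dot v (- u) = - dot v u.
Proof. by rewrite dotC dotNl dotC. Qed.

Lemma dotBr u v w : dot w (u - v) = dot w u - dot w v.
Proof. by rewrite dotDr dotNr. Qed.

Lemma dot0l u : dot 0 u = 0.
Proof. by rewrite -(scale0r 0) dotZl mul0r. Qed.

Lemma dot0r u : dot u 0 = 0.
Proof. by rewrite dotC dot0l. Qed.

Definition dot_linE :=
  (dotDl, dotDr, dotBl, dotBr, dotZl, dotZr, dotNl, dotNr, dot0l, dot0r).

Lemma dot_ge0 u : 0 <= dot u u.
Proof. by rewrite sumr_ge0// => i _; rewrite -expr2 sqr_ge0. Qed.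

Lemma dot_eq0 u : dot u u = 0 -> u = 0.
Proof.
move=> /eqP; rewrite psumr_eq0 => [/allP h|i _]; last by rewrite -expr2 sqr_ge0.
apply/rowP => i; have /eqP := h i (mem_index_enum _).
by rewrite mxE => /eqP; rewrite mulf_eq0 orbb => /eqP.
Qed.

Lemma enorm_ge0 u : 0 <= enorm u.
Proof. exact: sqrtr_ge0. Qed.

Lemma sqr_enorm u : enorm u ^+ 2 = dot u u.
Proof. by rewrite sqr_sqrtr// dot_ge0. Qed.

Lemma enorm0 : enorm (0 : 'rV[R]_3) = 0.
Proof. by rewrite /enorm dot0l sqrtr0. Qed.

Lemma enorm0_eq0 u : enorm u = 0 -> u = 0.
Proof. by move=> h; apply: dot_eq0; rewrite -sqr_enorm h expr0n. Qed.

Lemma enorm_gt0 u : u <> 0 -> 0 < enorm u.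
Proof.
move=> u0; rewrite lt_def enorm_ge0 andbT; apply/eqP => h.
exact/u0/enorm0_eq0.
Qed.

Lemma enormN u : enorm (- u) = enorm u.
Proof. by rewrite /enorm dotNl dotNr opprK. Qed.

Lemma enormB u v : enorm (u - v) = enorm (v - u).
Proof. by rewrite -enormN opprB. Qed.

Lemma enormZ a u : enorm (a *: u) = `|a| * enorm u.
Proof. by rewrite /enorm dotZl dotZr mulrA -expr2 sqrtrM ?sqr_ge0// sqrtr_sqr. Qed.

Lemma enorm_le u a : 0 <= a -> dot u u <= a ^+ 2 -> enorm u <= a.
Proof. by move=> a0 h; rewrite -(ger0_norm a0) -sqrtr_sqr ler_wsqrtr. Qed.

Lemma enorm1_dot u : enorm u = 1 -> dot u u = 1.
Proof. by move=> h; rewrite -sqr_enorm h expr1n. Qed.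

Lemma dot1_enorm u : dot u u = 1 -> enorm u = 1.
Proof. by move=> h; rewrite /enorm h sqrtr1. Qed.

Lemma enorm_le_enorm u v : dot u u <= dot v v -> enorm u <= enorm v.
Proof. by move=> h; rewrite ler_wsqrtr. Qed.

Lemma cauchy_schwarz u v : dot u v <= enorm u * enorm v.
Proof.
have [->|u0] := pselect (u = 0); first by rewrite dot0l enorm0 mul0r.
have [->|v0] := pselect (v = 0); first by rewrite dot0r enorm0 mulr0.
have nu := enorm_gt0 u0; have nv := enorm_gt0 v0.
have := dot_ge0 (enorm v *: u - enorm u *: v).
rewrite !dot_linE -!sqr_enorm (dotC v u) => h.
have {}h : 0 <= (enorm u * enorm v - dot u v) * (2 * (enorm u * enorm v)).
  by apply: le_trans h _; rewrite le_eqVlt; apply/orP; left; apply/eqP; ring.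
by rewrite pmulr_lge0 ?mulr_gt0// subr_ge0 in h.
Qed.

Lemma cauchy_schwarz_abs u v : `|dot u v| <= enorm u * enorm v.
Proof.
rewrite ler_norml cauchy_schwarz andbT lerNl -dotNl.
by rewrite -[enorm u]enormN cauchy_schwarz.
Qed.

Lemma enormD u v : enorm (u + v) <= enorm u + enorm v.
Proof.
apply: enorm_le; first by rewrite addr_ge0 ?enorm_ge0.
have := cauchy_schwarz u v.
rewrite !dot_linE sqrrD !sqr_enorm (dotC v u); lra.
Qed.

Lemma enorm_triangle u v w : enorm (u - w) <= enorm (u - v) + enorm (v - w).
Proof. by rewrite -[u - w](subrKA v) enormD. Qed.

Lemma dot_unit_le u v : enorm v = 1 -> `|dot u v| <= enorm u.
Proof. by move=> v1; rewrite -[leRHS]mulr1 -v1 cauchy_schwarz_abs. Qed.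

Lemma normr_le_enorm u : `|u| <= enorm u.
Proof.
rewrite (_ : `|u| = mx_norm u)// mx_normrE; apply/bigmax_leP; split.
  exact: enorm_ge0.
move=> [i j] _ /=; rewrite ord1 -sqrtr_sqr ler_wsqrtr//.
rewrite /dot (bigD1 j)//= -expr2 lerDl sumr_ge0// => k _.
by rewrite -expr2 sqr_ge0.
Qed.

Lemma coord_le_normr u (j : 'I_3) : `|u 0 j| <= `|u|.
Proof.
by rewrite (_ : `|u| = mx_norm u)// mx_normrE; apply/bigmax_geP; right; exists (0, j).
Qed.

Lemma enorm_le_normr u : enorm u <= 2 * `|u|.
Proof.
apply: enorm_le; first by rewrite mulr_ge0.
rewrite (@le_trans _ _ (\sum_(i < 3) `|u| ^+ 2))//.
  apply: ler_sum => i _; rewrite -expr2 -real_normK ?num_real//.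
  by rewrite ler_pXn2r ?nnegrE// coord_le_normr.
rewrite sumr_const card_ord exprMn -[_ *+ 3]mulr_natr.
by have := sqr_ge0 `|u|; lra.
Qed.

Lemma nbhs_enormP x (A : set 'rV[R]_3) :
  nbhs x A <-> exists2 e, 0 < e & forall y, enorm (y - x) < e -> A y.
Proof.
split=> [/nbhs_ballP[e /= e0 h]|[e e0 h]].
  exists e => // y yx; apply: h; rewrite mx_norm_ball /ball_/=.
  by rewrite distrC (le_lt_trans (normr_le_enorm _)).
apply/nbhs_ballP; exists (e / 2) => /=; first by rewrite divr_gt0.
move=> y; rewrite mx_norm_ball /ball_/= => xy; apply: h.
rewrite (le_lt_trans (enorm_le_normr _))// distrC; lra.
Qed.

Lemma interior_enormP x (A : set 'rV[R]_3) :
  A^° x <-> exists2 e, 0 < e & forall y, enorm (y - x) < e -> A y.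
Proof. exact: nbhs_enormP. Qed.

Lemma enorm_lipschitz_continuous (f : 'rV[R]_3 -> R) a :
  (forall x y, `|f x - f y| <= a * enorm (x - y)) -> continuous f.
Proof.
move=> hf x; apply/(@cvgrPdist_le _ _ _ (nbhs x)) => /= e e0.
have a1 : 0 < `|a| + 1 by rewrite ltr_wpDl.
apply/nbhs_enormP; exists (e / (`|a| + 1)); first by rewrite divr_gt0.
move=> y yx; apply: le_trans (hf _ _) _; rewrite enormB.
rewrite ltr_pdivlMr// mulrC in yx; apply: le_trans (ltW yx).
rewrite ler_wpM2r ?enorm_ge0// (le_trans (ler_norm _))//; lra.
Qed.

Lemma continuous_dotl u : continuous (fun x => dot x u).
Proof.
apply: (@enorm_lipschitz_continuous _ (enorm u)) => x y.
by rewrite -dotBl mulrC cauchy_schwarz_abs.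
Qed.

Lemma enorm_dist_lipschitz x y : `|enorm x - enorm y| <= enorm (x - y).
Proof.
rewrite ler_norml; have := enormD (y - x) x; have := enormD (x - y) y.
rewrite !subrK enormB; lra.
Qed.

Lemma continuous_enorm : continuous (@enorm R).
Proof.
apply: (@enorm_lipschitz_continuous _ 1) => x y.
by rewrite mul1r enorm_dist_lipschitz.
Qed.

Lemma continuous_enormB x : continuous (fun y => enorm (y - x)).
Proof.
apply: (@enorm_lipschitz_continuous _ 1) => y z.
by rewrite mul1r (le_trans (enorm_dist_lipschitz _ _))// opprB addrA subrK.
Qed.

Lemma closed_enorm_ball x a : closed [set y | enorm (y - x) <= a].
Proof. exact: (closed_comp (fun y _ => @continuous_enormB x y) (@closed_le R a)). Qed.

Lemma compact_enorm_ball x a : compact [set y | enorm (y - x) <= a].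
Proof.
apply: bounded_closed_compact; last exact: closed_enorm_ball.
exists (a + enorm x); split; first exact: num_real.
move=> M hM y /= yx; apply: le_trans (ltW hM).
rewrite (le_trans (normr_le_enorm _))// -[leLHS]/(enorm y) -[y](subrK x).
by rewrite (le_trans (enormD _ _))// lerD2r.
Qed.

Lemma compact_sphere2 : compact (@sphere2 R).
Proof.
apply: (@subclosed_compact _ _ [set y | enorm (y - 0) <= 1]).
- by have := closed_comp (fun y _ => @continuous_enorm y) (@closed_eq R 1).
- exact: compact_enorm_ball.
- by move=> x; rewrite /sphere2/= subr0 => ->.
Qed.

(** ** Orthonormal frames *)

Definition orthonormal u v w := [/\ dot u u = 1, dot v v = 1, dot w w = 1,
  dot u v = 0 & dot u w = 0 /\ dot v w = 0].

(** Parseval's identity: the matrix with rows [u], [v], [w] has its transpose as right inverse, and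
    a right inverse of a square matrix is a left inverse. *)
Lemma orthonormal_dotE u v w x y : orthonormal u v w ->
  dot x y = dot x u * dot y u + dot x v * dot y v + dot x w * dot y w.
Proof.
move=> [huu hvv hww huv [huw hvw]].
pose r (i : 'I_3) := if i == 0 then u else if i == 1 then v else w.
pose A : 'M[R]_3 := \matrix_(i, j) r i 0 j.
have AA : A *m A^T = 1%:M.
  apply/matrixP => i j; rewrite !mxE.
  transitivity (dot (r i) (r j)); first by apply: eq_bigr => k _; rewrite !mxE.
  case: i j => [[|[|[|//]]] p] [[|[|[|//]]] q]; rewrite /r/= -?val_eqE/= //.
  - by rewrite dotC.
  - by rewrite dotC.
  - by rewrite dotC.
have dm (a b : 'rV[R]_3) : (a *m b^T) 0 0 = dot a b.
  by rewrite mxE; apply: eq_bigr => k _; rewrite mxE.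
have xA (z : 'rV[R]_3) (k : 'I_3) : (z *m A^T) 0 k = dot z (r k).
  by rewrite mxE; apply: eq_bigr => l _; rewrite !mxE.
transitivity (dot (x *m A^T) (y *m A^T)); last by rewrite dotE !xA.
by rewrite -!dm trmx_mul trmxK mulmxA -(mulmxA x) (mulmx1C AA) mulmx1.
Qed.

Lemma orthonormal_eq u v w x y : orthonormal u v w ->
  dot x u = dot y u -> dot x v = dot y v -> dot x w = dot y w -> x = y.
Proof.
move=> o hu hv hw; apply/eqP; rewrite -subr_eq0; apply/eqP/dot_eq0.
by rewrite (orthonormal_dotE _ _ o) !dotBl hu hv hw !subrr !mul0r !addr0.
Qed.

End Euclid.

(** * Hausdorff measure *)

Section HausdorffMeasure.
Variable R : realType.
Implicit Types (A B E O X Y Z : set 'rV[R]_3) (x y z : 'rV[R]_3) (delta : R).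
Local Open Scope ereal_scope.

Let weight (A : set 'rV[R]_3) : \bar R := (pi / 4)%:E * ediam A ^+ 2.

Lemma ediam_ge0 A : 0 <= ediam A.
Proof. by apply: ereal_sup_ubound; left. Qed.

Lemma ediam_set0 : ediam (set0 : set 'rV[R]_3) = 0.
Proof.
apply/eqP; rewrite eq_le ediam_ge0 andbT; apply: ge_ereal_sup => z [->//|].
by move=> [x []].
Qed.

Lemma ediam_le A (a : R) : (0 <= a)%R ->
  (forall x y, A x -> A y -> (enorm (x - y) <= a)%R) -> ediam A <= a%:E.
Proof.
move=> a0 h; apply: ge_ereal_sup => _ [->|[x Ax [y Ay <-]]].
  by rewrite lee_fin.
by rewrite lee_fin h.
Qed.

Lemma le_ediam A x y : A x -> A y -> (enorm (x - y))%:E <= ediam A.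
Proof. by move=> Ax Ay; apply: ereal_sup_ubound; right; exists x => //; exists y. Qed.

Lemma ediam_expanding (g : 'rV[R]_3 -> 'rV[R]_3) A B :
  (forall z, A z -> B (g z)) ->
  (forall z z', A z -> A z' -> (enorm (z - z') <= enorm (g z - g z'))%R) ->
  ediam A <= ediam B.
Proof.
move=> AB gexp; apply: ge_ereal_sup => _ [->|[x Ax [y Ay <-]]].
  exact: ediam_ge0.
by apply: le_trans (le_ediam (AB _ Ax) (AB _ Ay)); rewrite lee_fin gexp.
Qed.

Lemma subset_ediam A B : A `<=` B -> ediam A <= ediam B.
Proof. by move=> AB; exact: (@ediam_expanding id). Qed.

Let weight_ge0 A : 0 <= weight A.
Proof.
rewrite mule_ge0 ?lee_fin ?divr_ge0 ?pi_ge0// expe2.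
by rewrite mule_ge0 ?ediam_ge0.
Qed.

Let weight_le A B : ediam A <= ediam B -> weight A <= weight B.
Proof.
move=> AB; rewrite lee_wpmul2l ?lee_fin ?divr_ge0 ?pi_ge0// !expe2.
by rewrite lee_pmul ?ediam_ge0.
Qed.

Let weight0 : weight set0 = 0.
Proof. by rewrite /weight ediam_set0 expe2 mul0e mule0. Qed.

(* The constraint on the diameters is encoded in an infinite weight, so that
   the library's outer measure construction applies. *)
Let gauge delta (A : set (g_sigma_algebraType [set: set 'rV[R]_3])) : \bar R :=
  if ediam (A : set 'rV[R]_3) <= delta%:E then weight A else +oo.

Let gauge_ge0 delta A : 0 <= gauge delta A.
Proof. by rewrite /gauge; case: ifP. Qed.

Let gauge0 delta : (0 <= delta)%R -> gauge delta set0 = 0.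
Proof. by move=> d0; rewrite /gauge ediam_set0 lee_fin d0. Qed.

(** The sigma-algebra generated by all sets makes every cover admissible for [mu_ext], and a cover
    that breaks the diameter constraint contributes the harmless value [+oo]. *)
Let hausdorff2_preE delta A : hausdorff2_pre delta A = mu_ext (gauge delta) A.
Proof.
apply/eqP; rewrite eq_le; apply/andP; split; apply: le_ereal_inf_tmp.
- move=> _ [U [_ AU] <-]; have [h|] := pselect (forall i, ediam (U i) <= delta%:E).
    apply: ereal_inf_lbound; exists U => //.
    by apply: eq_eseriesr => i _; rewrite /gauge h.
  move=> /existsNP[i /negP Ui]; rewrite (@eseries_pinfty _ _ _ i) ?leey//.
    by move=> n _; rewrite -ltNye (lt_le_trans _ (gauge_ge0 _ _)).
  by rewrite /gauge (negbTE Ui).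
- move=> _ [U [AU h] <-]; apply: ereal_inf_lbound; exists U.
    by split => // i; exact: sub_sigma_algebra.
  by apply: eq_eseriesr => i _; rewrite /gauge h.
Qed.

Lemma hausdorff2_pre_ge0 delta A : 0 <= hausdorff2_pre delta A.
Proof. by rewrite hausdorff2_preE mu_ext_ge0. Qed.

Lemma hausdorff2_pre_set0 delta : (0 <= delta)%R -> hausdorff2_pre delta set0 = 0.
Proof. by move=> d0; rewrite hausdorff2_preE (mu_ext0 (gauge0 d0) (gauge_ge0 _)). Qed.

Lemma subset_hausdorff2_pre delta A B :
  A `<=` B -> hausdorff2_pre delta A <= hausdorff2_pre delta B.
Proof. by move=> AB; rewrite !hausdorff2_preE; exact: le_mu_ext. Qed.

Lemma hausdorff2_pre_sigma_subadditive delta :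
  sigma_subadditive (@hausdorff2_pre R delta).
Proof.
move=> F; rewrite hausdorff2_preE.
rewrite (eq_eseriesr (fun i _ => hausdorff2_preE delta (F i))).
have h := @mu_ext_sigma_subadditive _ _ _ (gauge delta) (gauge_ge0 delta) F.
exact h.
Qed.

Lemma hausdorff2_preU delta A B : (0 <= delta)%R ->
  hausdorff2_pre delta (A `|` B) <= hausdorff2_pre delta A + hausdorff2_pre delta B.
Proof.
move=> d0; have om := isOuterMeasure.Build R 'rV[R]_3 (hausdorff2_pre delta)
  (hausdorff2_pre_set0 d0) (hausdorff2_pre_ge0 delta)
  (@subset_hausdorff2_pre delta) (@hausdorff2_pre_sigma_subadditive delta).
pose mu : {outer_measure set 'rV[R]_3 -> \bar R} :=
  HB.pack (hausdorff2_pre delta) om.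
exact: (outer_measureU2 mu).
Qed.

Lemma hausdorff2_pre_le_ediam delta A : (0 <= delta)%R -> ediam A <= delta%:E ->
  hausdorff2_pre delta A <= (pi / 4)%:E * ediam A ^+ 2.
Proof.
move=> d0 Ad; pose U i := if i == 0%N then A else set0.
apply: (@le_trans _ _ (\sum_(0 <= i <oo) weight (U i))).
  apply: ereal_inf_lbound; exists U => //.
  split=> [x Ax|[|i]]; [by exists 0%N|exact: Ad|].
  by rewrite /U/= ediam_set0 lee_fin.
rewrite nneseries_recl//.
by rewrite eseries_cond/= eseries0 ?adde0// => -[|i]//= _ _; exact: weight0.
Qed.

Lemma hausdorff2_pre_antitone (d1 d2 : R) A : (d1 <= d2)%R ->
  hausdorff2_pre d2 A <= hausdorff2_pre d1 A.
Proof.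
move=> d12; apply: ereal_inf_le_tmp => _ [U [AU h] <-]; exists U => //.
by split => // i; rewrite (le_trans (h i))// lee_fin.
Qed.

Lemma le_area delta A : (0 < delta)%R -> hausdorff2_pre delta A <= area A.
Proof. by move=> d0; apply: ereal_sup_ubound; exists delta. Qed.

Lemma area_le A (b : \bar R) :
  (forall delta, (0 < delta)%R -> hausdorff2_pre delta A <= b) -> area A <= b.
Proof. by move=> h; apply: ge_ereal_sup => _ [delta /= d0 <-]; exact: h. Qed.

Lemma area_ge0 A : 0 <= area A.
Proof. exact: le_trans (hausdorff2_pre_ge0 1%R A) (le_area _ ltr01). Qed.

#[local] Hint Resolve area_ge0 : core.

Lemma area_set0 : area (set0 : set 'rV[R]_3) = 0.
Proof.
apply/eqP; rewrite eq_le area_ge0 andbT; apply: area_le => delta d0.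
by rewrite hausdorff2_pre_set0// ltW.
Qed.

Lemma subset_area : {homo @area R : A B / A `<=` B >-> A <= B}.
Proof.
move=> A B AB; apply: area_le => delta d0.
exact: le_trans (subset_hausdorff2_pre _ AB) (le_area _ d0).
Qed.

Let area_sigma_subadditive : sigma_subadditive (@area R).
Proof.
move=> F; apply: area_le => delta d0.
apply: le_trans (hausdorff2_pre_sigma_subadditive _ _) _.
apply: lee_nneseries => [i _ _|i _]; first exact: hausdorff2_pre_ge0.
exact: le_area.
Qed.

HB.instance Definition _ := isOuterMeasure.Build R 'rV[R]_3 (@area R)
  area_set0 area_ge0 subset_area area_sigma_subadditive.

(** A cover [U] of [E] pulls back to the cover [V] of [Z], and two points of [V i] are no farther
    apart than their images in [U i]. *)
Lemma hausdorff2_pre_expanding delta (g : 'rV[R]_3 -> 'rV[R]_3) Z E :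
  (forall z, Z z -> E (g z)) ->
  (forall z z', Z z -> Z z' -> (enorm (z - z') <= enorm (g z - g z'))%R) ->
  hausdorff2_pre delta Z <= hausdorff2_pre delta E.
Proof.
move=> ZE gexp; apply: le_ereal_inf_tmp => _ [U [EU h] <-].
pose V i := Z `&` g @^-1` U i.
have VU i : ediam (V i) <= ediam (U i).
  apply: (ediam_expanding (g := g)) => [z []//|z z' [Zz _] [Zz' _]].
  exact: gexp.
apply: (@le_trans _ _ (\sum_(0 <= i <oo) weight (V i))); last first.
  by apply: lee_nneseries => i *; [exact: weight_ge0|exact: weight_le].
apply: ereal_inf_lbound; exists V => //; split=> [z Zz|i].
  by have [i _ Ui] := EU _ (ZE _ Zz); exists i.
exact: le_trans (VU i) (h i).
Qed.

Lemma area_expanding (g : 'rV[R]_3 -> 'rV[R]_3) Z E :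
  (forall z, Z z -> E (g z)) ->
  (forall z z', Z z -> Z z' -> (enorm (z - z') <= enorm (g z - g z'))%R) ->
  area Z <= area E.
Proof.
move=> ZE gexp; apply: area_le => delta d0.
exact: le_trans (hausdorff2_pre_expanding _ ZE gexp) (le_area _ d0).
Qed.

(** A covering set of diameter at most [delta < eta] meets at most one of [A] and [B], so a cover of
    the union splits into a cover of each without counting any set twice. *)
Lemma hausdorff2_pre_separated delta (eta : R) A B :
  (0 <= delta)%R -> (delta < eta)%R ->
  (forall x y, A x -> B y -> (eta <= enorm (x - y))%R) ->
  hausdorff2_pre delta A + hausdorff2_pre delta B <= hausdorff2_pre delta (A `|` B).
Proof.
move=> d0 deta sep; apply: le_ereal_inf_tmp => _ [U [ABU h] <-].
pose V (D : set 'rV[R]_3) i := U i `&` [set _ | (U i `&` D) !=set0].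
have coverV D : D `<=` A `|` B ->
    hausdorff2_pre delta D <= \sum_(0 <= i <oo) weight (V D i).
  move=> DAB; apply: ereal_inf_lbound; exists (V D) => //; split=> [x Dx|i].
    by have [i _ Uix] := ABU _ (DAB _ Dx); exists i => //; split => //; exists x.
  by apply: le_trans (h i); apply: subset_ediam => x [].
have := leeD (coverV A (@subsetUl _ A B)) (coverV B (@subsetUr _ A B)).
rewrite -nneseriesD => [/le_trans|i _ _|i _ _]; try exact: weight_ge0.
apply; apply: lee_nneseries => [i _ _|i _]; first by rewrite adde_ge0.
have [[x [Ux Ax]]|nA] := pselect ((U i `&` A) !=set0); last first.
  rewrite (_ : V A i = set0) ?weight0 ?add0e; last by apply/seteqP; split => // z [].
  by apply/weight_le/subset_ediam => z [].
have [[y [Uy By]]|nB] := pselect ((U i `&` B) !=set0); last first.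
  rewrite (_ : V B i = set0) ?weight0 ?adde0; last by apply/seteqP; split => // z [].
  by apply/weight_le/subset_ediam => z [].
have := le_trans (le_ediam Ux Uy) (h i).
by rewrite lee_fin leNgt (lt_le_trans deta (sep _ _ Ax By)).
Qed.

Lemma area_separated (eta : R) A B : (0 < eta)%R ->
  (forall x y, A x -> B y -> (eta <= enorm (x - y))%R) ->
  area A + area B <= area (A `|` B).
Proof.
move=> eta0 sep.
have [->|ABoo] := eqVneq (area (A `|` B)) +oo; first exact: leey.
have fin X : X `<=` A `|` B -> area X \is a fin_num.
  move=> XAB; rewrite ge0_fin_numE// (le_lt_trans (subset_area XAB))// ltey.
  exact: ABoo.
have Bfin := fin _ (@subsetUr _ A B).
rewrite -leeBrDr//; apply: area_le => d1 d10.
rewrite leeBrDr// addeC.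
have prefin : hausdorff2_pre d1 A \is a fin_num.
  rewrite ge0_fin_numE ?hausdorff2_pre_ge0//.
  by rewrite (le_lt_trans (le_area _ d10))// ltey_eq fin ?orbT//; exact: subsetUl.
rewrite -leeBrDr//; apply: area_le => d2 d20; rewrite leeBrDr//.
(* The two suprema are bounded at independent scales [d1] and [d2]. A common smaller scale only
   increases both premeasures, and the factor [1 / 2] keeps it strictly below [eta]. *)
pose d := Num.min (Num.min d1 d2) (eta / 2)%R.
have d0 : (0 < d)%R by rewrite !lt_min d10 d20 divr_gt0.
apply: le_trans (le_area _ d0).
apply: le_trans (hausdorff2_pre_separated (ltW d0) _ sep); last first.
  by rewrite /d gt_min orbC ltr_pdivrMr// mulr2n mulrDr mulr1 ltrDl eta0.
rewrite addeC leeD//; apply: hausdorff2_pre_antitone; rewrite /d.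
  by rewrite !ge_min lexx.
by rewrite !ge_min lexx orbT.
Qed.

(** ** Open sets are Caratheodory measurable *)

Section OpenCaratheodory.
Variable O : set 'rV[R]_3.
Hypothesis oO : open O.

Let core n := [set x | forall y, ~ O y -> (n.+1%:R^-1 <= enorm (x - y))%R].

Let core_sub n : core n `<=` O.
Proof.
move=> x h; apply: contrapT => /h; rewrite subrr enorm0 leNgt.
by rewrite invr_gt0 ltr0n.
Qed.

Let core_nd m n : (m <= n)%N -> core m `<=` core n.
Proof.
move=> mn x h y Oy; apply: le_trans (h y Oy).
by rewrite lef_pV2 ?posrE ?ltr0n// ler_nat.
Qed.

Let core_cup x : O x -> exists n, core n x.
Proof.
move=> Ox; have /nbhs_enormP[e e0 h] := open_nbhs_nbhs (conj oO Ox).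
have [n _ hn] := near_infty_natSinv_lt (PosNum e0).
exists n => y Oy; rewrite leNgt; apply/negP => xy; apply/Oy/h.
by rewrite enormB (lt_trans xy)// hn/=.
Qed.

Let core_sep n : exists2 eta : R, (0 < eta)%R &
  forall x y, core n x -> ~ core n.+1 y -> (eta <= enorm (x - y))%R.
Proof.
exists (n.+1%:R^-1 - n.+2%:R^-1)%R.
  by rewrite subr_gt0 ltf_pV2 ?posrE ?ltr0n// ltr_nat.
move=> x y hx /existsNP[z /not_implyP[Oz /negP]]; rewrite -ltNge => yz.
have {}hx : (n.+1%:R^-1 <= enorm (x - z))%R := hx z Oz.
rewrite lerBlDr (le_trans hx)// (le_trans (enorm_triangle x y z))//.
by rewrite lerD2l ltW.
Qed.

Let core_separated n X Y : X `<=` core n -> Y `<=` ~` core n.+1 ->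
  area X + area Y <= area (X `|` Y).
Proof.
move=> Xn Yn; have [eta eta0 h] := core_sep n.
by apply: (area_separated eta0) => x y /Xn cx /Yn; exact: h.
Qed.

Let annulus X k := X `&` (core k.+2 `\` core k.+1).

(** Annulus [n] is at positive distance from [core n], so adding it upgrades [core n] to
    [core n.+2]. Carrying two consecutive cores treats even and odd annuli in a single induction. *)
Let annulus_sum X n :
  \sum_(0 <= k < n) area (annulus X k) + area (X `&` core 0) + area (X `&` core 1)
  <= area (X `&` core n) + area (X `&` core n.+1).
Proof.
elim: n => [|n ih]; first by rewrite big_geq// add0e.
rewrite big_nat_recr//= 2!(addeAC _ (area (annulus X n))).
apply: le_trans (leeD ih (lexx _)) _.
rewrite [X in X + _]addeC -addeA leeD2l//.
apply: le_trans (core_separated (n := n) _ _) _.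
- by move=> x [].
- by move=> x [_ []].
apply: subset_area => x [[Xx cx]|[Xx [cx _]]]; split => //.
by apply: core_nd cx; rewrite ltnW.
Qed.

(** Caratheodory's argument for metric outer measures: [core n.+1] is separated from the complement
    of [O], and what it misses of [X] inside [O] is covered by the annuli from [n] on, whose total
    area is the tail of a convergent series. *)
Lemma open_caratheodory : (@area R).-caratheodory O.
Proof.
suff le_X X : area (X `&` O) + area (X `&` ~` O) <= area X.
  exact: le_caratheodory_measurable le_X.
have [->|Xoo] := eqVneq (area X) +oo; first exact: leey.
have Xfin : area X < +oo by rewrite ltey.
have sumfin : \sum_(0 <= k <oo) area (annulus X k) < +oo.
  apply: (@le_lt_trans _ _ (area X + area X)); last by rewrite lte_add_pinfty.
  apply: lime_le; first by apply: is_cvg_nneseries => *; exact: area_ge0.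
  apply: nearW => n; apply: le_trans (leeD (subset_area (@subIsetl _ X (core n)))
    (subset_area (@subIsetl _ X (core n.+1)))).
  apply: le_trans (annulus_sum X n).
  by rewrite -addeA leeDl// adde_ge0.
have tail := nneseries_tail_cvg sumfin (fun k _ => area_ge0 _).
have bound n : area (X `&` O) + area (X `&` ~` O) <=
    area X + \sum_(n <= k <oo) area (annulus X k).
  apply: (@le_trans _ _ (area (X `&` core n.+1) +
      \sum_(n <= k <oo) area (annulus X k) + area (X `&` ~` O))).
    rewrite leeD2r//.
    apply: (@le_trans _ _ (area ((X `&` core n.+1) `|`
        \bigcup_(k in ~` `I_n) annulus X k))).
      apply: subset_area => x [Xx Ox]; have [m cm] := core_cup Ox.
      have [cn|ncn] := pselect (core n.+1 x); [by left|right].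
      have [k nk kx] : exists2 k, (n <= k)%N & (core k.+2 `\` core k.+1) x.
        have nm : (n.+1 < m)%N.
          by rewrite ltnNge; apply/negP => mn; apply/ncn/(core_nd mn).
        have ex : exists m, `[< core m x >] by exists m; apply/asboolP.
        (* The least [j] with [x] in [core j] is at least [n + 2], which places [x] in annulus
           [j - 2]. *)
        have [j /asboolP cj jmin] := ex_minnP ex.
        have nj : (n.+1 < j)%N.
          by rewrite ltnNge; apply/negP => jn; apply/ncn/(core_nd jn).
        exists j.-2; first by rewrite -ltnS -ltnS; case: j nj {cj jmin} => [|[|]].
        case: j nj cj jmin => [|[|j]]// nj cj jmin; split => // cj1.
        by have := jmin j.+1; rewrite ltnn => /(_ (asboolT cj1)).
      by exists k => //=; apply/negP; rewrite -leqNgt.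
    apply: le_trans (outer_measureU2 (@area R) _ _) _; rewrite leeD2l//.
    exact: outer_measure_sigma_subadditive_tail.
  rewrite addeAC leeD2r//; apply: le_trans (core_separated (n := n.+1) _ _) _.
  - by move=> x [].
  - by move=> x [_ Ox] cx; exact/Ox/(core_sub cx).
  - by apply: subset_area => x [[]|[]].
have hlim : area X + \sum_(n <= k <oo) area (annulus X k) @[n --> \oo] --> area X.
  rewrite -[X in _ --> X]adde0; apply: cvgeD; [|exact: cvg_cst|exact: tail].
  by rewrite ge0_adde_def ?inE.
rewrite -(cvg_lim _ hlim)//; apply: lime_ge; first by apply/cvg_ex; eexists; exact: hlim.
exact: nearW.
Qed.

Lemma area_openID X : area X = area (X `&` O) + area (X `&` ~` O).
Proof. exact: open_caratheodory. Qed.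

End OpenCaratheodory.

End HausdorffMeasure.

(** * Area of rectangles *)

Section Rectangles.
Variable R : realType.
Implicit Types (o u v w x y : 'rV[R]_3) (a b : R).

(** Half-open sides let translated copies tile a larger rectangle without overlap. *)
Definition rect o u v w a b : set 'rV[R]_3 :=
  [set x | [/\ dot (x - o) w = 0, 0 <= dot (x - o) u < a & 0 <= dot (x - o) v < b]].

Lemma subset_rect o u v w a b a' b' : a <= a' -> b <= b' ->
  rect o u v w a b `<=` rect o u v w a' b'.
Proof.
move=> aa bb x [h0 /andP[u0 hu] /andP[v0 hv]]; split => //=.
  by rewrite u0 (lt_le_trans hu).
by rewrite v0 (lt_le_trans hv).
Qed.

Lemma rectC o u v w a b : rect o u v w a b = rect o v u w b a.
Proof. by apply/seteqP; split=> x []. Qed.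

Lemma orthonormalC u v w : orthonormal u v w -> orthonormal v u w.
Proof. by case=> ? ? ? ? [? ?]; split => //; rewrite dotC. Qed.

Section Congruence.
Variables (o u v w o' u' v' w' : 'rV[R]_3).
Hypotheses (uvw : orthonormal u v w) (uvw' : orthonormal u' v' w').

Let g x := o' + (dot (x - o) u *: u' + dot (x - o) v *: v').

Let g_rect a b x : rect o u v w a b x -> rect o' u' v' w' a b (g x).
Proof.
case: uvw' => huu hvv hww huv [huw hvw] [h0 hu hv].
rewrite /rect/g/= addrC addKr !dot_linE (dotC v' u') huu hvv huv huw hvw.
by rewrite !mulr0 !mulr1 !addr0 add0r -!dotBl.
Qed.

Let g_isometry a b x y : rect o u v w a b x -> rect o u v w a b y ->
  enorm (x - y) <= enorm (g x - g y).
Proof.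
case: (uvw') => huu hvv hww huv [huw hvw] [hx _ _] [hy _ _].
apply: enorm_le_enorm; rewrite /g opprD addrACA subrr add0r.
rewrite (orthonormal_dotE _ _ uvw).
have xy z : dot (x - y) z = dot (x - o) z - dot (y - o) z.
  by rewrite -dotBl opprB addrA subrK.
rewrite !xy hx hy !dot_linE (dotC v' u') huu hvv huv.
by rewrite le_eqVlt; apply/orP; left; apply/eqP; ring.
Qed.

Lemma le_hausdorff2_pre_rect delta a b :
  (hausdorff2_pre delta (rect o u v w a b) <=
   hausdorff2_pre delta (rect o' u' v' w' a b))%E.
Proof. exact: hausdorff2_pre_expanding (@g_rect a b) (@g_isometry a b). Qed.

Lemma le_area_rect a b :
  (area (rect o u v w a b) <= area (rect o' u' v' w' a b))%E.
Proof. exact: area_expanding (@g_rect a b) (@g_isometry a b). Qed.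

End Congruence.

Section Frame.
Variables (o u v w : 'rV[R]_3).
Hypothesis uvw : orthonormal u v w.

Let G a b := area (rect o u v w a b).
Let P delta a b := hausdorff2_pre delta (rect o u v w a b).

Let GC a b : G a b = G b a.
Proof.
rewrite /G rectC; apply/eqP; rewrite eq_le.
by rewrite !le_area_rect//; exact: orthonormalC.
Qed.

Let PC delta a b : P delta a b = P delta b a.
Proof.
rewrite /P rectC; apply/eqP; rewrite eq_le.
by rewrite !le_hausdorff2_pre_rect//; exact: orthonormalC.
Qed.

Let dot_shift a x y : dot (x - (o + a *: u)) y = dot (x - o) y - a * dot u y.
Proof. by rewrite !dot_linE; ring. Qed.

Let rect_split a a' b : 0 <= a -> 0 <= a' ->
  rect o u v w (a + a') b `&` [set x | dot (x - o) u < a] = rect o u v w a b.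
Proof.
case: uvw => huu _ _ huv [huw _] a0 a0'; apply/seteqP; split => x /=; rewrite /rect/=.
  by move=> [[h0 /andP[hu _] hv] hua]; rewrite hu.
move=> [h0 /andP[hu hua] hv]; split => //; split => //.
by rewrite hu/= (lt_le_trans hua)// lerDl.
Qed.

Let rect_splitC a a' b : 0 <= a -> 0 <= a' ->
  rect o u v w (a + a') b `&` ~` [set x | dot (x - o) u < a] =
  rect (o + a *: u) u v w a' b.
Proof.
case: uvw => huu _ _ huv [huw _] a0 a0'; apply/seteqP; split => x /=;
  rewrite /rect/= !dot_shift huu huv huw !mulr0 mulr1 !subr0.
  move=> [[h0 /andP[hu hua] hv] /negP]; rewrite -leNgt => au; split => //.
  by rewrite subr_ge0 au ltrBlDl.
move=> [h0]; rewrite subr_ge0 ltrBlDl => /andP[au ->] hv; split.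
  by rewrite (le_trans a0 au).
by apply/negP; rewrite -leNgt.
Qed.

Let GD a a' b : 0 <= a -> 0 <= a' -> G (a + a') b = (G a b + G a' b)%E.
Proof.
move=> a0 a0'; rewrite /G.
have oH : open [set x : 'rV[R]_3 | dot (x - o) u < a].
  rewrite [X in open X](_ : _ = (fun x => dot x u) @^-1` [set z | z < a + dot o u]).
    by apply: open_comp => [x _|]; [exact: continuous_dotl|exact: open_lt].
  by apply/seteqP; split=> x /=; rewrite dotBl ltrBlDr.
rewrite [LHS](area_openID oH) (rect_split _ a0 a0') (rect_splitC _ a0 a0').
by congr (_ + _)%E; apply/eqP; rewrite eq_le (le_area_rect _ _ uvw uvw) le_area_rect.
Qed.

Let PD delta a a' b : 0 <= delta -> 0 <= a -> 0 <= a' ->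
  (P delta (a + a') b <= P delta a b + P delta a' b)%E.
Proof.
move=> d0 a0 a0'; rewrite /P.
rewrite -[X in (hausdorff2_pre delta X <= _)%E](setIT _).
rewrite -(setUv [set x : 'rV[R]_3 | dot (x - o) u < a]) setIUr.
apply: le_trans (hausdorff2_preU _ _ d0) _.
rewrite (rect_split _ a0 a0') (rect_splitC _ a0 a0').
by rewrite leeD2l// le_hausdorff2_pre_rect.
Qed.

Let Pn delta n a b : 0 <= delta -> 0 <= a ->
  (P delta (a *+ n.+1) b <= n.+1%:R%:E * P delta a b)%E.
Proof.
move=> d0 a0; elim: n => [|n ih]; first by rewrite mulr1n mul1e.
rewrite mulrSr -[n.+2]addn1 natrD EFinD ge0_muleDl ?lee_fin// mul1e.
by apply: le_trans (PD _ d0 _ a0) _; rewrite ?mulrn_wge0// leeD2r.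
Qed.

Lemma area_rectMn n a b : 0 <= a ->
  (area (rect o u v w (a *+ n.+1) b) = n.+1%:R%:E * area (rect o u v w a b))%E.
Proof.
move=> a0; elim: n => [|n ih]; first by rewrite mulr1n mul1e.
rewrite mulrSr -[n.+2]addn1 natrD EFinD ge0_muleDl ?lee_fin// mul1e.
by rewrite -/(G _ _) GD ?mulrn_wge0// /G ih.
Qed.

Let ediam_rect a : 0 <= a -> (ediam (rect o u v w a a) <= (2 * a)%:E)%E.
Proof.
move=> a0; apply: ediam_le => [|x y]; first by rewrite mulr_ge0.
move=> [hx /andP[x1 x2] /andP[x3 x4]] [hy /andP[y1 y2] /andP[y3 y4]].
apply: enorm_le; first by rewrite mulr_ge0.
have xy z : dot (x - y) z = dot (x - o) z - dot (y - o) z.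
  by rewrite -dotBl opprB addrA subrK.
rewrite (orthonormal_dotE _ _ uvw) !xy hx hy subrr mulr0 addr0.
have sq (s t : R) : 0 <= s -> s < a -> 0 <= t -> t < a -> (s - t) * (s - t) <= a ^+ 2.
  move=> *; rewrite -expr2 -real_normK ?num_real// ler_pXn2r ?nnegrE//.
  rewrite ler_norml; lra.
have := sq _ _ x1 x2 y1 y2; have := sq _ _ x3 x4 y3 y4; have := sqr_ge0 a.
by rewrite exprMn; set A := a ^+ 2; lra.
Qed.

(** Cutting the unit square into [n.+1 ^ 2] squares of side [s] and diameter at most
    [2 * s <= delta] gives the covering sum [pi], whatever [delta]. *)
Let G11_lty : (G 1 1 < +oo)%E.
Proof.
apply: (@le_lt_trans _ _ pi%:E); last exact: ltry.
apply: area_le => delta d0.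
pose n := Num.truncn (2 / delta); pose s : R := n.+1%:R^-1.
have n0 : 0 < n.+1%:R :> R by rewrite ltr0n.
have s0 : 0 <= s by rewrite invr_ge0 ltW.
have sd : 2 * s <= delta.
  rewrite /s ler_pdivrMr// mulrC -ler_pdivrMr// ltW//.
  by have /andP[] := truncn_itv (ltW (divr_gt0 (ltr0Sn R 1) d0)).
have s1 : s *+ n.+1 = 1 by rewrite -mulr_natr mulVf// gt_eqF.
have d0' := ltW d0.
have Ps b : (P delta 1 b <= n.+1%:R%:E * P delta s b)%E.
  by rewrite -{1}s1 Pn.
apply: le_trans (Ps _) _.
apply: (@le_trans _ _ (n.+1%:R%:E * (n.+1%:R%:E * (pi / 4 * (2 * s) ^+ 2)%:E))%E).
  rewrite lee_wpmul2l ?lee_fin// PC.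
  apply: le_trans (Ps _) _; rewrite lee_wpmul2l ?lee_fin//.
  have diam := ediam_rect s0.
  apply: le_trans (hausdorff2_pre_le_ediam d0' (le_trans diam _)) _.
    by rewrite lee_fin.
  rewrite [leRHS]EFinM lee_wpmul2l ?lee_fin ?divr_ge0 ?pi_ge0// EFin_expe !expe2.
  by rewrite lee_pmul ?ediam_ge0.
rewrite -!EFinM lee_fin /s le_eqVlt; apply/orP; left; apply/eqP.
by field; rewrite gt_eqF.
Qed.

(** In the coordinates along [u] and [v], a set of diameter [D] fits in a square of side [2 * D]
    around one of its points, whose Lebesgue measure is [16 / pi] times the weight
    [pi / 4 * D ^+ 2]. Countable subadditivity of planar Lebesgue measure then bounds every covering
    sum from below. For an empty [U i] the center is a default value and the box is a single
    point. *)
Lemma pi16_le_area_rect : ((pi / 16)%:E <= area (rect o u v w 1 1))%E.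
Proof.
apply: le_trans (le_area _ ltr01); apply: le_ereal_inf_tmp => _ [U [cU hU] <-].
pose D i := fine (ediam (U i)).
have DE i : ediam (U i) = (D i)%:E.
  by rewrite fineK// ge0_fin_numE ?ediam_ge0// (le_lt_trans (hU i)) ?ltry.
have D0 i : 0 <= D i by rewrite -lee_fin -DE ediam_ge0.
pose c i := dot (get (U i) - o) u; pose c' i := dot (get (U i) - o) v.
pose box i : set (measurableTypeR R * measurableTypeR R) :=
  `[c i - D i, c i + D i]%classic `*` `[c' i - D i, c' i + D i]%classic.
pose mu := (@lebesgue_measure R \x @lebesgue_measure R)%E.
have muitv (x y : R) : 0 <= y ->
    @lebesgue_measure R `[x - y, x + y]%classic = (2 * y)%:E.
  move=> y0; rewrite lebesgue_measure_itv/= lte_fin.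
  case: ltP => [_|h]; first by rewrite -EFinB; congr EFin; ring.
  by have -> : y = 0 by [lra]; rewrite mulr0.
have mubox i : mu (box i) = ((16 / pi)%:E * ((pi / 4)%:E * ediam (U i) ^+ 2))%E.
  transitivity (@lebesgue_measure R `[(c i - D i)%R, (c i + D i)%R]%classic *
                @lebesgue_measure R `[(c' i - D i)%R, (c' i + D i)%R]%classic)%E.
    by apply: product_measure1E; exact: measurable_itv.
  rewrite !muitv// DE -EFin_expe -!EFinM; congr EFin.
  have pin0 : pi != 0 :> R by rewrite gt_eqF// pi_gt0.
  by move: (@pi R) pin0 => p p0; field.
pose sq : set (measurableTypeR R * measurableTypeR R) :=
  `[0, 1[%classic `*` `[0, 1[%classic.
have musq : mu sq = 1%E.
  transitivity (@lebesgue_measure R `[0%R, 1%R[%classic *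
                @lebesgue_measure R `[0%R, 1%R[%classic)%E.
    by apply: product_measure1E; exact: measurable_itv.
  by rewrite !lebesgue_measure_itv/= lte_fin ltr01 oppr0 adde0 mule1.
have sqU : sq `<=` \bigcup_i box i.
  case: (uvw) => huu hvv _ huv [huw hvw].
  move=> [s t] [/= /[!in_itv]/= hs ht].
  pose x := o + (s *: u + t *: v).
  have xu : dot (x - o) u = s.
    by rewrite /x addrC addKr !dot_linE huu (dotC v) huv mulr0 mulr1 addr0.
  have xv : dot (x - o) v = t.
    by rewrite /x addrC addKr !dot_linE hvv huv mulr0 mulr1 add0r.
  have xw : dot (x - o) w = 0.
    by rewrite /x addrC addKr !dot_linE huw hvw !mulr0 addr0.
  have [|i _ Ux] := cU x; first by split; rewrite ?xu ?xv ?xw.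
  have := le_ediam Ux (getPex (ex_intro _ x Ux)); rewrite DE lee_fin => dx.
  have near y : enorm y = 1 -> `|dot (x - o) y - dot (get (U i) - o) y| <= D i.
    move=> y1; rewrite -dotBl opprB addrA subrK.
    exact: le_trans (dot_unit_le _ y1) dx.
  exists i => //; split => /=; rewrite in_itv/=.
    by have := near u (dot1_enorm huu); rewrite xu ler_distl.
  by have := near v (dot1_enorm hvv); rewrite xv ler_distl.
have : (mu sq <= \sum_(i <oo) mu (box i))%E.
  apply: measure_sigma_subadditive => // [i|]; apply: measurableX => //;
    exact: measurable_itv.
rewrite musq (eq_eseriesr (fun i _ => mubox i)) nneseriesZl; last first.
  move=> i _; rewrite mule_ge0 ?lee_fin ?divr_ge0 ?pi_ge0// DE -EFin_expe.
  by rewrite lee_fin sqr_ge0.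
have pi0 := pi_gt0 R.
rewrite -lee_pdivrMl ?divr_gt0// mule1 => h; apply: le_trans h.
by rewrite lee_fin invf_div.
Qed.

Lemma area_rect_lty a b : (area (rect o u v w a b) < +oo)%E.
Proof.
pose n := Num.truncn (Num.max 0 (Num.max a b)).
have /andP[_ hn] : n%:R <= Num.max 0 (Num.max a b) < n.+1%:R.
  by rewrite truncn_itv// le_max lexx.
move: hn; rewrite !gt_max => /and3P[n0 an bn].
apply: (@le_lt_trans _ _ (G n.+1%:R n.+1%:R)).
  by apply/subset_area/subset_rect; exact: ltW.
rewrite /G area_rectMn// -/(G _ _) GC /G area_rectMn//.
by rewrite !lte_mul_pinfty ?lee_fin ?mule_ge0 ?lee_fin ?area_ge0.
Qed.

End Frame.

(* Only the finiteness and positivity of this constant matter: it cancels in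
   [nu], so the isodiametric inequality (giving the value 1) is not needed. *)
Definition area_unit : R :=
  fine (area (rect 0 (delta_mx 0 0) (delta_mx 0 1) (delta_mx 0 2%:R) 1 1)).

Let orthonormal_delta :
  orthonormal (delta_mx 0 0) (delta_mx 0 1) (delta_mx 0 2%:R : 'rV[R]_3).
Proof. by split; try split; rewrite !dotE !mxE -!val_eqE/=; ring. Qed.

Let area_unitE : area (rect 0 (delta_mx 0 0) (delta_mx 0 1) (delta_mx 0 2%:R) 1 1)
   = area_unit%:E.
Proof.
rewrite /area_unit fineK// ge0_fin_numE ?area_ge0//.
exact: area_rect_lty _ orthonormal_delta _ _.
Qed.

Lemma area_unit_gt0 : 0 < area_unit.
Proof.
rewrite -lte_fin -area_unitE.
apply: lt_le_trans (pi16_le_area_rect _ orthonormal_delta).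
by rewrite lte_fin divr_gt0// pi_gt0.
Qed.

(** Between consecutive integers, where [f] is already linear, monotonicity leaves an error of at
    most [f 1]. Hence every multiple [n.+1%:R * (f a - a * f 1)] of the defect stays bounded, and
    the defect vanishes. *)
Lemma monotone_homogeneous (f : R -> R) :
  (forall a b, 0 <= a -> a <= b -> f a <= f b) ->
  (forall n a, 0 <= a -> f (a *+ n.+1) = n.+1%:R * f a) ->
  forall a, 0 <= a -> f a = a * f 1.
Proof.
move=> fmono fn a a0.
have f0 : f 0 = 0.
  by have := fn 1%N 0 (lexx 0); rewrite mul0rn; lra.
have f1 : 0 <= f 1 by rewrite -f0 fmono.
have bound n : `|n.+1%:R * (f a - a * f 1)| <= f 1.
  pose k := Num.truncn (a *+ n.+1).
  have /andP[ka ak] : k%:R <= a *+ n.+1 < k.+1%:R by rewrite truncn_itv ?mulrn_wge0.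
  have fk (m : nat) : f m%:R = m%:R * f 1.
    case: m => [|m]; first by rewrite f0 mul0r.
    exact: fn ler01.
  have h1 : f k%:R <= f (a *+ n.+1) by rewrite fmono.
  have h2 : f (a *+ n.+1) <= f k.+1%:R by rewrite fmono ?mulrn_wge0// ltW.
  rewrite !fk fn// in h1 h2.
  rewrite -(mulr_natl a) in ka ak.
  have k1 : k%:R * f 1 <= n.+1%:R * a * f 1 by rewrite ler_wpM2r.
  have k2 : n.+1%:R * a * f 1 <= k.+1%:R * f 1 by rewrite ler_wpM2r// ltW.
  have kS : k.+1%:R = k%:R + 1 :> R by rewrite -addn1 natrD.
  rewrite kS mulrDl mul1r in h2 k2; rewrite mulrBr mulrA ler_norml.
  move: (n.+1%:R * f a) (n.+1%:R * a * f 1) (k%:R * f 1) h1 h2 k1 k2 => X Y Z h1 h2 k1 k2.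
  clear -h1 h2 k1 k2; apply/andP; split; lra.
have [//|ne] := eqVneq (f a) (a * f 1); rewrite -subr_eq0 in ne.
have d0 : 0 < `|f a - a * f 1| by rewrite normr_gt0.
pose n := Num.truncn (f 1 / `|f a - a * f 1|).
have /andP[_] : n%:R <= f 1 / `|f a - a * f 1| < n.+1%:R.
  by rewrite truncn_itv// divr_ge0.
rewrite ltr_pdivrMr// ltNge => /negP; case.
by have := bound n; rewrite normrM ger0_norm// ler0n.
Qed.

Lemma area_rect o u v w a b : orthonormal u v w -> 0 <= a -> 0 <= b ->
  area (rect o u v w a b) = (area_unit * (a * b))%:E.
Proof.
move=> uvw a0 b0.
pose F c c' := fine (area (rect o u v w c c')).
have FE c c' : area (rect o u v w c c') = (F c c')%:E.
  by rewrite fineK// ge0_fin_numE ?area_ge0// area_rect_lty.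
have FC c c' : F c c' = F c' c.
  rewrite /F rectC; congr fine; apply/eqP; rewrite eq_le.
  by rewrite !le_area_rect//; exact: orthonormalC.
have F_le c1 c2 c' : c1 <= c2 -> F c1 c' <= F c2 c'.
  move=> c12; rewrite -lee_fin -!FE; apply: subset_area; exact: subset_rect.
have Fn n c c' : 0 <= c -> F (c *+ n.+1) c' = n.+1%:R * F c c'.
  by move=> c0; apply: EFin_inj; rewrite EFinM -!FE; exact: area_rectMn.
have Flin c c' : 0 <= c -> F c c' = c * F 1 c'.
  apply: (@monotone_homogeneous (F^~ c') _ _ c).
    by move=> x y _; exact: F_le.
  by move=> n x; exact: Fn.
have F11 : F 1 1 = area_unit.
  apply: EFin_inj; rewrite -FE -area_unitE; apply/eqP; rewrite eq_le.
  by rewrite !le_area_rect.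
by rewrite FE (Flin _ _ a0) FC (Flin _ _ b0) F11; congr EFin; ring.
Qed.

Lemma continuous0_near (f : R -> R) : {for 0, continuous f} ->
  forall e, 0 < e -> exists2 d, 0 < d & forall s, 0 < s < d -> `|f s - f 0| < e.
Proof.
move=> fc e e0; have /(@cvgrPdist_lt _ _ _ (nbhs (0 : R))) /(_ e e0) := fc.
move=> /nbhs_ballP[d /= d0 hd]; exists d => // s /andP[s0 sd].
by rewrite distrC; apply: hd; rewrite /ball/= sub0r normrN gtr0_norm.
Qed.

(** A closed rectangle fits in half-open ones with slightly longer sides, and continuity of the
    product of the sides removes the excess. Shrinking does the same for open rectangles in
    [area_ge_rect]. *)
Lemma area_le_rect o u v w a b (A : set 'rV[R]_3) : orthonormal u v w ->
  0 <= a -> 0 <= b ->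
  (forall x, A x -> [/\ dot (x - o) w = 0, 0 <= dot (x - o) u <= a &
                      0 <= dot (x - o) v <= b]) ->
  (area A <= (area_unit * (a * b))%:E)%E.
Proof.
move=> uvw a0 b0 hA.
pose f e := area_unit * ((a + e) * (b + e)).
have -> : area_unit * (a * b) = f 0 by rewrite /f !addr0.
have fc : {for 0, continuous f}.
  by apply: continuousM; [exact: cvg_cst|apply: continuousM];
    apply: continuousD; (exact: cvg_cst || exact: cvg_id).
apply/lee_addgt0Pr => e e0; have [d d0 hd] := continuous0_near fc e0.
have {hd} /hd : 0 < d / 2 < d by lra.
rewrite ltr_distl => /andP[_ fd].
apply: (@le_trans _ _ (f (d / 2))%:E); last by rewrite -EFinD lee_fin; lra.
have [ad bd] : 0 <= a + d / 2 /\ 0 <= b + d / 2 by split; lra.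
rewrite -[(f (d / 2))%:E](area_rect o uvw ad bd); apply: subset_area => x /hA[].
move=> h0 /andP[u0 ua] /andP[v0 vb]; split => //; rewrite ?u0 ?v0/=; lra.
Qed.

Lemma area_ge_rect o u v w a b (A : set 'rV[R]_3) : orthonormal u v w ->
  0 <= a -> 0 <= b ->
  (forall x, dot (x - o) w = 0 -> 0 < dot (x - o) u < a ->
             0 < dot (x - o) v < b -> A x) ->
  ((area_unit * (a * b))%:E <= area A)%E.
Proof.
move=> uvw a0 b0 hA; have A0 := area_ge0 A.
have [->|an0] := eqVneq a 0; first by rewrite mul0r mulr0.
have [->|bn0] := eqVneq b 0; first by rewrite !mulr0.
have {}a0 : 0 < a by rewrite lt_def an0.
have {}b0 : 0 < b by rewrite lt_def bn0.
pose f e := area_unit * ((a - e) * (b - e)).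
have -> : area_unit * (a * b) = f 0 by rewrite /f !subr0.
have fc : {for 0, continuous f}.
  by apply: continuousM; [exact: cvg_cst|apply: continuousM];
    apply: continuousB; (exact: cvg_cst || exact: cvg_id).
apply/lee_addgt0Pr => e e0; have [d d0 hd] := continuous0_near fc e0.
pose x := Num.min (d / 2) (Num.min (a / 2) (b / 2)).
have x0 : 0 < x by rewrite !lt_min !divr_gt0.
have : x <= d / 2 /\ x <= a / 2 /\ x <= b / 2.
  by rewrite /x !ge_min !lexx !orbT.
move=> [xd [xa xb]].
have := hd x; rewrite x0/= => /(_ _)/wrap[]; first by lra.
rewrite ltr_distl => /andP[fx _].
apply: (@le_trans _ _ (f x + e)%:E); first by rewrite lee_fin; lra.
have [ax bx] : 0 <= a - x /\ 0 <= b - x by split; lra.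
rewrite EFinD leeD2r// -[(f x)%:E](area_rect (o + ((x / 2) *: u + (x / 2) *: v)) uvw ax bx).
case: uvw => huu hvv _ huv [huw hvw].
have sh (y z : 'rV[R]_3) : dot (y - (o + (x / 2 *: u + x / 2 *: v))) z =
    dot (y - o) z - x / 2 * (dot u z + dot v z).
  by rewrite !dot_linE; ring.
apply: subset_area => y; rewrite /rect/= !sh huu hvv huv (dotC v u) huv huw hvw.
rewrite !addr0 !add0r mulr0 !mulr1 subr0.
by move=> [h0 /andP[u0 ua] /andP[v0 vb]]; apply: hA => //; apply/andP; split; lra.
Qed.

End Rectangles.

(** * Convex bodies and their normals *)

Section ConvexBody.
Variables (R : realType) (C : set 'rV[R]_3).
Hypothesis hC : convex_body C.
Implicit Types (x y z r n : 'rV[R]_3).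

Lemma convex_body_conv x y (s : R) : C x -> C y -> 0 <= s -> s <= 1 ->
  C ((1 - s) *: x + s *: y).
Proof.
case: hC => cC _ _ Cx Cy s0 s1.
have := cC y x (Itv01 s0 s1); rewrite !inE => /(_ Cy Cx).
by rewrite /conv/= addrC.
Qed.

Lemma convex_body_ray r x (s s' : R) : C r -> C (r + s *: x) -> 0 <= s' -> s' <= s ->
  C (r + s' *: x).
Proof.
move=> Cr Cx s0 ss'; have [s_eq0|sn0] := eqVneq s 0.
  by have -> : s' = 0 by [lra]; rewrite scale0r addr0.
have s_gt0 : 0 < s by rewrite lt_def sn0 (le_trans s0).
have := convex_body_conv Cr Cx (divr_ge0 s0 (ltW s_gt0)).
rewrite ler_pdivrMr// mul1r => /(_ ss'); congr C.
by rewrite scalerDr scalerA divfK// addrA -scalerDl subrK scale1r.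
Qed.

Lemma convex_body_closed : closed C.
Proof. by case: hC => _ cC _; apply: (compact_closed _ cC); exact: norm_hausdorff. Qed.

Lemma bdE : bd C = C `\` C^°.
Proof. by rewrite /bd -(closure_id C).1//; exact: convex_body_closed. Qed.

Lemma interior_conv x y (s : R) : C^° x -> C y -> 0 <= s -> s < 1 ->
  C^° ((1 - s) *: x + s *: y).
Proof.
move=> /interior_enormP[e e0 he] Cy s0 s1; apply/interior_enormP.
have s10 : 0 < 1 - s by rewrite subr_gt0.
exists ((1 - s) * e); first by rewrite mulr_gt0.
move=> z hz; pose x' := (1 - s)^-1 *: (z - s *: y).
have -> : z = (1 - s) *: x' + s *: y.
  by rewrite /x' scalerA mulfV ?gt_eqF// scale1r subrK.
apply: convex_body_conv => //; last exact: ltW.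
apply: he; have -> : x' - x = (1 - s)^-1 *: (z - ((1 - s) *: x + s *: y)).
  apply: (scalerI (lt0r_neq0 s10)); rewrite scalerBr /x' !scalerA.
  by rewrite mulfV ?gt_eqF// !scale1r opprD addrA addrAC.
by rewrite enormZ gtr0_norm ?invr_gt0// mulrC ltr_pdivrMr// mulrC.
Qed.

Lemma outward_normal_int r n z :
  outward_unit_normal C r n -> C^° z -> dot (z - r) n < 0.
Proof.
move=> [n1 hn] /interior_enormP[e e0 he].
have := hn (z + (e / 2) *: n); rewrite !dot_linE enorm1_dot//.
have Cz : C (z + (e / 2) *: n).
  by apply: he; rewrite addrC addKr enormZ n1 mulr1 gtr0_norm; lra.
by move=> /(_ Cz); lra.
Qed.

(** Regularity is uniqueness of the plane, which determines a unit normal only up to sign; an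
    interior point of [C] excludes the opposite sign. *)
Lemma regular_normal_uniq r n n' : regular_bd C r ->
  outward_unit_normal C r n -> outward_unit_normal C r n' -> n = n'.
Proof.
move=> [_ [P [_ uP]]] hn hn'.
have plane m : outward_unit_normal C r m -> P = [set x | dot (x - r) m = 0].
  by move=> hm; apply: uP; exists m.
have [_ _ [c Cc]] := hC.
have [[n1 _] [n1' _]] := (hn, hn').
have eqp x : dot (x - r) n = 0 <-> dot (x - r) n' = 0.
  have := plane _ hn; rewrite (plane _ hn') => /seteqP[h1 h2].
  by split=> h; [exact: h2|exact: h1].
pose k := dot n n'.
(* The vector [n - k *: n'] is orthogonal to [n'], hence lies in the common plane and is orthogonal
   to [n] too: [1 - k ^+ 2 = 0]. *)
have [_] := eqp (r + (n - k *: n')).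
rewrite addrC addKr !dot_linE !enorm1_dot// (dotC n') -/k mulr1 subrr => /(_ erefl) k1.
have n'E : n = k *: n'.
  apply/eqP; rewrite -subr_eq0; apply/eqP/dot_eq0.
  by rewrite !dot_linE (dotC n') -/k !enorm1_dot// -[RHS]k1; ring.
have kk : (k - 1) * (k + 1) = 0 by lra.
have := outward_normal_int hn Cc; have := outward_normal_int hn' Cc.
move/eqP : kk; rewrite mulf_eq0 subr_eq0 addr_eq0 => /orP[]/eqP kE.
  by rewrite n'E kE scale1r.
by rewrite n'E kE scaleN1r dotNr => h1 h2; exfalso; lra.
Qed.

Lemma normalP r : regular_bd C r -> outward_unit_normal C r (normal C r).
Proof. by move=> [_ [P [[n hn _] _]]]; apply: getPex; exists n. Qed.

Lemma normal_eq r n : regular_bd C r -> outward_unit_normal C r n -> normal C r = n.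
Proof. by move=> rr; apply: regular_normal_uniq (normalP rr). Qed.

(** Continuity of the normal on regular points, by compactness: a unit vector outside [A] is not a
    normal at [r], as some [x] of [C] lies strictly beyond its plane. This persists for nearby
    vectors and base points, so the unit vectors outside [A] are excluded uniformly near [r]. *)
Lemma normal_nbhs (A : set 'rV[R]_3) r : open A -> regular_bd C r ->
  A (normal C r) -> nbhs r [set r' | regular_bd C r' -> A (normal C r')].
Proof.
move=> oA rr Ar.
pose K := @sphere2 R `&` ~` A.
have cK : compact K.
  apply: (subclosed_compact _ (@compact_sphere2 R)); last by move=> ? [].
  apply: closedI; last exact: open_closedC.
  by apply: (compact_closed _ (@compact_sphere2 R)); exact: norm_hausdorff.
have : \forall r' \near nbhs r, K `<=` [set n | exists2 x, C x & 0 < dot (x - r') n].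
  apply: ((compact_near_coveringP K).1 cK _ (nbhs r)
    (fun r' n => exists2 x, C x & 0 < dot (x - r') n)) => n [n1 An].
  have [x Cx xn] : exists2 x, C x & 0 < dot (x - r) n.
    apply: contrapT => h; apply: An.
    have <- // : normal C r = n.
    apply: normal_eq => //; split => // x Cx; rewrite leNgt; apply/negP => xn.
    by apply: h; exists x.
  pose d := dot (x - r) n; pose e := d / (2 * (enorm (x - r) + 2)).
  have nr0 : 0 < 2 * (enorm (x - r) + 2) by rewrite mulr_gt0// ltr_wpDl ?enorm_ge0.
  have e0 : 0 < e by rewrite divr_gt0.
  exists ([set n' | enorm (n' - n) < e] , [set r' | enorm (r' - r) < Num.min e 1]).
    split => /=; apply/nbhs_enormP; first by exists e.
    by exists (Num.min e 1) => //; rewrite lt_min e0 ltr01.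
  move=> [n' r'] /= [hn']; rewrite lt_min => /andP[hr' hr1]; exists x => //.
  have -> : dot (x - r') n' = d - dot (r' - r) n + dot (x - r') (n' - n).
    by rewrite /d !dot_linE; ring.
  have h1 := dot_unit_le (r' - r) n1.
  have h2 := cauchy_schwarz_abs (x - r') (n' - n).
  have h3 : enorm (x - r') <= enorm (x - r) + 1.
    by rewrite (le_trans (enorm_triangle _ r _))// lerD2l enormB ltW.
  have h4 : enorm (x - r') * enorm (n' - n) <= (enorm (x - r) + 1) * e.
    by rewrite ler_pM ?enorm_ge0// ltW.
  have de : d = 2 * (e * (enorm (x - r) + 2)).
    by rewrite mulrCA /e divfK// gt_eqF.
  have h1' := le_lt_trans h1 hr'.
  have h2' := le_trans h2 h4.
  rewrite ltr_norml in h1'; rewrite ler_norml in h2'.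
  move: h1' h2' => /andP[_ h1'] /andP[h2' _].
  have : 0 <= e * (enorm (x - r)) by rewrite mulr_ge0 ?enorm_ge0// ltW.
  by rewrite de; lra.
apply: filterS => r' h rr'; apply: contrapT => An.
have [n1 hn] := normalP rr'.
by have [//|x Cx] := h (normal C r'); rewrite ltNge hn.
Qed.

(** * The distribution of normals as a Borel measure *)

Section NormalMeasure.
Variable E : set 'rV[R]_3.
Hypothesis E_reg : E `<=` regular_bd C.
Local Open Scope ereal_scope.

(** The trace on [E] is the right outer measure because on regular points the normal map is
    continuous, so that preimages of open sets agree with open sets there. *)
Let areaE (X : set 'rV[R]_3) := area (E `&` X).

Let areaE0 : areaE set0 = 0.
Proof. by rewrite /areaE setI0 outer_measure0. Qed.

Let areaE_ge0 X : 0 <= areaE X.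
Proof. exact: outer_measure_ge0. Qed.

Let le_areaE : {homo areaE : A B / A `<=` B >-> A <= B}.
Proof. by move=> A B AB; apply: le_outer_measure; exact: setIS. Qed.

Let areaE_subadditive : sigma_subadditive areaE.
Proof.
move=> F; rewrite /areaE setI_bigcupr.
exact: (outer_measure_sigma_subadditive (@area R) (fun i => E `&` F i)).
Qed.

HB.instance Definition _ := isOuterMeasure.Build R 'rV[R]_3 areaE
  areaE0 areaE_ge0 le_areaE areaE_subadditive.

Lemma normal_caratheodory (A : set (borel3 R)) :
  measurable A -> areaE.-caratheodory (normal C @^-1` A).
Proof.
move: A; apply: smallest_sub => [|A oA].
  split => [|A|F].
  - by rewrite preimage_set0; exact: (caratheodory_measurable_set0 areaE).
  - rewrite setTD preimage_setC; exact: (@caratheodory_measurable_setC _ _ areaE).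
  - move=> hF; rewrite preimage_bigcup.
    exact: (@caratheodory_measurable_bigcup _ _ areaE).
(* [O] is open by construction, and by [normal_nbhs] it cuts out of [E] the same points as the
   preimage of [A]. *)
pose O := [set r | regular_bd C r -> (A : set 'rV[R]_3) (normal C r)]^°.
have oO : open O by exact: open_interior.
have EO : E `&` (normal C @^-1` A) = E `&` O.
  apply/seteqP; split => r [Er hr]; split => //.
    by apply: normal_nbhs => //; exact: E_reg.
  exact: (interior_subset hr (E_reg Er)).
have EOC X : E `&` (X `&` ~` (normal C @^-1` A)) = E `&` X `&` ~` O.
  rewrite setIA; apply/seteqP; split => r [[Er Xr] hr]; split => // hr'; apply: hr.
    by have [] : (E `&` (normal C @^-1` A)) r by rewrite EO.
  by have [] : (E `&` O) r by rewrite -EO.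
move=> X; rewrite /areaE EOC setIA setIAC EO setIAC.
exact: open_caratheodory.
Qed.

(** The equation is stated for every set, Borel or not, so that [nu] is equal to such a measure as a
    set function and can be replaced by it under the integral sign. *)
Lemma normal_measure (k : {nonneg R}) :
  exists m : {measure set (borel3 R) -> \bar R},
    forall A, m A = k%:num%:E * area (E `&` normal C @^-1` (A : set 'rV[R]_3)).
Proof.
pose p (A : set (borel3 R)) := areaE (normal C @^-1` A).
have p0 : p set0 = 0 by rewrite /p preimage_set0 areaE0.
have p_ge0 A : 0 <= p A by exact: areaE_ge0.
have p_additive : semi_sigma_additive p.
  move=> F mF tF mUF; rewrite /p preimage_bigcup.
  apply: (@caratheodory_measure_sigma_additive _ _ areaE).
  - by move=> i; exact: normal_caratheodory.
  - apply/trivIsetP => /= i j _ _ ij; rewrite -preimage_setI.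
    by move/trivIsetP : tF => /(_ _ _ _ _ ij) ->//; rewrite preimage_set0.
  - by rewrite -preimage_bigcup; exact: normal_caratheodory.
have mp := isMeasure.Build _ _ _ p p0 p_ge0 p_additive.
pose P : {measure set (borel3 R) -> \bar R} := HB.pack p mp.
by exists (mscale k P) => A.
Qed.

End NormalMeasure.
End ConvexBody.

(** * The body near the edge of its tangent wedge *)

Section TangentWedge.
Variables (R : realType) (C : set 'rV[R]_3) (r0 e1 e2 e : 'rV[R]_3) (l1 l2 : R).
Hypothesis hC : convex_body C.
Hypothesis hr0 : bd C r0.
Hypotheses (e1_unit : enorm e1 = 1) (e2_unit : enorm e2 = 1).
Hypothesis hcone : tangent_cone C r0 =
  [set r | dot (r - r0) e1 <= 0 /\ dot (r - r0) e2 <= 0].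

Let Cr0 : C r0.
Proof. by move: hr0; rewrite bdE// => -[]. Qed.

Lemma tangent_wedge x : C x -> dot (x - r0) e1 <= 0 /\ dot (x - r0) e2 <= 0.
Proof.
move=> Cx; have [->|xr0] := eqVneq x r0; first by rewrite subrr !dot0l.
have : tangent_cone C r0 x.
  apply: subset_closure; exists 1 => //=; exists x; last by rewrite scale1r addrC subrK.
  by split => //; exact/eqP.
by rewrite hcone.
Qed.

(* [C] contains a ball around some [x0]; removing from [v] a small multiple of
   [x0 - r0] leaves a direction of the wedge, approximated by directions of [C],
   and the error is absorbed by the ball. *)
Lemma tangent_wedge_interior v : dot v e1 < 0 -> dot v e2 < 0 ->
  exists2 tau, 0 < tau & C (r0 + tau *: v).
Proof.
move=> v1 v2; have [_ _ [x0 /interior_enormP[rho rho0 hrho]]] := hC.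
have [v0 v0E] : exists v0, v0 = x0 - r0 by exists (x0 - r0).
pose m := Num.min (- dot v e1) (- dot v e2).
have m0 : 0 < m by rewrite lt_min !oppr_gt0 v1.
pose mu := m / (enorm v0 + 1).
have v01 : 0 < enorm v0 + 1 by rewrite ltr_wpDl ?enorm_ge0.
have mu0 : 0 < mu by rewrite divr_gt0.
have small w : enorm w = 1 -> `|mu * dot v0 w| <= m.
  move=> w1; rewrite normrM gtr0_norm// /mu mulrAC ler_pdivrMr// ler_pM2l//.
  by rewrite (le_trans (dot_unit_le v0 w1))// lerDl.
have inw : tangent_cone C r0 (r0 + (v - mu *: v0)).
  rewrite hcone/= addrC addKr !dot_linE.
  have := small _ e1_unit; have := small _ e2_unit; rewrite !ler_norml.
  have : m <= - dot v e1 /\ m <= - dot v e2 by rewrite /m !ge_min !lexx orbT.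
  by move=> [? ?] /andP[? ?] /andP[? ?]; split; lra.
have [|y [[s s0 [p [Cp _] <-]] hy]] := inw [set y | enorm (y - (r0 + (v - mu *: v0))) < mu * rho].
  by apply/nbhs_enormP; exists (mu * rho) => //; rewrite mulr_gt0.
rewrite /= in s0 hy.
(* Chosen so that [s *: (p - r0) + mu *: (z - r0) = v]: dividing by [s + mu] exhibits a point of the
   ray as a convex combination of [p] and [z]. *)
pose z := x0 + mu^-1 *: ((v - mu *: v0) - s *: (p - r0)).
have Cz : C z.
  apply: hrho; rewrite /z addrC addKr enormZ gtr0_norm ?invr_gt0//.
  rewrite mulrC ltr_pdivrMr// [ltRHS]mulrC enormB.
  by have -> : s *: (p - r0) - (v - mu *: v0) =
     r0 + s *: (p - r0) - (r0 + (v - mu *: v0)) by rewrite [in RHS]opprD addrACA subrr add0r.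
have smu : 0 < s + mu by rewrite ltr_wpDl.
exists (s + mu)^-1; first by rewrite invr_gt0.
have := convex_body_conv hC Cp Cz (divr_ge0 (ltW mu0) (ltW smu)).
rewrite ler_pdivrMr// mul1r lerDr => /(_ s0); congr C.
rewrite /z v0E; apply/rowP => i; rewrite !mxE; field.
by rewrite !gt_eqF.
Qed.

End TangentWedge.

Section Edge.
Variables (R : realType) (C : set 'rV[R]_3) (r0 e1 e2 e d : 'rV[R]_3) (l1 l2 P Q : R).

(* Bundles what is used of [C]: [d] spans the edge of the wedge, along which [C]
   contains exactly the segment with abscissas [P, Q]. *)
Record edge_data : Prop := EdgeData {
  edge_body : convex_body C;
  edge_C : C r0;
  edge_e1 : enorm e1 = 1;
  edge_e2 : enorm e2 = 1;
  edge_indep : dot e1 e2 ^+ 2 < 1;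
  edge_d : dot d d = 1;
  edge_de1 : dot d e1 = 0;
  edge_de2 : dot d e2 = 0;
  edge_l1 : 0 < l1;
  edge_l2 : 0 < l2;
  edge_eE : e = l1 *: e1 + l2 *: e2;
  edge_e : enorm e = 1;
  edge_wedge : forall x, C x -> dot (x - r0) e1 <= 0 /\ dot (x - r0) e2 <= 0;
  edge_tip : forall v, dot v e1 < 0 -> dot v e2 < 0 ->
    exists2 tau, 0 < tau & C (r0 + tau *: v);
  edge_P : P <= 0;
  edge_Q : 0 <= Q;
  edge_PQ : P < Q;
  edge_CP : C (r0 + P *: d);
  edge_CQ : C (r0 + Q *: d);
  edge_sub : forall x, C x -> dot (x - r0) e = 0 -> P <= dot (x - r0) d <= Q
}.

End Edge.

Section EdgeGeometry.
Variables (R : realType) (C : set 'rV[R]_3) (r0 e1 e2 e d : 'rV[R]_3) (l1 l2 P Q : R).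

Lemma edge_data_sym : edge_data C r0 e1 e2 e d l1 l2 P Q ->
  edge_data C r0 e2 e1 e d l2 l1 P Q.
Proof.
case=> *; split => //; try by rewrite addrC.
- by rewrite dotC.
- by move=> x Cx; rewrite and_comm; auto.
- by move=> v v2 v1; auto.
Qed.

Hypothesis H : edge_data C r0 e1 e2 e d l1 l2 P Q.

Let k := dot e1 e2.
Let e11 : dot e1 e1 = 1 := enorm1_dot (edge_e1 H).
Let e22 : dot e2 e2 = 1 := enorm1_dot (edge_e2 H).
Let e21 : dot e2 e1 = k := dotC _ _.
Let ed1 : dot e1 d = 0. Proof. by rewrite dotC (edge_de1 H). Qed.
Let ed2 : dot e2 d = 0. Proof. by rewrite dotC (edge_de2 H). Qed.

Definition wedge_sin : R := Num.sqrt (1 - dot e1 e2 ^+ 2).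

Lemma wedge_sin_gt0 : 0 < wedge_sin.
Proof. by rewrite sqrtr_gt0 subr_gt0 (edge_indep H). Qed.

Lemma sqr_wedge_sin : wedge_sin ^+ 2 = 1 - dot e1 e2 ^+ 2.
Proof. by rewrite sqr_sqrtr// subr_ge0 ltW// (edge_indep H). Qed.

Let s0 := wedge_sin_gt0.
Let sn0 : wedge_sin != 0. Proof. by rewrite gt_eqF// s0. Qed.
Let s2 : wedge_sin ^+ 2 = 1 - k ^+ 2 := sqr_wedge_sin.

(* Unit vector of the face orthogonal to [e1] and to the edge, pointing into the wedge. *)
Definition face_dir : 'rV[R]_3 := wedge_sin^-1 *: (dot e1 e2 *: e1 - e2).

(* Unit vector orthogonal to [e] and to the edge. *)
Definition base_dir : 'rV[R]_3 := wedge_sin^-1 *: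
  ((dot e1 e2 * l1 + l2) *: e1 - (l1 + dot e1 e2 * l2) *: e2).

Lemma dot_edge_e x : dot x e = l1 * dot x e1 + l2 * dot x e2.
Proof. by rewrite (edge_eE H) !dot_linE. Qed.

Lemma sqr_edge_e : l1 ^+ 2 + l2 ^+ 2 + 2 * k * l1 * l2 = 1.
Proof.
transitivity (dot e e); last exact: enorm1_dot (edge_e H).
by rewrite (edge_eE H) !dot_linE e11 e22 e21 -/k; ring.
Qed.

Lemma dot_face_dir x :
  dot x face_dir = wedge_sin^-1 * (dot e1 e2 * dot x e1 - dot x e2).
Proof. by rewrite /face_dir !dot_linE. Qed.

Lemma dot_base_dir x : dot x base_dir = wedge_sin^-1 *
  ((dot e1 e2 * l1 + l2) * dot x e1 - (l1 + dot e1 e2 * l2) * dot x e2).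
Proof. by rewrite /base_dir !dot_linE. Qed.

Lemma face_frame : orthonormal d face_dir e1.
Proof.
split; rewrite ?e11 ?(edge_d H)//.
- rewrite dot_face_dir ![dot face_dir _]dotC !dot_face_dir e11 e22 e21 -/k.
  by apply: (mulfI (expf_neq0 2 sn0)); rewrite [RHS]mulr1 [RHS]s2; field.
- by rewrite dot_face_dir (edge_de1 H) (edge_de2 H); ring.
- rewrite (edge_de1 H); split => //; rewrite dotC dot_face_dir e11 -/k; ring.
Qed.

Lemma base_frame : orthonormal d base_dir e.
Proof.
have se := sqr_edge_e.
split; rewrite ?(edge_d H)//.
- rewrite dot_base_dir ![dot base_dir _]dotC !dot_base_dir e11 e22 e21 -/k.
  apply: (mulfI (expf_neq0 2 sn0)); rewrite [RHS]mulr1 [RHS]s2.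
  transitivity ((1 - k ^+ 2) * (l1 ^+ 2 + l2 ^+ 2 + 2 * k * l1 * l2)).
    by field.
  by rewrite se mulr1.
- exact: enorm1_dot (edge_e H).
- by rewrite dot_base_dir (edge_de1 H) (edge_de2 H); ring.
- rewrite dot_edge_e (edge_de1 H) (edge_de2 H); split; first ring.
  by rewrite dotC dot_base_dir ![dot e _]dotC !dot_edge_e e11 e22 e21 -/k; ring.
Qed.

(** The points of [C] whose abscissa leaves []P - eta, Q + eta[] form a compact set on which the
    depth is positive by [edge_sub], hence bounded away from zero. *)
Lemma edge_outer (eta : R) : 0 < eta -> exists2 h, 0 < h & forall x, C x ->
  - dot (x - r0) e <= h -> P - eta <= dot (x - r0) d <= Q + eta.
Proof.
move=> eta0.
have cl (f : 'rV[R]_3 -> R) (a : R) u :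
    (forall x, f x = dot x u - dot r0 u) -> closed [set x | a <= f x].
  move=> fE; have -> : [set x | a <= f x] = (fun x => dot x u) @^-1` [set z | a + dot r0 u <= z].
    by apply/seteqP; split=> x /=; rewrite fE lerBrDr.
  by apply: closed_comp => [x _|]; [exact: continuous_dotl|exact: closed_ge].
pose K := C `&` ([set x | Q + eta <= dot (x - r0) d] `|`
                 [set x | - P + eta <= dot (x - r0) (- d)]).
have cK : compact K.
  case: (edge_body H) => _ cC _; apply: compact_closedI => //.
  by apply: closedU; apply: cl => x; rewrite dotBl.
have e_le0 x : C x -> dot (x - r0) e <= 0.
  move=> /(edge_wedge H)[x1 x2]; rewrite dot_edge_e.
  by have := mulr_ge0_le0 (ltW (edge_l1 H)) x1; have := mulr_ge0_le0 (ltW (edge_l2 H)) x2; lra.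
have pos x : K x -> dot (x - r0) e < 0.
  move=> [Cx hx]; rewrite lt_neqAle e_le0// andbT; apply/eqP => /(edge_sub H Cx).
  by move: hx; rewrite /= dotNr => -[hx|hx] /andP[? ?]; lra.
have : \forall h \near (0 : R)^'+, K `<=` [set x | h < - dot (x - r0) e].
  apply: ((compact_near_coveringP K).1 cK _ (0 : R)^'+
    (fun h x => h < - dot (x - r0) e)) => x /pos xe.
  have c0 : 0 < - dot (x - r0) e / 2 by rewrite divr_gt0// oppr_gt0.
  exists ([set y | enorm (y - x) < - dot (x - r0) e / 2],
          [set h | h < - dot (x - r0) e / 2]).
    split => /=; first by apply/nbhs_enormP; exists (- dot (x - r0) e / 2).
    exact: nbhs_right_lt.
  move=> [y h] /= [hy hh].
  have := le_lt_trans (dot_unit_le (y - x) (edge_e H)) hy.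
  have -> : y - r0 = (y - x) + (x - r0) by rewrite addrA subrK.
  by rewrite (dotDl (y - x) (x - r0)) ltr_norml => /andP[_ ?]; lra.
move=> hK.
have [h [h0 hh]] : exists h, 0 < h /\ K `<=` [set x | h < - dot (x - r0) e].
  have [h [? ?]] := filter_ex (filterI (nbhs_right_gt (0 : R)) hK).
  by exists h.
exists h => // x Cx xh.
have nK : ~ K x by move=> /hh/=; rewrite ltNge xh.
apply/andP; split; rewrite leNgt; apply/negP => hx; apply: nK; split => //.
  by right; rewrite /= dotNr; lra.
by left; exact: ltW.
Qed.

Lemma edge_segment (s : R) : P <= s -> s <= Q -> C (r0 + s *: d).
Proof.
move=> Ps sQ; have PQ := edge_PQ H; have PQ0 : 0 < Q - P by lra.
have h0 : 0 <= (s - P) / (Q - P) by apply: divr_ge0; lra.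
have h1 : (s - P) / (Q - P) <= 1 by rewrite ler_pdivrMr//; lra.
have := convex_body_conv (edge_body H) (edge_CP H) (edge_CQ H) h0 h1; congr C.
by apply/rowP => i; rewrite !mxE; field; rewrite gt_eqF.
Qed.

Lemma edge_inner (eta : R) : 0 < eta -> eta < 1 -> exists2 t0, 0 < t0 &
  forall t x, 0 < t -> t < t0 -> P + eta <= dot (x - r0) d <= Q - eta ->
    eta * t <= - dot (x - r0) e1 <= t / eta ->
    eta * t <= - dot (x - r0) e2 <= t / eta -> C x.
Proof.
move=> eta0 eta1; have hC := edge_body H.
have PQ := edge_PQ H; have P0 := edge_P H; have Q0 := edge_Q H.
(* [- f1] and [- f2] are dual to [e1] and [e2] in the plane orthogonal to [d], so that
   [x - r0 = al *: d + a1 *: f1 + a2 *: f2] in the notation below. The two bounds on [a1] and [a2]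
   keep their ratio between [ep = eta ^+ 2] and its inverse. *)
pose f1 := wedge_sin ^- 2 *: (k *: e2 - e1); pose f2 := wedge_sin ^- 2 *: (k *: e1 - e2).
have w2 : 1 - k ^+ 2 != 0 by rewrite -s2 expf_neq0.
have f11 : dot f1 e1 = -1 by rewrite /f1 !dot_linE e11 e21 s2; field.
have f12 : dot f1 e2 = 0 by rewrite /f1 !dot_linE e22 -/k s2; field.
have f21 : dot f2 e1 = 0 by rewrite /f2 !dot_linE e11 e21 s2; field.
have f22 : dot f2 e2 = -1 by rewrite /f2 !dot_linE e22 -/k s2; field.
have f1d : dot f1 d = 0 by rewrite /f1 !dot_linE ed1 ed2; ring.
have f2d : dot f2 d = 0 by rewrite /f2 !dot_linE ed1 ed2; ring.
clearbody f1 f2; pose ep := eta ^+ 2.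
have ep0 : 0 < ep by rewrite exprn_gt0.
have ep1 : ep < 1 by rewrite exprn_ilt1// ltW.
have [tau1 tau10 C1] : exists2 tau, 0 < tau & C (r0 + tau *: (f1 + ep *: f2)).
  by apply: (edge_tip H); rewrite !dot_linE ?f11 ?f12 ?f21 ?f22; lra.
have [tau2 tau20 C2] : exists2 tau, 0 < tau & C (r0 + tau *: (ep *: f1 + f2)).
  by apply: (edge_tip H); rewrite !dot_linE ?f11 ?f12 ?f21 ?f22; lra.
have [tau [tau0 {}C1 {}C2]] : exists tau, [/\ 0 < tau, C (r0 + tau *: (f1 + ep *: f2)) &
    C (r0 + tau *: (ep *: f1 + f2))].
  exists (Num.min tau1 tau2); rewrite lt_min tau10 tau20; split => //.
    by apply: (convex_body_ray hC (edge_C H) C1); [rewrite le_min !ltW|rewrite ge_min lexx].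
  by apply: (convex_body_ray hC (edge_C H) C2); [rewrite le_min !ltW|rewrite ge_min lexx orbT].
(* Since [a1 + a2 <= 2 * (t / eta)], this threshold yields [S * (Q - P + 1) <= eta] below; the
   summand [1] gives [S < 1] as well. *)
exists (eta ^+ 2 * tau / (2 * (Q - P + 1))).
  by rewrite divr_gt0 ?mulr_gt0//; lra.
move=> t x t0 tt /andP[alP alQ] /andP[a1l a1u] /andP[a2l a2u].
set al := dot (x - r0) d in alP alQ.
set a1 := - dot (x - r0) e1 in a1l a1u; set a2 := - dot (x - r0) e2 in a2l a2u.
have ept : ep * (t / eta) = eta * t by rewrite /ep; field; rewrite gt_eqF.
have et0 : 0 < eta * t by rewrite mulr_gt0.
have b1 : ep * a2 <= a1 by rewrite (le_trans _ a1l)// -ept ler_pM2l.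
have b2 : ep * a1 <= a2 by rewrite (le_trans _ a2l)// -ept ler_pM2l.
pose S := (a1 + a2) / ((1 + ep) * tau).
have S0 : 0 < S by rewrite divr_gt0 ?mulr_gt0//; lra.
have SPQ : S * (Q - P + 1) <= eta.
  have Ele : S * (Q - P + 1) <= 2 * (t / eta) / tau * (Q - P + 1).
    rewrite ler_pM2r; last lra.
    rewrite /S ler_pdivrMr ?mulr_gt0//; last lra.
    have -> : 2 * (t / eta) / tau * ((1 + ep) * tau) = 2 * (t / eta) * (1 + ep).
      by field; rewrite !gt_eqF.
    have : 0 <= t / eta * ep by rewrite mulr_ge0 ?divr_ge0 ?ltW.
    by rewrite mulrDr mulr1; lra.
  apply: le_trans Ele _.
  have QP1 : 0 < Q - P + 1 by lra.
  rewrite ltr_pdivlMr ?mulr_gt0// in tt.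
  rewrite -(ler_pM2r (mulr_gt0 eta0 tau0)).
  have -> : 2 * (t / eta) / tau * (Q - P + 1) * (eta * tau) = t * (2 * (Q - P + 1)).
    by field; rewrite !gt_eqF.
  by apply: le_trans (ltW tt) _; rewrite expr2 mulrA.
have S1 : S < 1 by have : S * 1 <= S * (Q - P + 1) by [rewrite ler_pM2l//; lra]; nra.
have SQ : S * Q <= eta by nra.
have SP : S * (- P) <= eta by nra.
have S10 : 0 < 1 - S by lra.
have Cd : C (r0 + (al / (1 - S)) *: d).
  by apply: edge_segment; rewrite ?ler_pdivrMr ?ler_pdivlMr//; lra.
have a12 : 0 < a1 + a2 by lra.
(* [S] matches the sum [a1 + a2], and [c] the proportion of the two: [ep + c * (1 - ep)] has to be
   [(1 + ep) * a2 / (a1 + a2)]. *)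
pose c := (a2 - ep * a1) / ((1 - ep) * (a1 + a2)).
have den : 0 < (1 - ep) * (a1 + a2) by rewrite mulr_gt0//; lra.
have c0 : 0 <= c by apply: divr_ge0; lra.
have c1 : c <= 1 by rewrite ler_pdivrMr//; nra.
have C12 := convex_body_conv hC C1 C2 c0 c1.
have := convex_body_conv hC Cd C12 (ltW S0) (ltW S1); congr C.
have xd : dot x d = al + dot r0 d by rewrite /al dotBl subrK.
have x1 : dot x e1 = dot r0 e1 - a1 by rewrite /a1 dotBl; ring.
have x2 : dot x e2 = dot r0 e2 - a2 by rewrite /a2 dotBl; ring.
have nz : [/\ 1 + ep != 0, 1 - ep != 0, a1 + a2 != 0, tau != 0 & 1 - S != 0].
  by split; rewrite gt_eqF//; lra.
case: nz => nz1 nz2 nz3 nz4 nz5.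
clearbody al a1 a2; set y := LHS.
have yd : dot y d = dot x d.
  by rewrite xd /y !dot_linE f1d f2d (edge_d H); field.
have y1 : dot y e1 = dot x e1.
  rewrite x1 /y !dot_linE f11 f21 (edge_de1 H) !mulr0 /c /S; field.
  by rewrite nz1 nz2 nz3 nz4.
have y2 : dot y e2 = dot x e2.
  rewrite x2 /y !dot_linE f12 f22 (edge_de2 H) !mulr0 /c /S; field.
  by rewrite nz1 nz2 nz3 nz4.
by apply: (orthonormal_eq face_frame) => //; rewrite !dot_face_dir y1 y2.
Qed.

End EdgeGeometry.

(** * Caps and slices *)

(** A pair [(a, b)] stands for the affine function [a + s * b], a constraint of a polyhedron along a
    ray; [s] is the first time at which a constraint becomes tight. In the induction, if the head is
    violated at the exit time of the tail, then its own zero comes earlier. *)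
Lemma first_exit (R : realType) (l : seq (R * R)) :
  all (fun p => 0 <= p.1) l -> has (fun p => p.2 < 0) l ->
  exists2 s, 0 <= s & has (fun p => p.1 + s * p.2 == 0) l &&
                      all (fun p => 0 <= p.1 + s * p.2) l.
Proof.
elim: l => [//|[a b] l ih] /=/andP[a0 l0].
have [lneg _|/hasPn lpos /orP[b0|//]] := boolP (has (fun p => p.2 < 0) l); last first.
  have s0 : 0 <= a / - b by rewrite divr_ge0// oppr_ge0 ltW.
  have E : a + a / - b * b = 0 by field; rewrite lt_eqF.
  exists (a / - b) => //; rewrite E eqxx lexx/=.
  apply/allP => p pl; rewrite addr_ge0 ?(allP l0)// mulr_ge0// leNgt.
  exact: lpos.
have [s s0 /andP[hs /allP ss]] := ih l0 lneg.
have [ab|ab] := leP 0 (a + s * b).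
  by exists s => //; rewrite hs orbT/= ab; apply/allP.
have b0 : b < 0 by nra.
have s'0 : 0 <= a / - b by rewrite divr_ge0// oppr_ge0 ltW.
have s's : a / - b <= s by rewrite ler_pdivrMr ?oppr_gt0//; lra.
have E : a + a / - b * b = 0 by field; rewrite lt_eqF.
exists (a / - b) => //; rewrite E eqxx lexx/=.
apply/allP => p pl; have := ss _ pl; have := allP l0 _ pl.
have [p0|p0] := leP 0 p.2; first by move=> ? _; rewrite addr_ge0// mulr_ge0.
by move=> _ /le_trans; apply; rewrite lerD2l ler_wnM2r// ltW.
Qed.

Section CapBounds.
Variables (R : realType) (C : set 'rV[R]_3) (r0 e1 e2 e d : 'rV[R]_3) (l1 l2 P Q : R).

(* [wedge_width * t] is the width of the section of the wedge at depth [t]; the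
   parts of its two faces above that section are [l1] and [l2] times as wide. *)
Definition wedge_width : R := (wedge_sin e1 e2 * l1 * l2)^-1.

(** At depth at most [t] in the wedge, [- dot x ei <= t / li], so the coordinate along [face_dir] is
    at most [end_const * t] in absolute value. *)
Definition end_const : R := (wedge_sin e1 e2)^-1 * (l1^-1 + l2^-1).

Definition box (eta t : R) : set 'rV[R]_3 := [set x |
  [/\ P - eta <= dot (x - r0) d <= Q + eta, dot (x - r0) e1 <= 0,
      dot (x - r0) e2 <= 0 & - t <= dot (x - r0) e]].

Definition base (eta t : R) : set 'rV[R]_3 :=
  box eta t `&` [set x | dot (x - r0) e = - t].

(** The region that [edge_inner] places inside [C], with strict inequalities to make it open. *)
Definition core (eta t : R) : set 'rV[R]_3 := [set x |
  [/\ P + eta < dot (x - r0) d < Q - eta, eta * t < - dot (x - r0) e1 < t / eta &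
      eta * t < - dot (x - r0) e2 < t / eta]].

Hypothesis H : edge_data C r0 e1 e2 e d l1 l2 P Q.

Let k := dot e1 e2.
Let sg := wedge_sin e1 e2.
Let sg0 : 0 < sg := wedge_sin_gt0 H.
Let l10 := edge_l1 H.
Let l20 := edge_l2 H.
Let omega := wedge_width.

Lemma wedge_width_gt0 : 0 < wedge_width.
Proof. by rewrite invr_gt0 !mulr_gt0. Qed.

Let omega0 : 0 < omega := wedge_width_gt0.

Lemma area_face_le (eta t : R) (A : set 'rV[R]_3) : 0 <= eta -> 0 <= t ->
  A `<=` box eta t `&` [set x | dot (x - r0) e1 = 0] ->
  (area A <= (area_unit R * ((Q - P + 2 * eta) * (l1 * omega * t)))%:E)%E.
Proof.
move=> eta0 t0 hA; have PQ := edge_PQ H.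
apply: (@area_le_rect _ (r0 + (P - eta) *: d) _ _ _ _ _ _ (face_frame H)); first lra.
  by apply: mulr_ge0 => //; apply: mulr_ge0; exact: ltW.
move=> x /hA[[/andP[xP xQ] x1 x2 xe] x10].
have sh y : dot (x - (r0 + (P - eta) *: d)) y = dot (x - r0) y - (P - eta) * dot d y.
  by rewrite !dot_linE; ring.
have [_ _ _ df [de1 _]] := face_frame H.
rewrite /= in x10.
rewrite !sh (edge_d H) df (edge_de1 H) !mulr0 mulr1 !subr0 dot_face_dir x10.
split => //; first by apply/andP; split; lra.
rewrite (dot_edge_e H) x10 in xe.
rewrite mulr0 sub0r mulrN oppr_ge0 pmulr_rle0 ?invr_gt0// x2/=.
rewrite -mulrN mulrC ler_pdivrMr//.
have -> : l1 * omega * t * wedge_sin e1 e2 = t / l2.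
  by rewrite /omega /wedge_width; field; rewrite !gt_eqF.
by rewrite ler_pdivlMr//; lra.
Qed.

(** The corner of the base with abscissa [a] that lies on the face orthogonal to [e2]. Within the
    base, the coordinate along [base_dir] measured from there is proportional to the distance to
    that face. *)
Let base_orig (a t : R) : 'rV[R]_3 :=
  r0 + (a *: d - t *: e - ((k * l1 + l2) * t / (l1 * sg)) *: base_dir e1 e2 l1 l2).

Let base_coords (a t : R) x : [/\ dot (x - base_orig a t) e = dot (x - r0) e + t,
  dot (x - base_orig a t) d = dot (x - r0) d - a &
  dot (x - base_orig a t) e = 0 ->
  dot (x - base_orig a t) (base_dir e1 e2 l1 l2) = - (omega * l2) * dot (x - r0) e2].
Proof.
have [dd ww ee dw [de we]] := base_frame H.
have sh y : dot (x - base_orig a t) y = dot (x - r0) y - a * dot d y + t * dot e y +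
    ((k * l1 + l2) * t / (l1 * sg)) * dot (base_dir e1 e2 l1 l2) y.
  by rewrite /base_orig !dot_linE; ring.
rewrite !sh dd ww ee dw de we (dotC e d) de (dotC (base_dir _ _ _ _) d) dw.
rewrite (dotC e (base_dir _ _ _ _)) we.
split; [ring|ring|].
have se := sqr_edge_e H.
rewrite dot_base_dir (dot_edge_e H) -/k -/sg /omega /wedge_width -/sg.
set X1 := dot _ e1; set X2 := dot _ e2 => h.
have X1E : X1 = (- t - l2 * X2) / l1.
  apply: (mulIf (lt0r_neq0 l10)); rewrite divfK ?gt_eqF//; lra.
transitivity (- X2 * (l1 ^+ 2 + l2 ^+ 2 + 2 * k * l1 * l2) / (sg * l1)).
  by rewrite X1E; field; rewrite !gt_eqF.
by rewrite se; field; rewrite !gt_eqF.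
Qed.

Lemma area_base_le (eta t : R) : 0 <= eta -> 0 <= t ->
  (area (base eta t) <= (area_unit R * ((Q - P + 2 * eta) * (omega * t)))%:E)%E.
Proof.
move=> eta0 t0; have PQ := edge_PQ H.
apply: (@area_le_rect _ (base_orig (P - eta) t) _ _ _ _ _ _ (base_frame H)); first lra.
  by apply: mulr_ge0 => //; exact: ltW.
move=> x [[/andP[xP xQ] x1 x2 _] /= xe].
have [ce cd cw] := base_coords (P - eta) t x.
have ce0 : dot (x - base_orig (P - eta) t) e = 0 by rewrite ce xe addNr.
rewrite ce0 cd (cw ce0); split => //; first by apply/andP; split; lra.
have X2l : - l2 * dot (x - r0) e2 <= t.
  by have := mulr_ge0_le0 (ltW l10) x1; rewrite (dot_edge_e H) in xe; lra.
apply/andP; split.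
  rewrite mulNr oppr_ge0; apply: mulr_ge0_le0 => //.
  by apply: mulr_ge0; exact: ltW.
by rewrite -mulrN -mulrA ler_pM2l// mulNr -mulNr.
Qed.

Lemma area_core_ge (eta t : R) : 0 < eta -> 0 < t -> eta < l1 -> eta < l2 ->
  2 * eta <= Q - P -> (l1 + l2) * eta <= 1 ->
  ((area_unit R * ((Q - P - 2 * eta) * (omega * t * (1 - (l1 + l2) * eta))))%:E <=
   area (base eta t `&` core eta t))%E.
Proof.
move=> eta0 t0 eta1 eta2 etaPQ etal.
(* The lower bounds [eta * t] cut strips of widths [omega * l2 * (eta * t)] and
   [omega * l1 * (eta * t)] off the two sides of the base; the first one is the shift of the
   origin. *)
pose o := base_orig (P + eta) t + (omega * l2 * (eta * t)) *: base_dir e1 e2 l1 l2.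
have [dd ww ee dw [de we]] := base_frame H.
apply: (@area_ge_rect _ o _ _ _ _ _ _ (base_frame H)); first lra.
  by apply: mulr_ge0; [apply: mulr_ge0; exact: ltW|lra].
have sh x y : dot (x - o) y = dot (x - base_orig (P + eta) t) y -
    (omega * l2 * (eta * t)) * dot (base_dir e1 e2 l1 l2) y.
  by rewrite /o !dot_linE; ring.
move=> x; rewrite !sh ww we (dotC (base_dir _ _ _ _) d) dw !mulr0 mulr1 !subr0 => ce0.
have [ce cd cw] := base_coords (P + eta) t x.
rewrite cd (cw ce0) => /andP[d1 d2] /andP[w1 w2].
have xe : dot (x - r0) e = - t by rewrite ce in ce0; lra.
have X2l : eta * t < - dot (x - r0) e2.
  rewrite -(ltr_pM2l (mulr_gt0 omega0 l20)); lra.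
have X1l : eta * t < - dot (x - r0) e1.
  have : omega * (- l2 * dot (x - r0) e2) < omega * (t * (1 - l1 * eta)) by lra.
  rewrite ltr_pM2l// => h; rewrite -(ltr_pM2l l10).
  by rewrite (dot_edge_e H) in xe; lra.
have et0 : 0 < eta * t by rewrite mulr_gt0.
have small (a l : R) : eta < l -> 0 < a -> l * a <= t -> a < t / eta.
  by move=> el a0 h; rewrite ltr_pdivlMr// (lt_le_trans _ h)// mulrC ltr_pM2r.
rewrite (dot_edge_e H) in xe.
have p1 : 0 < l1 * - dot (x - r0) e1 by rewrite mulr_gt0//; lra.
have p2 : 0 < l2 * - dot (x - r0) e2 by rewrite mulr_gt0//; lra.
split; [split => //=|split => //].
- split; [by apply/andP; split; lra|lra|lra|by rewrite (dot_edge_e H); lra].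
- by rewrite (dot_edge_e H).
- by apply/andP; split; lra.
- by rewrite X1l (@small _ l1)//; lra.
- by rewrite X2l (@small _ l2)//; lra.
Qed.

Lemma open_core (eta t : R) : open (core eta t).
Proof.
have op (u : 'rV[R]_3) a b : open [set x : 'rV[R]_3 | a < dot (x - r0) u < b].
  rewrite [X in open X](_ : _ = (fun x => dot x u) @^-1`
      ([set z | a + dot r0 u < z] `&` [set z | z < b + dot r0 u])).
    apply: open_comp => [x _|]; first exact: continuous_dotl.
    by apply: openI; [exact: open_gt|exact: open_lt].
  apply/seteqP; split=> x /=; rewrite dotBl ltrBrDr ltrBlDr.
    by move=> /andP[].
  by move=> [-> ->].
rewrite [X in open X](_ : _ = [set x | P + eta < dot (x - r0) d < Q - eta] `&`
   ([set x | eta * t < dot (x - r0) (- e1) < t / eta] `&`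
    [set x | eta * t < dot (x - r0) (- e2) < t / eta])).
  by apply: openI => //; apply: openI.
apply/seteqP; split => x /=; rewrite /core/= !dotNr; first by case.
by move=> [? []].
Qed.

Lemma area_end_le (eta t a : R) (A : set 'rV[R]_3) : 0 <= t ->
  A `<=` box eta t `&` [set x | dot (x - r0) d = a] ->
  (area A <= (area_unit R * ((t / l1) * (2 * (end_const * t))))%:E)%E.
Proof.
move=> t0 hA.
have [dd ff e11 df [de fe]] := face_frame H.
have fr : orthonormal e1 (face_dir e1 e2) d.
  by split => //; [rewrite dotC|split; rewrite dotC].
have ec0 : 0 <= end_const.
  by apply: mulr_ge0; [|apply: addr_ge0]; rewrite invr_ge0; exact: ltW.
apply: (@area_le_rect _ (r0 + (a *: d - (t / l1) *: e1 - (end_const * t) *: face_dir e1 e2))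
  _ _ _ _ _ _ fr).
- by rewrite divr_ge0// ltW.
- by apply: mulr_ge0 => //; exact: mulr_ge0.
move=> x /hA[[_ x1 x2 xe] /= xa].
have sh y : dot (x - (r0 + (a *: d - (t / l1) *: e1 - (end_const * t) *: face_dir e1 e2))) y
    = dot (x - r0) y - a * dot d y + (t / l1) * dot e1 y + end_const * t * dot (face_dir e1 e2) y.
  by rewrite !dot_linE; ring.
rewrite !sh dd ff e11 df de fe (dotC e1 d) de (dotC (face_dir _ _) d) df.
rewrite (dotC e1 (face_dir _ _)) fe xa.
rewrite !mulr0 !mulr1 !addr0 !subr0 subrr.
rewrite (dot_edge_e H) in xe.
have h1 := mulr_ge0_le0 (ltW l10) x1; have h2 := mulr_ge0_le0 (ltW l20) x2.
have X1 : - dot (x - r0) e1 <= t / l1 by rewrite ler_pdivlMr//; lra.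
have X2 : - dot (x - r0) e2 <= t / l2 by rewrite ler_pdivlMr//; lra.
have kk : `|k| <= 1.
  by have := dot_unit_le e1 (edge_e2 H); rewrite (edge_e1 H).
rewrite ler_norml in kk; case/andP: kk => k1 k2.
split => //; first by apply/andP; split; lra.
rewrite dot_face_dir -/k -/sg.
have fb : `|k * dot (x - r0) e1 - dot (x - r0) e2| <= t * (l1^-1 + l2^-1).
  by rewrite ler_norml; apply/andP; split; nra.
have : `|sg^-1 * (k * dot (x - r0) e1 - dot (x - r0) e2)| <= end_const * t.
  rewrite normrM gtr0_norm ?invr_gt0// /end_const -mulrA ler_pM2l ?invr_gt0//.
  by rewrite [leRHS]mulrC.
by rewrite ler_norml => /andP[? ?]; apply/andP; split; lra.
Qed.

End CapBounds.

Lemma wedge_widthC (R : realType) (e1 e2 : 'rV[R]_3) (l1 l2 : R) :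
  wedge_width e2 e1 l2 l1 = wedge_width e1 e2 l1 l2.
Proof. by rewrite /wedge_width /wedge_sin (dotC e1) mulrAC. Qed.

(** * Upper bound for the area of the cap *)

Section CapUpperBound.
Variables (R : realType) (C : set 'rV[R]_3) (r0 e1 e2 e d : 'rV[R]_3) (l1 l2 P Q : R).
Hypothesis H : edge_data C r0 e1 e2 e d l1 l2 P Q.
Variables eta t : R.
Hypotheses (eta0 : 0 < eta) (t0 : 0 < t) (eta1 : eta < l1) (eta2 : eta < l2).
Hypotheses (etaPQ : 2 * eta <= Q - P) (etal : (l1 + l2) * eta <= 1).
Hypothesis outer : forall x, C x -> - dot (x - r0) e <= t ->
  P - eta <= dot (x - r0) d <= Q + eta.
Hypothesis inner : core r0 e1 e2 d P Q eta t `<=` C.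

Let omega := wedge_width e1 e2 l1 l2.
Let c := area_unit R.
Let L := Q - P.
Let boxt := box r0 e1 e2 e d P Q eta t.
Let baset := base r0 e1 e2 e d P Q eta t.
Let coret := core r0 e1 e2 d P Q eta t.

Let C_box x : C x -> - t <= dot (x - r0) e -> boxt x.
Proof.
move=> Cx xt; have [x1 x2] := edge_wedge H Cx.
by split => //; apply: outer => //; lra.
Qed.

Lemma area_slice_ge :
  ((c * ((L - 2 * eta) * (omega * t * (1 - (l1 + l2) * eta))))%:E <=
   area (slice C r0 e t))%E.
Proof.
apply: le_trans (area_core_ge H eta0 t0 eta1 eta2 etaPQ etal) _.
by apply: subset_area => x [[_ xe] xc]; split => //; exact: inner.
Qed.

Lemma area_slice_le :
  (area (slice C r0 e t) <= (c * ((L + 2 * eta) * (omega * t)))%:E)%E.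
Proof.
apply: le_trans (area_base_le H (ltW eta0) (ltW t0)).
by apply: subset_area => x [Cx /= xe]; split => //; apply: C_box => //; rewrite xe.
Qed.

(** As [core] is open, area is additive on this splitting of the base, and the bounds for the base
    and its core can be subtracted. The result is of order [eta * t]. *)
Lemma area_base_core_le : (area (baset `&` ~` coret) <=
  (c * ((L + 2 * eta) * (omega * t) -
        (L - 2 * eta) * (omega * t * (1 - (l1 + l2) * eta))))%:E)%E.
Proof.
have := area_base_le H (ltW eta0) (ltW t0).
rewrite [X in (X <= _)%E](area_openID (@open_core _ r0 e1 e2 d P Q eta t)) => h.
have := leeD (area_core_ge H eta0 t0 eta1 eta2 etaPQ etal) (lexx (area (baset `&` ~` coret))).
move=> /le_trans /(_ h).
by rewrite addeC -leeBrDr// -EFinB -mulrBr.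
Qed.

Let pieces : set 'rV[R]_3 :=
  (boxt `&` [set x | dot (x - r0) e1 = 0]) `|`
  ((boxt `&` [set x | dot (x - r0) e2 = 0]) `|`
  ((boxt `&` [set x | dot (x - r0) d = P - eta]) `|`
  ((boxt `&` [set x | dot (x - r0) d = Q + eta]) `|` (baset `&` ~` coret)))).

Let coret_int : coret `<=` C^°.
Proof.
have <- : coret^° = coret by apply/interior_id; exact: open_core.
exact: interiorS.
Qed.

(** The ray has to leave the bounded box. If it does so through the base, it misses [core], because
    an outward ray never enters the interior of [C], which contains [core]. *)
Let outward_ray r : C r -> - t <= dot (r - r0) e -> forall n, outward_unit_normal C r n ->
  exists2 s, 0 <= s & pieces (r + s *: n).
Proof.
move=> Cr rt n hn; have [[rP rQ] r1 r2 _] : [/\ P - eta <= dot (r - r0) d /\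
    dot (r - r0) d <= Q + eta, dot (r - r0) e1 <= 0, dot (r - r0) e2 <= 0 & True].
  by have [/andP[? ?] ? ? _] := C_box Cr rt.
pose l := [:: (- dot (r - r0) e1, - dot n e1); (- dot (r - r0) e2, - dot n e2);
  (dot (r - r0) d - (P - eta), dot n d); (Q + eta - dot (r - r0) d, - dot n d);
  (dot (r - r0) e + t, dot n e)].
have lA : all (fun p => 0 <= p.1) l by rewrite /= !andbT; apply/and5P; split; lra.
(* If no constraint decreased along [n], then [dot n e1 <= 0], [dot n e2 <= 0] and [0 <= dot n e]
   would force [n = 0]. *)
have lB : has (fun p => p.2 < 0) l.
  apply/negPn/negP => /hasPn h.
  have n1 : dot n e1 <= 0.
    by have := h (_, _) (mem_head _ _); rewrite /= -leNgt oppr_ge0.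
  have hh p : p \in l -> 0 <= p.2 by move=> /h; rewrite -leNgt.
  have n2 : dot n e2 <= 0.
    by rewrite -oppr_ge0; apply: (hh (- dot (r - r0) e2, - dot n e2)); rewrite !inE eqxx ?orbT.
  have n3 : 0 <= dot n d.
    by apply: (hh (dot (r - r0) d - (P - eta), dot n d)); rewrite !inE eqxx ?orbT.
  have n4 : dot n d <= 0.
    by rewrite -oppr_ge0; apply: (hh (Q + eta - dot (r - r0) d, - dot n d)); rewrite !inE eqxx ?orbT.
  have n5 : 0 <= dot n e.
    by apply: (hh (dot (r - r0) e + t, dot n e)); rewrite !inE eqxx ?orbT.
  rewrite (dot_edge_e H) in n5.
  have m1 := mulr_ge0_le0 (ltW (edge_l1 H)) n1.
  have m2 := mulr_ge0_le0 (ltW (edge_l2 H)) n2.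
  have z1 : dot n e1 = 0.
    by apply: (mulfI (lt0r_neq0 (edge_l1 H))); rewrite mulr0; lra.
  have z2 : dot n e2 = 0.
    by apply: (mulfI (lt0r_neq0 (edge_l2 H))); rewrite mulr0; lra.
  have n0 : n = 0.
    apply: (orthonormal_eq (face_frame H)); rewrite !dot0l ?z1//; first lra.
    by rewrite dot_face_dir z1 z2; ring.
  by have := hn.1; rewrite n0 enorm0; lra.
have [s s0 /andP[sE sA]] := first_exit lA lB.
exists s => //; set z := r + s *: n.
have zE y : dot (z - r0) y = dot (r - r0) y + s * dot n y by rewrite /z !dot_linE; ring.
move: sA; rewrite /= !andbT => /and5P[A1 A2 A3 A4 A5].
have zbox : boxt z.
  by split; rewrite !zE; [apply/andP; split| | |]; lra.
have zC : ~ C^° z.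
  move=> /(outward_normal_int hn); rewrite /z addrC addKr dotZl enorm1_dot ?hn.1//.
  lra.
move: sE; rewrite /= orbF => /or4P[|||/orP[]] /eqP E.
- by left; split => //=; rewrite zE; lra.
- by right; left; split => //=; rewrite zE; lra.
- by right; right; left; split => //=; rewrite zE; lra.
- by right; right; right; left; split => //=; rewrite zE; lra.
- right; right; right; right; split; last by move=> /coret_int.
  by split => //=; rewrite zE; lra.
Qed.

(* Pushing the points of the cap along their outward normals to the boundary of
   the box does not decrease distances. *)
Lemma area_cap_le_pieces : (area (cap C r0 e t `&` regular_bd C) <= area pieces)%E.
Proof.
have hC := edge_body H.
have ex r : exists z, (cap C r0 e t `&` regular_bd C) r ->
    pieces z /\ exists2 s, 0 <= s & z = r + s *: normal C r.
  have [[[rC rt] rr]|nr] := pselect ((cap C r0 e t `&` regular_bd C) r); last by exists 0.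
  have Cr : C r by move: rC; rewrite (bdE hC) => -[].
  have [s s0 hs] := outward_ray Cr rt (normalP rr).
  by exists (r + s *: normal C r) => _; split => //; exists s.
have [g hg] := choice ex.
apply: (area_expanding (g := g)) => [r /hg[]//|r r' hr hr'].
have [_ [s s0 ->]] := hg r hr; have [_ [s' s'0 ->]] := hg r' hr'.
have [_ hn] := normalP hr.2; have [_ hn'] := normalP hr'.2.
have Cr : C r by have := hr.1.1; rewrite (bdE hC) => -[].
have Cr' : C r' by have := hr'.1.1; rewrite (bdE hC) => -[].
set n := normal C r in hn *; set n' := normal C r' in hn' *.
apply: enorm_le_enorm.
have h1 := mulr_ge0_le0 s0 (hn r' Cr'); have h2 := mulr_ge0_le0 s'0 (hn' r Cr).
have h3 := dot_ge0 (s *: n - s' *: n').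
have -> : r + s *: n - (r' + s' *: n') = (r - r') + (s *: n - s' *: n').
  by rewrite opprD addrACA.
have D (a b : 'rV[R]_3) : dot (a + b) (a + b) = dot a a + 2 * dot a b + dot b b.
  by rewrite !dot_linE (dotC b a); ring.
rewrite [leRHS]D.
(* Only the cross term needs a sign: it combines the supporting inequalities at [r] and [r'], with
   weights [s] and [s']. *)
suff X0 : 0 <= dot (r - r') (s *: n - s' *: n').
  by rewrite -addrA lerDl addr_ge0// mulr_ge0.
have E : dot (r - r') n = - dot (r' - r) n by rewrite -dotNl opprB.
by rewrite dotBr !dotZr E mulrN; lra.
Qed.

Lemma area_cap_le : (area (cap C r0 e t `&` regular_bd C) <=
  (c * ((L + 2 * eta) * (l1 * omega * t) + ((L + 2 * eta) * (l2 * omega * t) +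
    (t / l1 * (2 * (end_const e1 e2 l1 l2 * t)) +
    (t / l1 * (2 * (end_const e1 e2 l1 l2 * t)) +
    ((L + 2 * eta) * (omega * t) -
        (L - 2 * eta) * (omega * t * (1 - (l1 + l2) * eta))))))))%:E)%E.
Proof.
apply: le_trans area_cap_le_pieces _.
have areaU (A B : set 'rV[R]_3) (a b : R) : (area A <= (c * a)%:E)%E ->
    (area B <= (c * b)%:E)%E -> (area (A `|` B) <= (c * (a + b))%:E)%E.
  move=> hA hB; apply: le_trans (outer_measureU2 (@area R) A B) _.
  by rewrite mulrDr EFinD leeD.
apply: (areaU); first exact: (area_face_le H (ltW eta0) (ltW t0)).
apply: (areaU).
  rewrite /omega -wedge_widthC; apply: (area_face_le (edge_data_sym H) (ltW eta0) (ltW t0)).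
  by move=> x [[]].
apply: (areaU); first exact: (@area_end_le _ _ _ _ _ _ _ _ _ _ _ H eta t (P - eta) _ (ltW t0)).
apply: (areaU); first exact: (@area_end_le _ _ _ _ _ _ _ _ _ _ _ H eta t (Q + eta) _ (ltW t0)).
exact: area_base_core_le.
Qed.

End CapUpperBound.

(** * Boundary points touched by an inner ball *)

Section InnerBalls.
Variables (R : realType) (C : set 'rV[R]_3).
Hypothesis hC : convex_body C.
Implicit Types (c r n x y z u : 'rV[R]_3) (rho s : R).

(** If [x] in [C] lay beyond the tangent plane of the ball at [r], prolonging the segment from [x]
    through [r] would enter the open ball, and [r] would be interior to [C]. *)
Lemma touching_normal c n rho : 0 < rho -> enorm n = 1 ->
  (forall y, enorm (y - c) <= rho -> C y) -> bd C (c + rho *: n) ->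
  outward_unit_normal C (c + rho *: n) n.
Proof.
move=> rho0 n1 ball_C; rewrite (bdE hC) => -[Cr nCr]; split => // x Cx.
rewrite leNgt; apply/negP => xn; apply: nCr.
set r := c + rho *: n in Cr xn *.
have [e0 sm] : 0 < 2 * rho * dot (x - r) n / (dot (x - r) (x - r) + 1) /\
    0 <= dot (x - r) (x - r) by rewrite divr_gt0 ?mulr_gt0 ?ltr_wpDl ?dot_ge0.
(* The point [r - ep *: (x - r)] is in the open ball as soon as
   [ep * |x - r|^2 < 2 * rho * dot (x - r) n]; the [+ 1] in the denominator makes this strict. *)
set ep := _ / _ in e0.
have epE : ep * (dot (x - r) (x - r) + 1) = 2 * rho * dot (x - r) n.
  by rewrite /ep divfK// gt_eqF// ltr_wpDl.
clearbody ep; pose y := r - ep *: (x - r).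
have yint : C^° y.
  have yc : enorm (y - c) < rho.
    rewrite -(ger0_norm (ltW rho0)) -sqrtr_sqr ltr_sqrt ?exprn_gt0//.
    have -> : y - c = rho *: n - ep *: (x - r).
      by rewrite /y /r addrAC (addrC c) addrK.
    move: (x - r) sm epE => v sm epE.
    rewrite [X in X < _](_ : _ = rho ^+ 2 - ep * (2 * rho * dot v n - ep * dot v v)).
      by rewrite -epE gtrBl mulr_gt0// mulrDr mulr1 addrC addKr.
    by rewrite !dot_linE enorm1_dot// (dotC n v); ring.
  apply/interior_enormP; exists (rho - enorm (y - c)); first by rewrite subr_gt0.
  move=> w wy; apply: ball_C; apply: le_trans (enorm_triangle w y c) _; lra.
have ep1 : 0 < 1 + ep by lra.
have -> : r = (1 - ep / (1 + ep)) *: y + (ep / (1 + ep)) *: x.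
  by rewrite /y; apply/rowP => i; rewrite !mxE; field; rewrite gt_eqF.
apply: (interior_conv hC) => //; first by rewrite divr_ge0 ?ltW.
by rewrite ltr_pdivrMr//; lra.
Qed.

(** A normal [m] at the touching point also bounds the ball, in particular its point [c + rho *: m];
    this gives [1 <= dot n m], hence [m = n]. *)
Lemma touching_regular c n rho : 0 < rho -> enorm n = 1 ->
  (forall y, enorm (y - c) <= rho -> C y) -> bd C (c + rho *: n) ->
  regular_bd C (c + rho *: n) /\ normal C (c + rho *: n) = n.
Proof.
move=> rho0 n1 ball_C br; have hn := touching_normal rho0 n1 ball_C br.
have uniq m : outward_unit_normal C (c + rho *: n) m -> m = n.
  move=> [m1 hm]; have := hm (c + rho *: m).
  have Cm : C (c + rho *: m).
    by apply: ball_C; rewrite addrC addKr enormZ m1 mulr1 gtr0_norm.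
  move=> /(_ Cm); rewrite opprD addrACA subrr add0r -scalerBr dotZl pmulr_rle0//.
  rewrite dotBl enorm1_dot// subr_le0 => nm.
  apply/eqP; rewrite -subr_eq0; apply/eqP/dot_eq0/eqP.
  rewrite eq_le dot_ge0 andbT !dot_linE !enorm1_dot// (dotC m n); lra.
have rr : regular_bd C (c + rho *: n).
  split => //; exists [set x | dot (x - (c + rho *: n)) n = 0]; split.
    by exists n.
  by move=> _ [m /uniq -> ->].
by split => //; exact: uniq (normalP rr).
Qed.

(* Each supporting half-space contains the other ball, which makes the normals
   monotone in the centers: [dot (c - c') (n - n') >= 0]. *)
Lemma touching_expanding c c' n n' rho : 0 < rho -> enorm n = 1 -> enorm n' = 1 ->
  (forall y, enorm (y - c) <= rho -> C y) -> bd C (c + rho *: n) ->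
  (forall y, enorm (y - c') <= rho -> C y) -> bd C (c' + rho *: n') ->
  dot (c - c') (c - c') <=
  dot (c + rho *: n - (c' + rho *: n')) (c + rho *: n - (c' + rho *: n')).
Proof.
move=> rho0 n1 n1' hc br hc' br'.
have in_half (b m b' : 'rV[R]_3) : enorm m = 1 ->
    (forall y, enorm (y - b) <= rho -> C y) -> bd C (b + rho *: m) ->
    (forall y, enorm (y - b') <= rho -> C y) -> dot (b' - b) m <= 0.
  move=> m1 hb bb hb'; have [_ h] := touching_normal rho0 m1 hb bb.
  have := h (b' + rho *: m); rewrite opprD addrACA subrr addr0; apply.
  by apply: hb'; rewrite addrC addKr enormZ m1 mulr1 gtr0_norm.
have h := in_half _ _ _ n1 hc br hc'; have h' := in_half _ _ _ n1' hc' br' hc.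
have -> : c + rho *: n - (c' + rho *: n') = (c - c') + rho *: (n - n').
  by rewrite opprD addrACA scalerBr.
have D (a b : 'rV[R]_3) : dot (a + b) (a + b) = dot a a + 2 * dot a b + dot b b.
  by rewrite !dot_linE (dotC b a); ring.
rewrite [leRHS]D -addrA lerDl addr_ge0 ?dot_ge0// mulr_ge0// dotZr mulr_ge0 ?(ltW rho0)//.
have E : dot (c - c') n = - dot (c' - c) n by rewrite -dotNl opprB.
by rewrite dotBr E; lra.
Qed.

Lemma inner_ball_touch u z rho s1 : 0 < rho -> 0 <= s1 -> enorm u = 1 ->
  (forall y, enorm (y - (z - s1 *: u)) <= rho -> C y) -> ~ C (z + rho *: u) ->
  exists s n, [/\ 0 <= s <= s1, enorm n = 1,
    forall y, enorm (y - (z - s *: u)) <= rho -> C y &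
    bd C (z - s *: u + rho *: n)].
Proof.
move=> rho0 s10 u1 hs1 zu.
pose S := [set s | 0 <= s <= s1 /\ forall y, enorm (y - (z - s *: u)) <= rho -> C y].
have Ss1 : S s1 by split => //; rewrite s10/=.
have lbS : lbound S 0 by move=> s [/andP[]].
have infS : has_inf S by split; [exists s1|exists 0].
pose s := inf S.
have s0 : 0 <= s by apply: lb_le_inf => //; exists s1.
have ss1 : s <= s1 := ge_inf infS.2 Ss1.
have hs y : enorm (y - (z - s *: u)) <= rho -> C y.
  move=> ys; apply: contrapT => nCy.
  have /nbhs_enormP[e e0 he] : nbhs y (~` C).
    apply: open_nbhs_nbhs; split => //; apply: closed_openC; exact: (convex_body_closed hC).
  have [s' Ss' s's] := inf_adherent e0 infS; have [_ hs'] := Ss'.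
  have ss' : s <= s' := ge_inf infS.2 Ss'.
  apply: (he (y - (s' - s) *: u)).
    by rewrite addrAC subrr add0r enormN enormZ u1 mulr1 ger0_norm; rewrite -/s in s's; lra.
  apply: hs'; apply: le_trans ys; rewrite le_eqVlt; apply/orP; left; apply/eqP.
  by congr enorm; rewrite scalerBl; apply/rowP => i; rewrite !mxE; ring.
have s_gt0 : 0 < s.
  rewrite lt_def s0 andbT; apply/eqP => sE; apply/zu/hs.
  by rewrite sE scale0r subr0 addrC addKr enormZ u1 mulr1 gtr0_norm.
(* Were the closed ball inside the interior of [C], compactness would allow a further shift by some
   [a > 0], against the minimality of [s]. *)
have [r [rc nr]] : exists r, enorm (r - (z - s *: u)) <= rho /\ ~ C^° r.
  apply: contrapT => /forallNP h.
  have int_r r : enorm (r - (z - s *: u)) <= rho -> C^° r.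
    by move=> hr; apply: contrapT => nr; apply: (h r).
  have : \forall e \near (0 : R)^'+, [set y | enorm (y - (z - s *: u)) <= rho] `<=`
      [set y | C (y + e *: u)].
    apply: ((compact_near_coveringP _).1 (compact_enorm_ball (x:=z - s *: u) (a:=rho)) _
      (0 : R)^'+ (fun e y => C (y + e *: u))) => y /int_r/interior_enormP[e e0 he].
    exists ([set y' | enorm (y' - y) < e / 2], [set a | 0 < a < e / 2]).
      split => /=; first by apply/nbhs_enormP; exists (e / 2) => //; rewrite divr_gt0.
      near=> a; apply/andP; split; near: a; first exact: nbhs_right_gt.
      by apply: nbhs_right_lt; rewrite divr_gt0.
    move=> [y' a] /= [hy' /andP[a0 ha]]; apply: he.
    rewrite addrAC (le_lt_trans (enormD _ _))// enormZ u1 mulr1 gtr0_norm//; lra.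
  move=> near_e.
  have [a [a0 [as_ ha]]] := filter_ex (filterI (nbhs_right_gt (0 : R))
    (filterI (nbhs_right_lt s_gt0) near_e)).
  have : S (s - a).
    split; first by apply/andP; split; rewrite /= in a0 as_; lra.
    move=> y hy; have -> : y = (y - a *: u) + a *: u by rewrite subrK.
    apply: ha => /=; apply: le_trans hy; rewrite le_eqVlt; apply/orP; left; apply/eqP.
    by congr enorm; apply/rowP => i; rewrite !mxE; ring.
  by move=> /(ge_inf infS.2); rewrite -/s /= in a0 *; lra.
have rho_le : rho <= enorm (r - (z - s *: u)).
  rewrite leNgt; apply/negP => hr; apply/nr/interior_enormP.
  exists (rho - enorm (r - (z - s *: u))); first by rewrite subr_gt0.
  by move=> w wr; apply: hs; apply: le_trans (enorm_triangle w r _) _; lra.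
exists s, (rho^-1 *: (r - (z - s *: u))).
have rE : enorm (r - (z - s *: u)) = rho by apply/eqP; rewrite eq_le rc.
split => //; first by rewrite s0.
  by rewrite enormZ rE gtr0_norm ?invr_gt0// mulVf// gt_eqF.
rewrite scalerA mulfV ?gt_eqF// scale1r addrC subrK (bdE hC); split => //.
exact: hs.
Unshelve. all: by end_near. Qed.

End InnerBalls.

(** * Asymptotics of slices and caps *)

Section Asymptotics.
Variables (R : realType) (C : set 'rV[R]_3) (r0 e1 e2 e d : 'rV[R]_3) (l1 l2 P Q : R).
Hypothesis H : edge_data C r0 e1 e2 e d l1 l2 P Q.

Let omega := wedge_width e1 e2 l1 l2.
Let omega0 : 0 < omega := wedge_width_gt0 H.
Let c := area_unit R.
Let c0 : 0 < c := area_unit_gt0 R.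
Let L := Q - P.
Let L0 : 0 < L. Proof. by rewrite subr_gt0 (edge_PQ H). Qed.
Let l10 := edge_l1 H.
Let l20 := edge_l2 H.

Lemma cap_asymptotics (eps : R) : 0 < eps -> \forall t \near 0^'+,
  [/\ ((c * ((L * omega - eps) * t))%:E <= area (slice C r0 e t))%E,
      (area (slice C r0 e t) <= (c * ((L * omega + eps) * t))%:E)%E &
      (area (cap C r0 e t `&` regular_bd C) <=
       (c * ((L * omega * (l1 + l2) + eps) * t))%:E)%E].
Proof.
move=> eps0; pose b := l1 + l2; have b0 : 0 < b by rewrite addr_gt0.
(* [eta * M] bounds the errors due to the margin [eta], and [q * t] below those due to the two ends;
   each gets half of [eps]. The margin is fixed first, and the thresholds on [t] depend on it. *)
have [M ME0] : exists M, M = omega * (2 * b + 4 + L * b) by eexists.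
have Lb : 0 < L * b by rewrite mulr_gt0.
have M0 : 0 < M by rewrite ME0 mulr_gt0//; lra.
have [eta [eta0 [eta1 [etal1 [etal2 [etaL [etab etaM]]]]]]] : exists eta, 0 < eta /\
    (eta < 1 /\ (eta < l1 /\ (eta < l2 /\ (eta < L / 2 /\ (eta < b^-1 /\ eta < eps / (2 * M)))))).
  apply: (@filter_ex _ (0 : R)^'+); repeat apply: filterI;
    try exact: nbhs_right_gt; apply: nbhs_right_lt => //.
  - by rewrite divr_gt0.
  - by rewrite invr_gt0.
  - by rewrite divr_gt0// mulr_gt0.
have [h h0 hout] := edge_outer H eta0.
have [t0 t00 hinn] := edge_inner H eta0 eta1.
pose K := end_const e1 e2 l1 l2.
have K0 : 0 < K.
  rewrite mulr_gt0 ?invr_gt0 ?(wedge_sin_gt0 H)// addr_gt0 ?invr_gt0//.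
have [q qE] : exists q, q = 4 * K / l1 by eexists.
have q0 : 0 < q by rewrite qE; apply: divr_gt0 => //; apply: mulr_gt0 => //; exact: K0.
near=> t.
have t_gt0 : 0 < t by near: t; exact: nbhs_right_gt.
have tt0 : t < t0 by near: t; exact: nbhs_right_lt.
have th : t < h by near: t; exact: nbhs_right_lt.
have tK : t < eps / (2 * q).
  by near: t; apply: nbhs_right_lt; rewrite divr_gt0// mulr_gt0.
have etaPQ : 2 * eta <= Q - P by rewrite -/L; lra.
have etabb : (l1 + l2) * eta <= 1.
  by rewrite -/b mulrC -ler_pdivlMr// div1r ltW.
have outer x : C x -> - dot (x - r0) e <= t -> P - eta <= dot (x - r0) d <= Q + eta.
  by move=> Cx xt; apply: hout => //; lra.
have inner : core r0 e1 e2 d P Q eta t `<=` C.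
  move=> x [/andP[? ?] /andP[? ?] /andP[? ?]].
  by apply: (hinn t) => //; apply/andP; split; exact: ltW.
have etaM2 : eta * M <= eps / 2.
  have hM := ltW etaM; rewrite ler_pdivlMr ?mulr_gt0// in hM; lra.
have tK2 : q * t <= eps / 2.
  have hK := ltW tK; rewrite ler_pdivlMr ?mulr_gt0// in hK; lra.
have ew : 0 < eta * omega by rewrite mulr_gt0.
have ewb : 0 < eta * omega * b by rewrite mulr_gt0.
have ewLb : 0 < eta * omega * (L * b) by rewrite mulr_gt0.
have eewb : 0 < eta * (eta * omega * b) by rewrite mulr_gt0.
have ME : eta * M = 2 * (eta * omega * b) + 4 * (eta * omega) + eta * omega * (L * b).
  by rewrite ME0; ring.
split.
- apply: le_trans (area_slice_ge H eta0 t_gt0 etal1 etal2 etaPQ etabb inner).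
  rewrite lee_fin ler_pM2l// -/L -/omega -/b.
  have -> : (L - 2 * eta) * (omega * t * (1 - b * eta)) =
     (L * omega - eta * omega * (L * b) - 2 * (eta * omega) + 2 * (eta * (eta * omega * b))) * t by ring.
  by rewrite ler_pM2r//; lra.
- apply: le_trans (area_slice_le H eta0 t_gt0 outer) _.
  rewrite lee_fin ler_pM2l// -/L -/omega mulrA ler_pM2r// mulrDl -mulrA; lra.
- apply: le_trans (area_cap_le H eta0 t_gt0 etal1 etal2 etaPQ etabb outer inner) _.
  rewrite lee_fin ler_pM2l// -/L -/omega -/b -/K.
  set lhs := (X in X <= _).
  have -> : lhs = (L * omega * b + 2 * (eta * omega * b) + q * t +
     4 * (eta * omega) + eta * omega * (L * b) - 2 * (eta * (eta * omega * b))) * t.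
    by rewrite /lhs /b qE; field; rewrite gt_eqF.
  by rewrite ler_pM2r//; lra.
Unshelve. all: by end_near. Qed.

End Asymptotics.

(** * Area of the boundary points with normal near [e1] *)

Section FaceNormals.
Variables (R : realType) (C : set 'rV[R]_3) (r0 e1 e2 e d : 'rV[R]_3) (l1 l2 P Q : R).
Hypothesis H : edge_data C r0 e1 e2 e d l1 l2 P Q.

Let l10 := edge_l1 H.
Let l20 := edge_l2 H.
Let hC := edge_body H.
Let k := dot e1 e2.
Let e11 : dot e1 e1 = 1 := enorm1_dot (edge_e1 H).
Let ed1 : dot e1 d = 0. Proof. by rewrite dotC (edge_de1 H). Qed.
Let u := face_dir e1 e2.
Let u_unit : enorm u = 1.
Proof. by apply: dot1_enorm; case: (face_frame H). Qed.
Let d_unit : enorm d = 1.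
Proof. by apply: dot1_enorm; exact: edge_d H. Qed.

Section Scale.
Variables (delta theta kappa t m : R).
Hypothesis kappaE : kappa = delta * theta.
Hypotheses (delta0 : 0 < delta) (delta1 : delta <= 1) (delta2 : delta <= l2).
Hypotheses (theta0 : 0 < theta) (theta1 : theta <= 20^-1).
Hypotheses (t0 : 0 < t) (t1 : t <= 1).
Hypotheses (m5 : 5 <= m) (ml : 3 * (l1 + l2) <= m * l2).
Hypothesis inner : forall x, P + kappa <= dot (x - r0) d <= Q - kappa ->
  kappa * t <= - dot (x - r0) e1 <= t / kappa ->
  kappa * t <= - dot (x - r0) e2 <= t / kappa -> C x.

(** The part of the face of [e1] at a margin of order [delta] from its ends and [m * delta * t] from
    its sides. The factor [m] is large enough for the balls to stay over the face and for the
    touching points to stay in the cap. *)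
Definition face_core : set 'rV[R]_3 := [set z |
  [/\ dot (z - r0) e1 = 0, P + 2 * delta < dot (z - r0) d < Q - 2 * delta &
      m * delta * t < - dot (z - r0) e2 < t / l2 - m * delta * t]].

Let kappa0 : 0 < kappa. Proof. by rewrite kappaE mulr_gt0. Qed.
Let kd : 20 * kappa <= delta.
Proof.
rewrite kappaE mulrC -mulrA -[leRHS]mulr1 ler_pM2l//.
by rewrite -ler_pdivlMr// div1r.
Qed.
Let kt0 : 0 < kappa * t. Proof. exact: mulr_gt0. Qed.
Let dt0 : 0 < delta * t. Proof. exact: mulr_gt0. Qed.
Let ktdt : 20 * (kappa * t) <= delta * t.
Proof. by rewrite mulrA ler_pM2r. Qed.
Let mdt : 5 * (delta * t) <= m * delta * t.
Proof. by rewrite -(mulrA m) ler_pM2r. Qed.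
Let ktk : kappa * t <= kappa. Proof. by rewrite ger_pMr. Qed.
Let dtd : delta * t <= delta. Proof. by rewrite ger_pMr. Qed.

Local Ltac scale_facts :=
  have := kappa0; have := kd; have := kt0; have := dt0; have := ktdt;
  have := mdt; have := ktk; have := dtd; have := l10; have := l20;
  have := delta0; have := delta1; have := delta2; have := theta0;
  have := theta1; have := t0; have := t1; have := m5; have := ml;
  do 19 move=> ?.

Let face_inC (z y : 'rV[R]_3) : face_core z ->
  kappa * t <= - dot (y - r0) e1 -> - dot (y - r0) e1 <= delta * t ->
  `|dot (y - z) e2| <= 2 * (delta * t) -> `|dot (y - z) d| <= delta -> C y.
Proof.
scale_facts.
move=> [z1 /andP[zP zQ] /andP[zl zu]] y1 y1' y2 yd.
have yE w : dot (y - r0) w = dot (z - r0) w + dot (y - z) w.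
  by rewrite -dotDl [z - r0 + _]addrC addrA subrK.
rewrite ler_norml in y2; rewrite ler_norml in yd.
case/andP: y2 => y2 y2'; case/andP: yd => yd yd'.
apply: inner.
- by rewrite yE; apply/andP; split; lra.
- rewrite y1/= (le_trans y1')// ler_pdivlMr// mulrAC ger_pMl//.
  by have : delta * kappa <= 1 * 1 by [apply: ler_pM; lra]; lra.
- rewrite yE; apply/andP; split; first lra.
  have h : t / l2 <= t / kappa by rewrite ler_pM2l// lef_pV2 ?posrE//; lra.
  by apply: le_trans h; lra.
Qed.

Let k1 : `|k| <= 1.
Proof. by have := dot_unit_le e1 (edge_e2 H); rewrite (edge_e1 H). Qed.

Let kk (a : R) : 0 <= a -> `|a * k| <= a.
Proof. by move=> a0; rewrite normrM ger0_norm// ler_piMr. Qed.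

(** With its center at depth [2 * (kappa * t)] below the face, the ball has all its points at depth
    at least [kappa * t], inside [C] by [face_inC]; centered at [z] it would cross the face. *)
Lemma face_core_touch z : face_core z -> exists s n,
  [/\ 0 <= s <= 2 * (kappa * t), enorm n = 1,
    forall y, enorm (y - (z - s *: e1)) <= kappa * t -> C y &
    bd C (z - s *: e1 + (kappa * t) *: n)].
Proof.
scale_facts.
move=> fz; apply: (inner_ball_touch hC) => //; first 3 last.
- move=> /(edge_wedge H)[]; case: fz => z1 _ _.
  by rewrite addrAC dotDl z1 dotZl e11; lra.
- by rewrite mulr_ge0// ltW.
- exact: edge_e1 H.
move=> y hy; pose v := y - (z - (2 * (kappa * t)) *: e1).
have vE w : enorm w = 1 -> - (kappa * t) <= dot v w <= kappa * t.
  by move=> w1; rewrite -ler_norml (le_trans (dot_unit_le _ w1)).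
have yE w : dot (y - z) w = dot v w - 2 * (kappa * t) * dot e1 w.
  by rewrite /v !dot_linE; ring.
have yr w : dot (y - r0) w = dot (z - r0) w + dot (y - z) w.
  by rewrite -dotDl [z - r0 + _]addrC addrA subrK.
have /andP[v1 v1'] := vE _ (edge_e1 H).
have /andP[v2 v2'] := vE _ (edge_e2 H).
have /andP[vd vd'] := vE _ d_unit.
have := kk (ltW kt0); rewrite ler_norml => /andP[ka kb].
have z1 : dot (z - r0) e1 = 0 by case: fz.
apply: (face_inC fz).
- by rewrite yr z1 yE e11; lra.
- by rewrite yr z1 yE e11; lra.
- by rewrite yE -/k ler_norml; apply/andP; split; lra.
- by rewrite yE ed1 ler_norml; apply/andP; split; lra.
Qed.

(** The touching point is within [3 * (kappa * t)] of [z], which costs at most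
    [3 * (l1 + l2) * (kappa * t)] in depth; the hypothesis [ml] on [m] covers this. *)
Lemma face_core_cap z s (n : 'rV[R]_3) : face_core z -> 0 <= s <= 2 * (kappa * t) ->
  enorm n = 1 -> - t <= dot (z - s *: e1 + (kappa * t) *: n - r0) e.
Proof.
scale_facts.
move=> [z1 _ /andP[zl zu]] /andP[s0 s1] n1; rewrite (dot_edge_e H).
have E w : dot (z - s *: e1 + (kappa * t) *: n - r0) w =
    dot (z - r0) w - s * dot e1 w + kappa * t * dot n w by rewrite !dot_linE; ring.
rewrite !E z1 e11 -/k.
have b1 : `|kappa * t * dot n e1| <= kappa * t.
  by rewrite normrM gtr0_norm// ger_pMr// -n1 dot_unit_le// (edge_e1 H).
have b2 : `|kappa * t * dot n e2| <= kappa * t.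
  by rewrite normrM gtr0_norm// ger_pMr// -n1 dot_unit_le// (edge_e2 H).
have b3 := kk s0.
rewrite !ler_norml in b1 b2 b3.
case/andP: b1 => b1 _; case/andP: b2 => b2 _; case/andP: b3 => _ b3.
have f1 : - (3 * (kappa * t)) <= 0 - s * 1 + kappa * t * dot n e1 by lra.
have f2 : - (t / l2 - m * delta * t + 3 * (kappa * t)) <=
    dot (z - r0) e2 - s * k + kappa * t * dot n e2 by lra.
have g1 : l1 * - (3 * (kappa * t)) <= l1 * (0 - s * 1 + kappa * t * dot n e1).
  by rewrite ler_pM2l.
have g2 : l2 * - (t / l2 - m * delta * t + 3 * (kappa * t)) <=
    l2 * (dot (z - r0) e2 - s * k + kappa * t * dot n e2) by rewrite ler_pM2l.
have g3 : 3 * (l1 + l2) * (kappa * t) <= m * l2 * (delta * t).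
  by apply: ler_pM => //; lra || (rewrite mulr_ge0//; lra).
have E2 : l2 * - (t / l2 - m * delta * t + 3 * (kappa * t)) =
    - t + m * l2 * (delta * t) - 3 * l2 * (kappa * t).
  by field; rewrite gt_eqF.
lra.
Qed.

(** Steps of length [delta * t] from [z] along the face, pushed inwards by [2 * (kappa * t)], stay
    in [C]. The supporting inequality at the touching point, within [3 * (kappa * t)] of [z], bounds
    the tangential components of [n] by [5 * kappa / delta = 5 * theta]. A step straight inwards
    excludes [n] close to [- e1]. *)
Lemma face_core_normal z s (n : 'rV[R]_3) : face_core z ->
  0 <= s <= 2 * (kappa * t) ->
  outward_unit_normal C (z - s *: e1 + (kappa * t) *: n) n ->
  enorm (n - e1) <= 10 * theta.
Proof.
scale_facts.
move=> fz /andP[s0 s1] [n1 hn].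
have z1 : dot (z - r0) e1 = 0 by case: fz.
have bnd v : C (z + v) -> dot v n <= 3 * (kappa * t).
  move=> /hn; have -> : z + v - (z - s *: e1 + (kappa * t) *: n) =
      v + (s *: e1 - (kappa * t) *: n).
    by apply/rowP => i; rewrite !mxE; ring.
  rewrite dotDl dotBl !dotZl enorm1_dot// mulr1 => h.
  have := kk s0; have : `|s * dot e1 n| <= s.
    by rewrite normrM ger0_norm// ler_piMr// -(edge_e1 H) dot_unit_le.
  rewrite ler_norml => /andP[? ?] _; lra.
have side (v : 'rV[R]_3) : enorm v = 1 -> dot v e1 = 0 ->
    `|dot v n| <= 5 * theta.
  move=> v1 ve1.
  have one (w : 'rV[R]_3) : enorm w = 1 -> dot w e1 = 0 -> dot w n <= 5 * theta.
    move=> w1 we1.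
    have Cw : C (z + ((delta * t) *: w - (2 * (kappa * t)) *: e1)).
      set v' := _ *: w - _.
      have v'E y : dot v' y = delta * t * dot w y - 2 * (kappa * t) * dot e1 y.
        by rewrite /v' !dot_linE.
      have v'r y : dot (z + v' - r0) y = dot (z - r0) y + dot v' y.
        by rewrite -dotDl; congr (dot _ y); rewrite addrAC.
      have v'z : z + v' - z = v' by rewrite addrAC subrr add0r.
      have := kk (ltW kt0); rewrite ler_norml => /andP[ka kb].
      apply: (face_inC fz).
      + by rewrite v'r z1 v'E we1 e11; lra.
      + by rewrite v'r z1 v'E we1 e11; lra.
      + rewrite v'z v'E -/k.
        have : `|delta * t * dot w e2| <= delta * t.
          by rewrite normrM gtr0_norm// ger_pMr// -w1 dot_unit_le// (edge_e2 H).
        by rewrite !ler_norml => /andP[? ?]; apply/andP; split; lra.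
      + rewrite v'z v'E ed1.
        have : `|delta * t * dot w d| <= delta * t.
          by rewrite normrM gtr0_norm// ger_pMr// -w1 dot_unit_le.
        by rewrite !ler_norml => /andP[? ?]; apply/andP; split; lra.
    have := bnd _ Cw; rewrite dotBl !dotZl => h.
    have h1 : `|kappa * t * dot e1 n| <= kappa * t.
      by rewrite normrM gtr0_norm// ger_pMr// -(edge_e1 H) dot_unit_le.
    rewrite ler_norml in h1; case/andP: h1 => _ h1.
    rewrite -(ler_pM2l dt0).
    have -> : delta * t * (5 * theta) = 5 * (kappa * t) by rewrite kappaE; ring.
    lra.
  rewrite ler_norml one// andbT lerNl -dotNl.
  by apply: one; rewrite ?enormN// dotNl ve1 oppr0.
have sgn : - (3 * theta) <= dot e1 n.
  have Cw : C (z + - (delta * t) *: e1).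
    apply: (face_inC fz).
    - by rewrite addrAC dotDl z1 dotZl e11; lra.
    - by rewrite addrAC dotDl z1 dotZl e11; lra.
    - rewrite addrAC subrr add0r dotZl -/k mulNr normrN.
      by apply: le_trans (kk (ltW dt0)) _; lra.
    - by rewrite addrAC subrr add0r dotZl ed1 mulr0 normr0 ltW.
  have := bnd _ Cw; rewrite dotZl => h; rewrite -(ler_pM2l dt0).
  have -> : delta * t * - (3 * theta) = - (3 * (kappa * t)) by rewrite kappaE; ring.
  lra.
have [_ _ _ _ [de1 ue1]] := face_frame H.
have hd := side d d_unit (edge_de1 H); have hu := side u u_unit ue1.
have one : 1 = dot n d * dot n d + dot n u * dot n u + dot n e1 * dot n e1.
  by rewrite -(enorm1_dot n1) (orthonormal_dotE _ _ (face_frame H)).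
rewrite -!expr2 in one.
have sq (a : R) : `|a| <= 5 * theta -> a ^+ 2 <= 25 * theta ^+ 2.
  move=> ha; rewrite -real_normK ?num_real//.
  have -> : 25 * theta ^+ 2 = (5 * theta) ^+ 2 by ring.
  by rewrite ler_pXn2r ?nnegrE// mulr_ge0// ltW.
have := sq _ hd; have := sq _ hu; rewrite (dotC d) (dotC u) => qu qd.
have tt : theta ^+ 2 <= 400^-1.
  have -> : 400^-1 = (20^-1) ^+ 2 :> R by field.
  by rewrite ler_pXn2r ?nnegrE ?invr_ge0// ltW.
rewrite (dotC e1) in sgn.
have ne1 : dot n e1 <= 1.
  by have := dot_unit_le n (edge_e1 H); rewrite n1 ler_norml => /andP[].
have pos : 0 <= dot n e1.
  rewrite leNgt; apply/negP => neg.
  have : dot n e1 ^+ 2 <= (3 * theta) ^+ 2.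
    have -> : dot n e1 ^+ 2 = (- dot n e1) ^+ 2 by rewrite sqrrN.
    have [p1 p2] : 0 <= - dot n e1 /\ 0 <= 3 * theta by split; lra.
    rewrite ler_pXn2r ?nnegrE//; lra.
  by rewrite exprMn; lra.
(* Both tangential components being at most [5 * theta], [dot n e1 >= dot n e1 ^+ 2 >= 1 - 50 *
   theta ^+ 2], and [|n - e1|^2 = 2 - 2 * dot n e1] is at most [(10 * theta) ^+ 2]. *)
have : dot n e1 ^+ 2 <= dot n e1 by rewrite expr2 ler_piMr.
move=> sqn; apply: enorm_le; first lra.
rewrite !dot_linE enorm1_dot// e11 (dotC e1) exprMn; lra.
Qed.

Lemma area_face_core : 4 * delta <= Q - P -> 2 * m * delta <= l2^-1 ->
  ((area_unit R * ((Q - P - 4 * delta) *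
     ((t / l2 - 2 * (m * delta * t)) / wedge_sin e1 e2)))%:E <= area face_core)%E.
Proof.
move=> dPQ dl2; have sg0 := wedge_sin_gt0 H.
pose o := r0 + ((P + 2 * delta) *: d + (m * delta * t / wedge_sin e1 e2) *: u).
have [dd uu ee du [de ue]] := face_frame H.
have sh x y : dot (x - o) y = dot (x - r0) y - (P + 2 * delta) * dot d y -
    m * delta * t / wedge_sin e1 e2 * dot u y by rewrite /o !dot_linE; ring.
apply: (@area_ge_rect _ o _ _ _ _ _ _ (face_frame H)); first lra.
  rewrite divr_ge0 ?(ltW sg0)//.
  have : 2 * m * delta * t <= l2^-1 * t by rewrite ler_pM2r.
  by rewrite (mulrC _ t); lra.
move=> x; rewrite !sh dd uu du de ue (dotC u d) du !mulr0 !mulr1 !subr0.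
move=> x1 /andP[xd xd'] ; rewrite dot_face_dir x1 mulr0 sub0r mulrC -mulrBl.
rewrite pmulr_lgt0 ?invr_gt0// ltr_pM2r ?invr_gt0// => /andP[xu xu'].
by split => //; apply/andP; split; lra.
Qed.

(** Passing from points of the face to the centers of their balls adds a component along [e1],
    orthogonal to the face, and passing on to the touching points expands by
    [touching_expanding]. *)
Lemma area_face_normals eps : 10 * theta < eps ->
  (area face_core <= area (cap C r0 e t `&` regular_bd C `&`
     [set r | (enorm (normal C r - e1) < eps)%R]))%E.
Proof.
move=> teps.
have ex z : exists sn : R * 'rV[R]_3, face_core z ->
  [/\ 0 <= sn.1 <= 2 * (kappa * t), enorm sn.2 = 1,
    forall y, enorm (y - (z - sn.1 *: e1)) <= kappa * t -> C y &
    bd C (z - sn.1 *: e1 + (kappa * t) *: sn.2)].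
  have [fz|nfz] := pselect (face_core z); last by exists (0, 0).
  by have [s [n h]] := face_core_touch fz; exists (s, n).
have [sn hsn] := choice ex.
apply: (area_expanding (g := fun z => z - (sn z).1 *: e1 + (kappa * t) *: (sn z).2)).
  move=> z fz; have [hs hn hb hbd] := hsn z fz.
  have [hreg hnor] := touching_regular hC kt0 hn hb hbd.
  split => //=.
    by split => //; split => //=; exact: face_core_cap.
  rewrite hnor; apply: le_lt_trans teps; apply: (face_core_normal fz hs).
  exact: (touching_normal hC kt0 hn hb hbd).
move=> z z' fz fz'; have [hs hn hb hbd] := hsn z fz; have [hs' hn' hb' hbd'] := hsn z' fz'.
apply: enorm_le_enorm; apply: le_trans (touching_expanding hC kt0 hn hn' hb hbd hb' hbd').
have zz : dot (z - z') e1 = 0.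
  case: fz => z1 _ _; case: fz' => z1' _ _.
  by have -> : z - z' = (z - r0) - (z' - r0) by [rewrite opprB addrA subrK]; rewrite dotBl z1 z1' subrr.
have -> : z - (sn z).1 *: e1 - (z' - (sn z').1 *: e1) =
    (z - z') - ((sn z).1 - (sn z').1) *: e1.
  by apply/rowP => i; rewrite !mxE; ring.
move: (z - z') ((sn z).1 - (sn z').1) zz => v a zz.
rewrite [leRHS](_ : _ = dot v v + a ^+ 2) ?lerDl ?sqr_ge0//.
by rewrite !dot_linE (dotC e1 v) zz e11; ring.
Qed.

End Scale.

Lemma face_asymptotics (eps : R) : 0 < eps -> \forall t \near 0^'+,
  ((area_unit R * (((Q - P) * wedge_width e1 e2 l1 l2 * l1 - eps) * t))%:E <=
   area (cap C r0 e t `&` regular_bd C `&`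
     [set r | (enorm (normal C r - e1) < eps)%R]))%E.
Proof.
move=> eps0; pose L := Q - P; pose sg := wedge_sin e1 e2.
have L0 : 0 < L by rewrite subr_gt0 (edge_PQ H).
have sg0 : 0 < sg := wedge_sin_gt0 H.
have l1_gt0 := l10; have l2_gt0 := l20.
have [m mE] : exists m, m = 3 * (l1 + l2) / l2 + 5 by eexists.
have m5 : 5 <= m by rewrite mE lerDr divr_ge0//; lra.
have ml : 3 * (l1 + l2) <= m * l2.
  have -> : m * l2 = 3 * (l1 + l2) + 5 * l2 by rewrite mE; field; rewrite gt_eqF.
  by lra.
have [W WE] : exists W, W = (sg * l2)^-1 by eexists.
have W0 : 0 < W by rewrite WE invr_gt0 mulr_gt0.
(* [W * t] is the width of the face, and [M] the coefficient of [delta] in the area lost to the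
   margins; the term in [delta ^+ 2] is a gain. *)
have [M ME] : exists M, M = 4 * W + 2 * m * L / sg by eexists.
have M0 : 0 < M.
  by rewrite ME addr_gt0 ?mulr_gt0 ?invr_gt0//; lra.
have [delta [d0 [d1 [d2 [dL [dl2 dM]]]]]] : exists delta, 0 < delta /\
    (delta < 1 /\ (delta < l2 /\ (delta < L / 4 /\
    (delta < l2^-1 / (2 * m) /\ delta < eps / M)))).
  apply: (@filter_ex _ (0 : R)^'+); repeat apply: filterI;
    try exact: nbhs_right_gt; apply: nbhs_right_lt => //.
  - by rewrite divr_gt0.
  - by rewrite divr_gt0 ?invr_gt0//; lra.
  - by rewrite divr_gt0.
have [theta [th0 [th20 theps]]] : exists theta : R, 0 < theta /\
    (theta < 20^-1 /\ theta < eps / 10).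
  apply: (@filter_ex _ (0 : R)^'+); repeat apply: filterI;
    try exact: nbhs_right_gt; apply: nbhs_right_lt; rewrite ?divr_gt0 ?invr_gt0//.
have kappa0 : 0 < delta * theta by rewrite mulr_gt0.
have kappa1 : delta * theta < 1 by nra.
have [t0 t00 hinn] := edge_inner H kappa0 kappa1.
near=> t.
have t_gt0 : 0 < t by near: t; exact: nbhs_right_gt.
have tt0 : t < t0 by near: t; exact: nbhs_right_lt.
have t1 : t < 1 by near: t; exact: nbhs_right_lt.
have inner x : P + delta * theta <= dot (x - r0) d <= Q - delta * theta ->
    delta * theta * t <= - dot (x - r0) e1 <= t / (delta * theta) ->
    delta * theta * t <= - dot (x - r0) e2 <= t / (delta * theta) -> C x.
  exact: (hinn t).
have th10 : 10 * theta < eps by lra.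
apply: le_trans (area_face_normals erefl d0 (ltW d1) (ltW d2) th0 (ltW th20)
  t_gt0 (ltW t1) m5 ml inner th10).
have dl2' : 2 * m * delta <= l2^-1.
  by rewrite mulrC -ler_pdivlMr ?ltW//; lra.
have dL' : 4 * delta <= Q - P by rewrite -/L; lra.
apply: le_trans (area_face_core t_gt0 dL' dl2').
rewrite lee_fin ler_pM2l ?area_unit_gt0// -/L -/sg.
have -> : L * wedge_width e1 e2 l1 l2 * l1 = L * W.
  by rewrite WE /wedge_width -/sg; field; rewrite !gt_eqF.
have -> : (L - 4 * delta) * ((t / l2 - 2 * (m * delta * t)) / sg) =
    (L * W - delta * M + 8 * m * delta ^+ 2 / sg) * t.
  by rewrite ME WE; field; rewrite !gt_eqF.
rewrite ler_pM2r//.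
have dM' : delta * M <= eps by rewrite -ler_pdivlMr// ltW.
have : 0 <= 8 * m * delta ^+ 2 / sg.
  by apply: divr_ge0; [apply: mulr_ge0; [lra|exact: sqr_ge0]|exact: ltW].
lra.
Unshelve. all: by end_near. Qed.

End FaceNormals.

(** * The edge of the tangent wedge *)

Section CrossProduct.
Variable R : realType.
Implicit Types u v : 'rV[R]_3.

Definition cross_product u v : 'rV[R]_3 := \row_j
  (if j == 0 then u 0 1 * v 0 2%:R - u 0 2%:R * v 0 1 else
   if j == 1 then u 0 2%:R * v 0 0 - u 0 0 * v 0 2%:R else
   u 0 0 * v 0 1 - u 0 1 * v 0 0).

Lemma dot_cross_productl u v : dot (cross_product u v) u = 0.
Proof. by rewrite dotE !mxE/=; ring. Qed.

Lemma dot_cross_productr u v : dot (cross_product u v) v = 0.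
Proof. by rewrite dotE !mxE/=; ring. Qed.

Lemma dot_cross_product u v : dot (cross_product u v) (cross_product u v) =
  dot u u * dot v v - dot u v ^+ 2.
Proof. by rewrite !dotE !mxE/=; ring. Qed.

Lemma unit_independent u v : enorm u = 1 -> enorm v = 1 -> u <> v -> u <> - v ->
  dot u v ^+ 2 < 1.
Proof.
move=> u1 v1 uv uNv.
have sep w : enorm w = 1 -> u <> w -> dot u w < 1.
  move=> w1 uw; have : 0 < enorm (u - w) by apply: enorm_gt0 => /subr0_eq.
  rewrite -(@ltr_pXn2r _ 2) ?nnegrE ?enorm_ge0// expr0n/= sqr_enorm !dot_linE.
  by rewrite !enorm1_dot// (dotC w u); lra.
have h1 := sep _ v1 uv; have h2 := sep (- v); rewrite enormN dotNr in h2.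
have {}h2 := h2 v1 uNv.
by rewrite -subr_gt0 -[1 in X in _ < X](expr1n _ 2) subr_sqr mulr_gt0//; lra.
Qed.

End CrossProduct.

Lemma segmentC (R : realType) (p q : 'rV[R]_3) : segment p q = segment q p.
Proof.
have sub (a b : 'rV[R]_3) : segment a b `<=` segment b a.
  move=> _ [s /= /andP[s0 s1] <-]; exists (1 - s) => /=.
    by apply/andP; split; lra.
  by rewrite subKr addrC.
by apply/seteqP; split; exact: sub.
Qed.

(** At depth zero the two nonpositive numbers [dot (x - r0) ei] have a vanishing positive
    combination, so both vanish and the slice lies on the line through [r0] along [d]. The abscissas
    of its endpoints, in increasing order, are [P] and [Q]; as [r0] is in the slice, they enclose
    [0]. *)
Lemma edge_data_exists (R : realType) (C : set 'rV[R]_3) (r0 e1 e2 e : 'rV[R]_3)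
    (l1 l2 : R) : convex_body C -> bd C r0 -> enorm e1 = 1 -> enorm e2 = 1 ->
  e1 <> e2 -> e1 <> - e2 ->
  tangent_cone C r0 = [set r | dot (r - r0) e1 <= 0 /\ dot (r - r0) e2 <= 0] ->
  0 < l1 -> 0 < l2 -> e = l1 *: e1 + l2 *: e2 -> enorm e = 1 ->
  (exists p q : 'rV[R]_3, p <> q /\ slice C r0 e 0 = segment p q) ->
  exists d P Q, edge_data C r0 e1 e2 e d l1 l2 P Q.
Proof.
move=> hC hr0 e11 e21 ne neN hcone l10 l20 eE e_unit [p [q [pq hpq]]].
have indep := unit_independent e11 e21 ne neN.
have wedge := tangent_wedge hcone.
have Cr0 : C r0 by move: hr0; rewrite (bdE hC) => -[].
pose s := Num.sqrt (1 - dot e1 e2 ^+ 2).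
have s_gt0 : 0 < s by rewrite sqrtr_gt0 subr_gt0.
pose d := s^-1 *: cross_product e1 e2.
have d1 : dot d e1 = 0 by rewrite dotZl dot_cross_productl mulr0.
have d2 : dot d e2 = 0 by rewrite dotZl dot_cross_productr mulr0.
have dd : dot d d = 1.
  rewrite dotZl dotZr dot_cross_product !enorm1_dot// mul1r mulrA -expr2 exprVn.
  by rewrite sqr_sqrtr ?subr_ge0 ?mulVf ?gt_eqF ?subr_gt0// ltW.
clearbody d.
have [u [hu u1 u2]] : exists u : 'rV[R]_3,
    [/\ orthonormal d u e1, dot e2 u = - s & forall x, dot x e1 = 0 ->
      dot x u = - s^-1 * dot x e2].
  have sn0 : s != 0 by rewrite gt_eqF.
  have s2 : s ^+ 2 = 1 - dot e1 e2 ^+ 2 by rewrite sqr_sqrtr// subr_ge0 ltW.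
  exists (s^-1 *: (dot e1 e2 *: e1 - e2)); split.
  - split; [exact: dd| |exact: enorm1_dot| |].
    + rewrite !dot_linE !enorm1_dot// (dotC e2 e1).
      by apply: (mulfI (expf_neq0 2 sn0)); rewrite [RHS]mulr1 [RHS]s2; field.
    + by rewrite !dot_linE d1 d2; ring.
    + by split => //; rewrite !dot_linE enorm1_dot// (dotC e2 e1); ring.
  - rewrite !dot_linE (dotC e2 e1) enorm1_dot//.
    apply: (mulfI sn0); rewrite (_ : s * - s = - s ^+ 2); last by ring.
    by rewrite s2; field.
  - by move=> x x1; rewrite !dot_linE x1; ring.
have on_edge x : C x -> dot (x - r0) e = 0 -> x = r0 + dot (x - r0) d *: d.
  move=> /wedge[x1 x2]; rewrite eE !dotDr !dotZr => h.
  have m1 := mulr_ge0_le0 (ltW l10) x1; have m2 := mulr_ge0_le0 (ltW l20) x2.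
  have z1 : dot (x - r0) e1 = 0 by apply: (mulfI (lt0r_neq0 l10)); rewrite mulr0; lra.
  have z2 : dot (x - r0) e2 = 0 by apply: (mulfI (lt0r_neq0 l20)); rewrite mulr0; lra.
  suff -> : dot (x - r0) d *: d = x - r0 by rewrite addrC subrK.
  case: (hu) => _ _ _ du [de ue].
  apply: (orthonormal_eq hu); rewrite ?dotZl ?dd ?du ?d1 ?mulr1 ?mulr0 ?z1//.
  by rewrite u2// z2 mulr0.
have main p' q' : slice C r0 e 0 = segment p' q' ->
    dot (p' - r0) d < dot (q' - r0) d ->
    edge_data C r0 e1 e2 e d l1 l2 (dot (p' - r0) d) (dot (q' - r0) d).
  move=> hS lt_pq.
  have in_seg x : C x -> dot (x - r0) e = 0 ->
      dot (p' - r0) d <= dot (x - r0) d <= dot (q' - r0) d.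
    move=> Cx xe; have : slice C r0 e 0 x by split; rewrite //= oppr0.
    rewrite hS => -[a /= /andP[a0 a1] <-].
    have -> : dot ((1 - a) *: p' + a *: q' - r0) d =
        (1 - a) * dot (p' - r0) d + a * dot (q' - r0) d by rewrite !dot_linE; ring.
    by apply/andP; split; nra.
  have ends x : segment p' q' x -> C x /\ dot (x - r0) e = 0.
    by rewrite -hS => -[Cx] /=; rewrite oppr0.
  have [Cp pe] : C p' /\ dot (p' - r0) e = 0.
    by apply: ends; exists 0; rewrite /= ?lexx ?ler01// subr0 scale1r scale0r addr0.
  have [Cq qe] : C q' /\ dot (q' - r0) e = 0.
    by apply: ends; exists 1; rewrite /= ?lexx ?ler01// subrr scale1r scale0r add0r.
  have [|P0 Q0] := andP (in_seg r0 Cr0 _); first by rewrite subrr dot0l.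
  rewrite subrr dot0l in P0 Q0.
  split => //.
  - exact: (tangent_wedge_interior hC e11 e21 hcone).
  - by rewrite -(on_edge _ Cp pe).
  - by rewrite -(on_edge _ Cq qe).
have ends x : segment p q x -> C x /\ dot (x - r0) e = 0.
  by rewrite -hpq => -[Cx] /=; rewrite oppr0.
have [Cp pe] : C p /\ dot (p - r0) e = 0.
  by apply: ends; exists 0; rewrite /= ?lexx ?ler01// subr0 scale1r scale0r addr0.
have [Cq qe] : C q /\ dot (q - r0) e = 0.
  by apply: ends; exists 1; rewrite /= ?lexx ?ler01// subrr scale1r scale0r add0r.
have [lt_pq|lt_qp|pq_eq] := ltgtP (dot (p - r0) d) (dot (q - r0) d).
- by exists d, (dot (p - r0) d), (dot (q - r0) d); exact: main.
- by exists d, (dot (q - r0) d), (dot (p - r0) d); apply: main => //; rewrite segmentC.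
- by case: pq; rewrite (on_edge _ Cp pe) (on_edge _ Cq qe) pq_eq.
Qed.

(** * Weak convergence *)

Section IntegralBounds.
Context d (T : measurableType d) (R : realType) (m : {measure set T -> \bar R}).

Lemma Rintegral_near_cst (A : set T) (f : T -> R) (a eps : R) :
  measurable A -> (m A < +oo)%E -> m.-integrable A (EFin \o f) ->
  (forall x, A x -> `|f x - a| <= eps) ->
  `|Rintegral m A f - a * fine (m A)| <= eps * fine (m A).
Proof.
move=> mA mAfin intf fa.
have intc (b : R) : m.-integrable A (EFin \o cst b).
  apply: measurable_bounded_integrable => //; exists `|b|; split; first exact: num_real.
  by move=> y hy x _ /=; exact: ltW.
rewrite -(Rintegral_cst m mA a) -RintegralB//; last exact: intc.
have intB : m.-integrable A (EFin \o (fun x => f x - a)).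
  by rewrite (_ : _ \o _ = ((EFin \o f) \- (EFin \o cst a))%E)//; exact: integrableB.
apply: le_trans (le_normr_Rintegral mA intB) _.
rewrite -(Rintegral_cst m mA eps); apply: le_Rintegral => //.
  exact: integrable_norm.
exact: intc.
Qed.

Lemma Rintegral_two_pieces (S U1 U2 : set T) (f : T -> R) (a1 a2 B eps : R) :
  measurable S -> measurable U1 -> measurable U2 -> U1 `&` U2 = set0 ->
  (m S < +oo)%E -> m.-integrable S (EFin \o f) ->
  (forall x, S x -> `|f x| <= B) ->
  (forall x, (S `&` U1) x -> `|f x - a1| <= eps) ->
  (forall x, (S `&` U2) x -> `|f x - a2| <= eps) ->
  `|Rintegral m S f - a1 * fine (m (S `&` U1)) - a2 * fine (m (S `&` U2))| <=
    eps * (fine (m (S `&` U1)) + fine (m (S `&` U2))) +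
    B * (fine (m S) - fine (m (S `&` U1)) - fine (m (S `&` U2))).
Proof.
move=> mS mU1 mU2 U12 mSfin intf fB f1 f2.
pose A1 := S `&` U1; pose A2 := S `&` U2; pose A3 := S `\` (U1 `|` U2).
have mA1 : measurable A1 by exact: measurableI.
have mA2 : measurable A2 by exact: measurableI.
have mA3 : measurable A3 by apply: measurableD => //; exact: measurableU.
have A12 : [disjoint A1 & A2].
  by apply/eqP; rewrite /A1 /A2 setIACA U12 setI0.
have A123 : [disjoint (A1 `|` A2) & A3].
  by apply/eqP; rewrite /A1 /A2 -setIUr /A3 setDE setIACA setICr setI0.
have SE : S = A1 `|` A2 `|` A3.
  by rewrite /A1 /A2 -setIUr /A3 setDE -setIUr setUCr setIT.
have sub A : measurable A -> A `<=` S -> (m A < +oo)%E /\ m.-integrable A (EFin \o f).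
  move=> mA AS; split; last exact: integrableS intf.
  by apply: le_lt_trans mSfin; apply: le_measure; rewrite ?inE.
have [m1 i1] := sub _ mA1 (@subIsetl _ _ _).
have [m2 i2] := sub _ mA2 (@subIsetl _ _ _).
have [m3 i3] := sub _ mA3 (@subDsetl _ _ _).
have [m12 i12] : (m (A1 `|` A2) < +oo)%E /\ m.-integrable (A1 `|` A2) (EFin \o f).
  by apply: sub; [exact: measurableU|rewrite /A1 /A2 -setIUr; exact: subIsetl].
have fin A : (m A < +oo)%E -> m A \is a fin_num by move=> h; rewrite ge0_fin_numE.
have intE : Rintegral m S f = Rintegral m A1 f + Rintegral m A2 f + Rintegral m A3 f.
  rewrite {1}SE Rintegral_setU//; last by rewrite -SE.
    by rewrite Rintegral_setU.
  exact: measurableU.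
have mE : fine (m S) = fine (m A1) + fine (m A2) + fine (m A3).
  rewrite {1}SE measureU//; [|exact: measurableU|exact/eqP].
  by rewrite measureU ?(eqP A12)// !fineD ?fin_numD ?fin.
have h1 := Rintegral_near_cst mA1 m1 i1 f1.
have h2 := Rintegral_near_cst mA2 m2 i2 f2.
have h3 : `|Rintegral m A3 f - 0 * fine (m A3)| <= B * fine (m A3).
  by apply: Rintegral_near_cst => // x [Sx _]; rewrite subr0 fB.
rewrite -/A1 -/A2 intE mE; move: h1 h2 h3; rewrite !ler_norml.
by move=> /andP[? ?] /andP[? ?] /andP[? ?]; apply/andP; split; lra.
Qed.

End IntegralBounds.

(** The bounds force [xi - li] between [- gam] and [2 * gam], and leave at most [3 * gam] for the
    rest of the mass: this is the [7 * B]. The oscillation costs [eps * (l1 + l2)] for the limit and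
    at most [eps * (l1 + l2 + 1)] for the other integral. *)
Lemma two_atoms_bound (R : realType) (l1 l2 a1 a2 B eps gam gap x1 x2 X I I0 : R) :
  0 <= B -> 0 <= eps -> 0 <= gam -> gam <= 1 ->
  eps * (2 * (l1 + l2) + 1) = gap / 2 -> gam * (7 * B + 1) <= gap / 2 ->
  `|a1| <= B -> `|a2| <= B -> l1 - gam <= x1 -> l2 - gam <= x2 ->
  x1 + x2 <= X -> X <= l1 + l2 + gam ->
  `|I0 - a1 * l1 - a2 * l2| <= eps * (l1 + l2) + B * (l1 + l2 - l1 - l2) ->
  `|I - a1 * x1 - a2 * x2| <= eps * (x1 + x2) + B * (X - x1 - x2) ->
  `|I0 - I| <= gap.
Proof.
move=> B0 eps0 gam0 gam1 epsE gamB a1B a2B h1 h2 h12 hX hI0 hI.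
have d1 : `|a1 * (x1 - l1)| <= B * (2 * gam).
  by rewrite normrM ler_pM// ler_norml; apply/andP; split; lra.
have d2 : `|a2 * (x2 - l2)| <= B * (2 * gam).
  by rewrite normrM ler_pM// ler_norml; apply/andP; split; lra.
have b3 : B * (X - x1 - x2) <= B * (3 * gam) by rewrite ler_wpM2l//; lra.
have e3 : eps * (x1 + x2) <= eps * (l1 + l2 + 1) by rewrite ler_wpM2l//; lra.
move: hI0 hI d1 d2; rewrite !ler_norml => /andP[? ?] /andP[? ?] /andP[? ?] /andP[? ?].
by apply/andP; split; lra.
Qed.

Section SphereFunctions.
Variable R : realType.
Implicit Type f : 'rV[R]_3 -> R.

Lemma open_borel3 (A : set 'rV[R]_3) : open A -> measurable (A : set (borel3 R)).
Proof. by move=> oA; exact: sub_sigma_algebra. Qed.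

Lemma closed_borel3 (A : set 'rV[R]_3) : closed A -> measurable (A : set (borel3 R)).
Proof.
by move=> cA; rewrite -[A]setCK; apply: measurableC; apply: open_borel3; exact: closed_openC.
Qed.

Lemma measurable_sphere2 : measurable (@sphere2 R : set (borel3 R)).
Proof.
apply: closed_borel3; apply: (compact_closed _ (@compact_sphere2 R)).
exact: norm_hausdorff.
Qed.

Lemma sphere2_measurable_fun f : {within @sphere2 R, continuous f} ->
  measurable_fun (@sphere2 R : set (borel3 R)) (f : borel3 R -> R).
Proof.
move=> /continuousP cf; apply: (measurability _ (measurable_realfun.RGenOpens.measurableE R)).
move=> _ [_ [a [b ->] <-]].
have /open_subspaceP[V oV VE] : open ((f : subspace (@sphere2 R) -> R) @^-1` `]a, b[%classic).
  by apply: cf; exact: interval_open.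
rewrite setIC -VE; apply: measurableI; first exact: open_borel3.
exact: measurable_sphere2.
Qed.

Lemma sphere2_bounded f : {within @sphere2 R, continuous f} ->
  exists2 B, 0 <= B & forall x, enorm x = 1 -> `|f x| <= B.
Proof.
move=> cf; have [M [_ hM]] := compact_bounded (continuous_compact cf (@compact_sphere2 R)).
exists (`|M| + 1); first by rewrite addr_ge0.
move=> x x1; apply: (hM (`|M| + 1)).
  by rewrite (le_lt_trans (ler_norm M))// ltrDl.
by exists x.
Qed.

Lemma sphere2_near f (x : 'rV[R]_3) (eps : R) : {within @sphere2 R, continuous f} ->
  enorm x = 1 -> 0 < eps -> exists2 rho, 0 < rho &
  forall y, enorm y = 1 -> enorm (y - x) < rho -> `|f y - f x| <= eps.
Proof.
move=> cf x1 eps0.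
have /(@cvgrPdist_le _ _ _ _ (within_filter _ _)) /(_ eps eps0) :=
  (subspace_continuousP _ _).1 cf x x1.
move=> /nbhs_enormP[rho rho0 h]; exists rho => // y y1 yx.
by rewrite distrC; exact: h.
Qed.

End SphereFunctions.

Section LimitMeasure.
Variables (R : realType) (l1 l2 : R) (e1 e2 : 'rV[R]_3).
Hypotheses (l10 : 0 < l1) (l20 : 0 < l2).

Lemma nu_star_measure : exists m : {measure set (borel3 R) -> \bar R},
  (m : set (borel3 R) -> \bar R) = nu_star l1 l2 e1 e2.
Proof.
exists (measure_add (mscale (NngNum (ltW l10)) (dirac (e1 : borel3 R)))
                    (mscale (NngNum (ltW l20)) (dirac (e2 : borel3 R)))).
by apply/funext => A; exact: measure_addE.
Qed.

End LimitMeasure.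

(** * Masses of the normalized measures *)

Section NuAsymptotics.
Variables (R : realType) (C : set 'rV[R]_3) (r0 e1 e2 e d : 'rV[R]_3) (l1 l2 P Q : R).
Hypothesis H : edge_data C r0 e1 e2 e d l1 l2 P Q.

Definition sphere_nbhs (x : 'rV[R]_3) (rho : R) : set (borel3 R) :=
  @sphere2 R `&` [set y | enorm (y - x) < rho].

Lemma nu_asymptotics (rho gam : R) : 0 < rho -> 0 < gam -> \forall t \near 0^'+,
  exists m : {measure set (borel3 R) -> \bar R},
  [/\ (m : set (borel3 R) -> \bar R) = nu C r0 e t,
      (m (@sphere2 R : set (borel3 R)) <= (l1 + l2 + gam)%:E)%E,
      ((l1 - gam)%:E <= m (sphere_nbhs e1 rho))%E &
      ((l2 - gam)%:E <= m (sphere_nbhs e2 rho))%E].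
Proof.
move=> rho0 gam0; have hC := edge_body H.
have l10 := edge_l1 H; have l20 := edge_l2 H.
have c0 := area_unit_gt0 R.
have [w wE] : exists w, w = (Q - P) * wedge_width e1 e2 l1 l2 by eexists.
have wE2 : w = (Q - P) * wedge_width e2 e1 l2 l1 by rewrite wE wedge_widthC.
have w0 : 0 < w.
  by rewrite wE mulr_gt0 ?(wedge_width_gt0 H)// subr_gt0 (edge_PQ H).
(* From [ep * (1 + (l1 + l2) + gam) <= w * gam] follow [(w * (l1 + l2) + ep) / (w - ep) <= l1 + l2 +
   gam] and, for [l <= l1 + l2], [l - gam <= (w * l - ep) / (w + ep)]. *)
pose q := w * gam / (1 + (l1 + l2) + gam).
have den : 0 < 1 + (l1 + l2) + gam by lra.
have q0 : 0 < q by rewrite divr_gt0// mulr_gt0.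
have [ep [ep0 [eprho [epw epq]]]] : exists ep, 0 < ep /\ (ep < rho /\ (ep < w /\ ep < q)).
  by apply: (@filter_ex _ (0 : R)^'+); repeat apply: filterI;
    try exact: nbhs_right_gt; exact: nbhs_right_lt.
have epq' : ep * (1 + (l1 + l2) + gam) <= w * gam.
  by rewrite -ler_pdivlMr// ltW.
have cap_near := cap_asymptotics H ep0.
have face_near1 := face_asymptotics H ep0.
have face_near2 := face_asymptotics (edge_data_sym H) ep0.
rewrite -wE in cap_near face_near1; rewrite -wE2 in face_near2.
apply: filterS (filterI (nbhs_right_gt (0 : R))
  (filterI cap_near (filterI face_near1 face_near2))).
move=> t [t_gt0 [[s_ge s_le cap_le] [face1 face2]]]; have t0 : 0 < t := t_gt0.
pose E := cap C r0 e t `&` regular_bd C.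
have [u uE] : exists u, u = area_unit R * t by eexists.
have u0 : 0 < u by rewrite uE mulr_gt0.
have uM (a : R) : area_unit R * (a * t) = a * u by rewrite uE; ring.
rewrite !uM in s_ge s_le cap_le face1 face2.
pose s := fine (area (slice C r0 e t)).
have sE : area (slice C r0 e t) = s%:E.
  by rewrite fineK// ge0_fin_numE ?area_ge0// (le_lt_trans s_le) ?ltry.
rewrite sE !lee_fin in s_ge s_le.
have s0 : 0 < s by apply: lt_le_trans s_ge; rewrite mulr_gt0// subr_gt0.
have is0 : 0 < s^-1 by rewrite invr_gt0.
have [m mE] := normal_measure hC (@subIsetr _ _ _ : E `<=` regular_bd C) (NngNum (ltW is0)).
have lower (x : 'rV[R]_3) (l : R) : 0 < l -> l <= l1 + l2 ->
    (((w * l - ep) * u)%:E <= area (E `&` [set r | (enorm (normal C r - x) < ep)%R]))%E ->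
    ((l - gam)%:E <= m (sphere_nbhs x rho))%E.
  move=> l0 lL face; rewrite mE /=.
  apply: (@le_trans _ _ (s^-1%:E * ((w * l - ep) * u)%:E)%E); last first.
    rewrite lee_wpmul2l ?lee_fin ?(ltW is0)//; apply: le_trans face _.
    apply: subset_area => r [[rc rr] /= hr]; split => //; split => /=.
      by have [] := normalP rr.
    exact: lt_trans hr eprho.
  rewrite -EFinM lee_fin mulrC ler_pdivlMr//.
  have epl : 0 < ep * l by rewrite mulr_gt0.
  have epg : 0 < ep * gam by rewrite mulr_gt0.
  have epL : ep * l <= ep * (l1 + l2) by rewrite ler_pM2l.
  (* The sign of [l - gam] decides whether the upper or the lower bound on [s] is the one to use. *)
  have [lg|lg] := leP 0 (l - gam).
    apply: le_trans (ler_wpM2l lg s_le) _; rewrite mulrA ler_pM2r//; lra.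
  apply: le_trans (ler_wnM2l (ltW lg) s_ge) _; rewrite mulrA ler_pM2r//; lra.
exists m; split.
- by apply/funext => A; rewrite mE.
- rewrite mE/=; apply: (@le_trans _ _ (s^-1%:E * ((w * (l1 + l2) + ep) * u)%:E)%E).
    rewrite lee_wpmul2l ?lee_fin ?(ltW is0)//; apply: le_trans cap_le.
    by apply: subset_area => r [].
  rewrite -EFinM lee_fin mulrC ler_pdivrMr//.
  apply: (@le_trans _ _ ((l1 + l2 + gam) * ((w - ep) * u))).
    rewrite mulrA ler_pM2r//; lra.
  by rewrite ler_pM2l//; lra.
- by apply: lower face1 => //; lra.
- by apply: lower face2 => //; lra.
Qed.

End NuAsymptotics.

Theorem theorem1 (R : realType) (C : set 'rV[R]_3) (r0 e1 e2 e : 'rV[R]_3)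
    (lambda1 lambda2 : R)
    (hC : convex_body C)
    (hr0 : bd C r0)
    (he1 : enorm e1 = 1) (he2 : enorm e2 = 1)
    (hne : e1 <> e2) (hneN : e1 <> - e2)
    (hcone : tangent_cone C r0 =
       [set r | dot (r - r0) e1 <= 0 /\ dot (r - r0) e2 <= 0])
    (hl1 : 0 < lambda1) (hl2 : 0 < lambda2)
    (he : e = lambda1 *: e1 + lambda2 *: e2)
    (hen : enorm e = 1)
    (hB0 : exists p q : 'rV[R]_3, p <> q /\ slice C r0 e 0 = segment p q) :
  weakly_converges (nu C r0 e) (nu_star lambda1 lambda2 e1 e2).
Proof.
have [d [P [Q H]]] := edge_data_exists hC hr0 he1 he2 hne hneN hcone hl1 hl2 he hen hB0.
move=> f cf.
have [ms msE] := nu_star_measure e1 e2 hl1 hl2; rewrite -msE.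
have [B B0 fB] := sphere2_bounded cf.
have mS := @measurable_sphere2 R; have mf := sphere2_measurable_fun cf.
have L0 : 0 < lambda1 + lambda2 by rewrite addr_gt0.
have dist0 : 0 < enorm (e1 - e2) by apply: enorm_gt0 => /subr0_eq.
pose U (x : 'rV[R]_3) (rho : R) : set (borel3 R) := [set y | enorm (y - x) < rho].
have mU x rho : measurable (U x rho).
  apply: open_borel3.
  exact: (open_comp (fun y _ => @continuous_enormB R x y) (@open_lt R rho)).
have intf (m : {measure set (borel3 R) -> \bar R}) : (m sphere2 < +oo)%E ->
    m.-integrable sphere2 (EFin \o f).
  move=> moo; apply: measurable_bounded_integrable => //.
  exists B; split; first exact: num_real.
  by move=> y By x Sx; apply: le_trans (ltW By); exact: fB.
have msA A : ms A = (lambda1%:E * dirac (e1 : borel3 R) A + lambda2%:E * dirac (e2 : borel3 R) A)%E.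
  by rewrite msE.
have S1 : (e1 : borel3 R) \in (sphere2 : set (borel3 R)) by rewrite inE.
have S2 : (e2 : borel3 R) \in (sphere2 : set (borel3 R)) by rewrite inE.
have msS : ms sphere2 = (lambda1 + lambda2)%:E.
  by rewrite msA !diracE S1 S2 !mule1.
have intfE (m : {measure set (borel3 R) -> \bar R}) : (m sphere2 < +oo)%E ->
    (\int[m]_(x in (sphere2 : set (borel3 R))) (f x)%:E)%E = (Rintegral m sphere2 f)%:E.
  by move=> moo; rewrite /Rintegral fineK//; apply: integrable_fin_num => //; exact: intf.
have ms_oo : (ms sphere2 < +oo)%E by rewrite msS ltry.
rewrite (intfE ms)//.
(* Convergence in the extended reals to a finite limit asks for two things: integrals that are
   eventually finite, and closeness of their real values. *)
suff claim (gap : R) : 0 < gap -> \forall t \near 0^'+, exists2 I : R,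
    (\int[nu C r0 e t]_(x in (sphere2 : set (borel3 R))) (f x)%:E)%E = I%:E &
    `|Rintegral ms sphere2 f - I| <= gap.
  apply/fine_cvgP; split.
    by apply: filterS (claim 1 ltr01) => t [I -> _].
  apply/cvgrPdist_le => gap gap0.
  by apply: filterS (claim gap gap0) => t [I /= -> ].
move=> gap0.
pose eps := gap / (2 * (2 * (lambda1 + lambda2) + 1)).
have eps0 : 0 < eps by rewrite divr_gt0// mulr_gt0//; lra.
have epsE : eps * (2 * (lambda1 + lambda2) + 1) = gap / 2.
  by rewrite /eps; field; rewrite gt_eqF//; lra.
have B7 : 0 < 7 * B + 1 by lra.
pose gam := Num.min 1 (gap / (2 * (7 * B + 1))).
have gam0 : 0 < gam by rewrite lt_min ltr01 divr_gt0// mulr_gt0.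
have [gam1 gamB] : gam <= 1 /\ gam * (7 * B + 1) <= gap / 2.
  split; first by rewrite ge_min lexx.
  rewrite -ler_pdivlMr//; have -> : gap / 2 / (7 * B + 1) = gap / (2 * (7 * B + 1)).
    by field; rewrite gt_eqF.
  by rewrite ge_min lexx orbT.
have [rho1 rho10 near1] := sphere2_near cf he1 eps0.
have [rho2 rho20 near2] := sphere2_near cf he2 eps0.
(* Below [rho1] and [rho2] the function is almost constant on the two neighborhoods; below half the
   distance of [e1] and [e2] these are disjoint and each contains only its own atom. *)
have [rho [rho0 [rle1 [rle2 rled]]]] : exists rho, 0 < rho /\
    (rho < rho1 /\ (rho < rho2 /\ rho < enorm (e1 - e2) / 2)).
  by apply: (@filter_ex _ (0 : R)^'+); repeat apply: filterI;
    try exact: nbhs_right_gt; apply: nbhs_right_lt => //; rewrite divr_gt0.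
have disj : U e1 rho `&` U e2 rho = set0.
  apply/seteqP; split => // y [y1 y2].
  have {}y1 : enorm (y - e1) < rho := y1; have {}y2 : enorm (y - e2) < rho := y2.
  by exfalso; have := enorm_triangle e1 y e2; rewrite (enormB e1 y); lra.
have fU1 x : (sphere2 `&` U e1 rho) x -> `|f x - f e1| <= eps.
  by move=> [x1 /= xU]; apply: near1 => //; exact: lt_trans rle1.
have fU2 x : (sphere2 `&` U e2 rho) x -> `|f x - f e2| <= eps.
  by move=> [x1 /= xU]; apply: near2 => //; exact: lt_trans rle2.
have fe1 := fB _ he1; have fe2 := fB _ he2.
have pieces (m : {measure set (borel3 R) -> \bar R}) (moo : (m sphere2 < +oo)%E) :=
  Rintegral_two_pieces mS (mU e1 rho) (mU e2 rho) disj moo (intf m moo) fB fU1 fU2.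
have ms1 : ms (sphere2 `&` U e1 rho) = lambda1%:E.
  rewrite msA !diracE !in_setI S1 S2/= [_ \in _]mem_set/=; last first.
    by rewrite /U/= subrr enorm0.
  rewrite [_ \in _]memNset/= ?mule0 ?mule1 ?adde0// /U/= => h.
  by rewrite enormB in h; lra.
have ms2 : ms (sphere2 `&` U e2 rho) = lambda2%:E.
  rewrite msA !diracE !in_setI S1 S2/= [_ \in _]memNset/=; last first.
    by rewrite /U/= => h; lra.
  rewrite [_ \in _]mem_set/= ?mule0 ?mule1 ?add0e// /U/=.
  by rewrite subrr enorm0.
(* The same estimate serves the limit measure, which has no mass outside the two neighborhoods, and
   [nu] at time [t]. *)
have := pieces ms ms_oo; rewrite ms1 ms2 msS /= => hms.
apply: filterS (nu_asymptotics H rho0 gam0) => t [m [<- mSle m1 m2]].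
have moo : (m sphere2 < +oo)%E by rewrite (le_lt_trans mSle) ?ltry.
exists (Rintegral m sphere2 f); first exact: intfE.
have mI x : measurable (sphere2 `&` U x rho : set (borel3 R)) by exact: measurableI.
have mfin (A : set (borel3 R)) : measurable A -> A `<=` sphere2 ->
    exists x : R, m A = x%:E.
  move=> mA AS; exists (fine (m A)); rewrite fineK// ge0_fin_numE//.
  by apply: le_lt_trans moo; apply: le_measure; rewrite ?inE.
have x12 : (m (sphere2 `&` U e1 rho) + m (sphere2 `&` U e2 rho) <= m sphere2)%E.
  rewrite -measureU//; last by rewrite setIACA disj setI0.
  by apply: le_measure; rewrite ?inE//; [exact: measurableU|rewrite -setIUr; exact: subIsetl].
have [x1 E1] := mfin _ (mI e1) (@subIsetl _ _ _).
have [x2 E2] := mfin _ (mI e2) (@subIsetl _ _ _).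
have [X ES] := mfin _ mS (@subset_refl _ _).
have {}m1 : lambda1 - gam <= x1 by rewrite -lee_fin -E1; exact: m1.
have {}m2 : lambda2 - gam <= x2 by rewrite -lee_fin -E2; exact: m2.
have {}x12 : x1 + x2 <= X by rewrite -lee_fin EFinD -E1 -E2 -ES; exact: x12.
have {}mSle : X <= lambda1 + lambda2 + gam by rewrite -lee_fin -ES; exact: mSle.
have := pieces m moo; rewrite E1 E2 ES /= => hm.
exact: (two_atoms_bound B0 (ltW eps0) (ltW gam0) gam1 epsE gamB fe1 fe2 m1 m2 x12 mSle hms hm).
Qed.
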